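(* Let $n,K\in\mathbb{N}$, $\mu>0$, $p\in[0,1]$, $\omega\in[0,1]$, and let the clients' service times be i.i.d. copies of a random variable $B$ that is with probability $p$ Erlang distributed with $K$ phases of rate $\mu$ and with probability $1-p$ Erlang distributed with $K+1$ phases of rate $\mu$. Let $C_i(k,u)$, $\bar f^\circ_{k,u}(t)$, $\bar h^\circ_{k,u}$, $p_{k\ell,uv}(t)$, $P^\downarrow_{k,u}(t)$, $P^\uparrow_{k,u}(t)$ be as defined in the context. Then the $C_i(k,u)$ are determined recursively by: for $i = 1,\ldots,n-1$, $k = 1,\ldots,i$, and $u\geqslant 0$, $$C_i(k,u) = \inf_{t\geqslant 0} \Bigg(\omega \,\bar f^\circ_{k,u}(t) + (1-\omega) \,\bar h^\circ_{k,u} +\sum_{\ell=2}^{k} \int_{(0,t)} p_{k\ell,uv}(t) \,C_{i+1}(\ell,v) \,\mathrm{d}v+P^\downarrow_{k,u}(t)\, C_{i+1}(1,0) + P^\uparrow_{k,u}(t) \,C_{i+1}(k+1, u+t)\Bigg),$$ whereas, for $k=1,\ldots,n$ and $u\geqslant 0$, $$C_n(k,u) = (1-\omega) \,\bar h^\circ_{k,u}.$$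
   Context: Model. Clients $1,\ldots,n$ arrive punctually, in this order, at a single server that serves them in order of arrival without idling when clients are present. Service times are i.i.d. copies of $B$. Immediately after the arrival of client $i<n$, the time $t\geqslant 0$ until the arrival of client $i+1$ is chosen as a (Borel measurable) function of $i$, the number $k$ of clients then in the system (including the one just arrived and the one in service), and the elapsed service time $u$ of the client in service. In state $(k,u)$ the service time of the client in service is distributed as $B$ conditioned on $B>u$, independent of all other service times. A policy is a collection of such decision functions $\tau_j(\cdot,\cdot)\geqslant 0$, $j=1,\ldots,n-1$. Cost. $C_i(k,u)$ is the infimum over policies of the expected cost associated with the arrival of client $i$ onwards, given that immediately after this arrival there are $k$ clients in the system and the client in service has elapsed service time $u$. The cost is $\omega$ times the total time the server is idle between the arrival of client $i$ and the arrival of client $n$, plus $(1-\omega)\sum_{j=i}^n W_j$, where $W_j$ is the waiting time of client $j$ (from arrival to start of service). Notation. $\mathrm{E}(m,\mu)$ denotes an Erlang random variable with shape $m$ and rate $\mu$, $\mathrm{Bin}(m,q)$ a binomial random variable, $\mathrm{Pois}(m)$ a Poisson random variable with mean $m$. View $B$ as a phase process: start in phase $1$, each phase lasts an independent exponential time of rate $\mu$, move from phase $z$ to $z+1$ for $z<K$, and after phase $K$ move to phase $K+1$ with probability $1-p$ and finish with probability $p$; after phase $K+1$ finish. Let $\gamma_z(t)=\gamma_z^\circ(t)/\mathbb{P}(B>t)$, the conditional probability of being in phase $z$ at time $t$ given $B>t$, where $$\gamma_z^\circ(t)=e^{-\mu t}\frac{(\mu t)^{z-1}}{(z-1)!}\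 (z=1,\ldots,K),\quad \gamma_{K+1}^\circ(t)=(1-p)e^{-\mu t}\frac{(\mu t)^K}{K!},\quad \mathbb{P}(B>t)=\sum_{z=1}^{K+1}\gamma_z^\circ(t).$$ Idle time: let $f_j(t)=\int_0^t\mathbb{P}(\mathrm{E}(j,\mu)\leqslant s)\,\mathrm{d}s=t\,\mathbb{P}(\mathrm{Pois}(\mu t)\geqslant j)-\frac{j}{\mu}\mathbb{P}(\mathrm{Pois}(\mu t)\geqslant j+1)$. Define $$\bar f_{kz}(t)=\sum_{m=0}^k \mathbb{P}(\mathrm{Bin}(k,1-p)=m)\,f_{kK-z+1+m}(t)\quad (z=1,\ldots,K),$$ $$\bar f_{k,K+1}(t)=\sum_{m=0}^{k-1} \mathbb{P}(\mathrm{Bin}(k-1,1-p)=m)\,f_{(k-1)K+1+m}(t),$$ and $\bar f^\circ_{k,u}(t)=\sum_{z=1}^{K+1}\gamma_z(u)\bar f_{kz}(t)$. Waiting time: $\bar h_{1z}=0$, and for $k\geqslant 2$, $\bar h_{kz}=\frac{(k-1)(K+1-p)+1-z}{\mu}$ for $z=1,\ldots,K$ and $\bar h_{k,K+1}=\frac{(k-2)(K+1-p)+1}{\mu}$; $\bar h^\circ_{k,u}=\sum_{z=1}^{K+1}\gamma_z(u)\bar h_{kz}$. Transitions: $P^\uparrow_{k,u}(t)=\mathbb{P}(B>u+t)/\mathbb{P}(B>u)$. Further, $$P^\downarrow_{k,u}(t)=\sum_{z=1}^{K}\gamma_z(u)\sum_{m=0}^k\mathbb{P}(\mathrm{Bin}(k,1-p)=m)\,\mathbb{P}(\mathrm{E}(kK-z+1+m,\mu)\leqslant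 t)+\gamma_{K+1}(u)\sum_{m=0}^{k-1}\mathbb{P}(\mathrm{Bin}(k-1,1-p)=m)\,\mathbb{P}(\mathrm{E}((k-1)K+1+m,\mu)\leqslant t).$$ For integers $1\leqslant a<b$ let $\psi_{vt}[a,b]=\mathbb{P}(t-v\leqslant \mathrm{E}(a,\mu)\leqslant t,\ \mathrm{E}(a,\mu)+\mathrm{E}(b-a,\mu)>t)$ with the two Erlang variables independent. For $\ell=2,\ldots,k$ and $0<v<t$: for $z=1,\ldots,K$, with $I=(k-\ell+1)K-z+m+1$, $$q_{k\ell,z,v}(t)=\sum_{m=0}^{k-\ell+1}\mathbb{P}(\mathrm{Bin}(k-\ell+1,1-p)=m)\big(p\,\psi_{vt}[I,I+K]+(1-p)\,\psi_{vt}[I,I+K+1]\big),$$ and for $z=K+1$, with $I=(k-\ell)K+m+1$, $$q_{k\ell,K+1,v}(t)=\sum_{m=0}^{k-\ell}\mathbb{P}(\mathrm{Bin}(k-\ell,1-p)=m)\big(p\,\psi_{vt}[I,I+K]+(1-p)\,\psi_{vt}[I,I+K+1]\big).$$ Finally $p_{k\ell,uv}(t)=\sum_{z=1}^{K+1}\gamma_z(u)\,\frac{\partial}{\partial v}q_{k\ell,z,v}(t)$. *)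

(* Defs.v *)
(* MathComp-Analysis. *)
From HB Require Import structures.
From mathcomp Require Import all_boot all_order all_algebra.
From mathcomp Require Import all_classical all_reals all_analysis.
From mathcomp Require Import measurable_realfun.
From mathcomp Require Import ring.

Set Implicit Arguments.
Unset Strict Implicit.
Unset Printing Implicit Defensive.

Import Order.TTheory GRing.Theory Num.Theory.
Import numFieldNormedType.Exports.

Local Open Scope classical_set_scope.
Local Open Scope ring_scope.

(** * Erlang distribution *)

Section erlang_pdf.
Context {R : realType}.
Implicit Types (m : nat) (mu x : R).

Let erlang_pdfT m mu x : R :=
  mu ^+ m * x ^+ m.-1 * expR (- (mu * x)) / (m.-1)`!%:R.

Definition erlang_pdf m mu : R -> R := (erlang_pdfT m mu) \_ `[0, +oo[.

Lemma erlang_pdfE m mu x : 0 <= x ->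
  erlang_pdf m mu x = mu ^+ m * x ^+ m.-1 * expR (- (mu * x)) / (m.-1)`!%:R.
Proof. by move=> x0; rewrite /erlang_pdf patchE ifT// inE/= in_itv/= x0. Qed.

Lemma lt0_erlang_pdf m mu x : x < 0 -> erlang_pdf m mu x = 0.
Proof.
move=> x0; rewrite /erlang_pdf patchE ifF//.
by apply/negP; rewrite inE/= in_itv/= andbT; apply/negP; rewrite -ltNge.
Qed.

Lemma erlang_pdf_ge0 m mu x : 0 < mu -> 0 <= erlang_pdf m mu x.
Proof.
move=> mu0; apply: restrict_ge0 => {}x /=; rewrite in_itv/= andbT => x0.
by rewrite /erlang_pdfT !mulr_ge0 ?exprn_ge0 ?expR_ge0 ?invr_ge0// ltW.
Qed.

Let continuous_erlang_pdfT m mu : continuous (erlang_pdfT m mu).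
Proof.
move=> x; apply: cvgM; last exact: cvg_cst.
apply: cvgM; first by apply: cvgM; [exact: cvg_cst|exact: exprn_continuous].
apply: continuous_comp; last exact: continuous_expR.
by apply: cvgN; apply: cvgM; [exact: cvg_cst|exact: cvg_id].
Qed.

Lemma measurable_erlang_pdf m mu : measurable_fun [set: R] (erlang_pdf m mu).
Proof.
apply/measurable_restrict => //; apply: measurable_funTS.
exact: continuous_measurable_fun.
Qed.

Lemma within_continuous_erlang_pdf m mu :
  {within `[0, +oo[%classic, continuous (erlang_pdf m mu)}.
Proof.
apply: (@subspace_eq_continuous _ _ _ (erlang_pdfT m mu)); last first.
  by apply: continuous_subspaceT; exact: continuous_erlang_pdfT.
by move=> x x0; rewrite [RHS]/from_subspace /erlang_pdf patchE x0.
Qed.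

(* The integral of the density telescopes over [pois i] below. *)
Let pois mu i x : R := expR (- (mu * x)) * (mu * x) ^+ i / i`!%:R.

Let pois_fun mu i :
  pois mu i = (i`!%:R^-1 : R) \*:
    ((expR \o (- (mu \*: id))) * (mu \*: (id : R -> R)) ^+ i).
Proof.
by apply/funext => x; rewrite /pois mulrC /= exprfctE.
Qed.

Let is_derive_pois0 mu x :
  is_derive x (1 : R) (pois mu 0) (- erlang_pdfT 1 mu x).
Proof.
rewrite pois_fun /erlang_pdfT.
apply: is_derive_eq.
rewrite exprfctE opprfctE /GRing.scale/= !expr0 expr1 fact0 invr1.
by have -> : mu *: x = mu * x by []; ring.
Qed.

Let is_derive_poisS mu i x :
  is_derive x (1 : R) (pois mu i.+1)
    (erlang_pdfT i.+1 mu x - erlang_pdfT i.+2 mu x).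
Proof.
rewrite pois_fun /erlang_pdfT.
apply: is_derive_eq.
rewrite exprfctE opprfctE /GRing.scale/= factS natrM mulr1.
have -> : mu *: x = mu * x by [].
rewrite !exprMn !exprS.
by field; rewrite pnatr_eq0 -lt0n fact_gt0 nat1r pnatr_eq0.
Qed.

Let is_derive_poisson_cdf mu m x :
  is_derive x (1 : R) (- \sum_(i < m.+1) pois mu i)
    (erlang_pdfT m.+1 mu x).
Proof.
elim: m => [|m IH].
  rewrite big_ord1; have h := is_derive_pois0 mu x.
  by apply: is_derive_eq; rewrite opprK.
rewrite big_ord_recr/= opprD.
have h := is_derive_poisS mu m x.
by apply: is_derive_eq; rewrite opprB addrC subrK.
Qed.

Let pois_cvgy mu i : 0 < mu -> pois mu i x @[x --> +oo] --> 0.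
Proof.
move=> mu0.
have H : (i.+1%:R : R) / (mu * x) @[x --> +oo] --> (0 : R).
  rewrite -(mulr0 i.+1%:R); apply: cvgM; first exact: cvg_cst.
  apply/gtr0_cvgV0; last by apply: gt0_cvgMry => //; exact: cvg_id.
  by near=> x; rewrite mulr_gt0.
apply: (squeeze_cvgr _ _ H); last exact: cvg_cst.
near=> x.
have x0 : 0 < mu * x by rewrite mulr_gt0.
apply/andP; split.
  by rewrite /pois !mulr_ge0 ?expR_ge0 ?exprn_ge0 ?invr_ge0// ltW.
rewrite /pois expRN -mulrA mulrC ler_pdivrMr ?expR_gt0//.
have := expR_ge1Dxn i (ltW x0).
move=> /(le_trans (ler_wpDl ler01 (lexx _))) h.
have -> : (mu * x) ^+ i / i`!%:R =
    i.+1%:R / (mu * x) * ((mu * x) ^+ i.+1 / i.+1`!%:R).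
  rewrite factS natrM exprS; field.
  by rewrite pnatr_eq0 -lt0n fact_gt0 nat1r pnatr_eq0/= -negb_or -mulf_eq0 mulrC lt0r_neq0.
by rewrite ler_wpM2l// divr_ge0// ltW.
Unshelve. all: by end_near. Qed.

Let sum_pois_cvgy mu m : 0 < mu ->
  \sum_(i < m) pois mu i @ +oo --> (0 : R).
Proof.
move=> mu0; elim: m => [|m IH]; first by rewrite big_ord0; exact: cvg_cst.
rewrite big_ord_recr/= -[X in _ --> X]addr0.
by apply: cvgD => //; exact: pois_cvgy.
Qed.

Lemma integral_erlang_pdf m mu : (0 < m)%N -> 0 < mu ->
  (\int[lebesgue_measure]_x (erlang_pdf m mu x)%:E = 1)%E.
Proof.
case: m => // m _ mu0.
have mE : measurable_fun setT (EFin \o erlang_pdf m.+1 mu).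
  by apply/measurable_EFinP; exact: measurable_erlang_pdf.
rewrite -(setUv `[0, +oo[%classic) ge0_integral_setU//=; last 4 first.
  exact: measurableC.
  by rewrite setUv.
  by move=> x _; rewrite lee_fin erlang_pdf_ge0.
  exact/disj_setPCl.
rewrite [X in (_ + X)%E]integral0_eq ?adde0; last first.
  by move=> x x0; rewrite /erlang_pdf patchE ifF// memNset.
have F0 x := is_derive_poisson_cdf mu m x.
rewrite (@ge0_continuous_FTC2y _ _ (- \sum_(i < m.+1) pois mu i) _ 0)//.
- rewrite opprfctE fct_sumE big_ord_recl /pois big1 ?addr0; last first.
    by move=> i _; rewrite mulr0 exprS mul0r mulr0 mul0r.
  by rewrite mulr0 oppr0 expR0 expr0 fact0 divr1 mulr1 EFinN oppeK add0e.
- by move=> x _; apply: erlang_pdf_ge0.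
- exact: within_continuous_erlang_pdf.
- by rewrite -[X in _ --> X]oppr0; apply: cvgN; exact: sum_pois_cvgy.
- apply: cvg_at_right_filter.
  by apply: differentiable_continuous; apply/derivable1_diffP.
- move=> x; rewrite in_itv/= andbT => x0.
  by rewrite derive1E derive_val erlang_pdfE// ltW.
Qed.

End erlang_pdf.

(* The degenerate parameters are sent to a Dirac mass so that [erlang_prob] is
   unconditionally a probability measure, as for [binomial_prob]. *)
Definition erlang_prob {R : realType} (m : nat) (mu : R) : set R -> \bar R :=
  fun A => if (0 < m)%N && (0 < mu) then
    (\int[lebesgue_measure]_(x in A) (erlang_pdf m mu x)%:E)%E
  else \d_(0 : R) A.

Section erlang_prob.
Context {R : realType} (m : nat) (mu : R).
Local Open Scope ereal_scope.
Local Notation erlang := (erlang_prob m mu).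

Let erlang0 : erlang set0 = 0.
Proof. by rewrite /erlang measure0; case: ifPn => //; rewrite integral_set0. Qed.

Let erlang_ge0 A : 0 <= erlang A.
Proof.
rewrite /erlang; case: ifPn => // /andP[_ mu0].
by apply: integral_ge0 => x _; rewrite lee_fin erlang_pdf_ge0.
Qed.

Let erlang_sigma_additive : semi_sigma_additive erlang.
Proof.
move=> /= F mF tF mUF; rewrite /erlang; case: ifPn => [/andP[_ mu0]|_]; last first.
  exact: measure_semi_sigma_additive.
apply: cvg_toP.
  apply: ereal_nondecreasing_is_cvgn => a b ab.
  apply: lee_sum_nneg_natr => // k _ _; apply: integral_ge0 => /= x Fkx.
  by rewrite lee_fin erlang_pdf_ge0.
rewrite ge0_integral_bigcup//=.
- apply/measurable_funTS/measurableT_comp => //.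
  exact: measurable_erlang_pdf.
- by move=> x _; rewrite lee_fin erlang_pdf_ge0.
Qed.

HB.instance Definition _ := isMeasure.Build _ _ _
  erlang erlang0 erlang_ge0 erlang_sigma_additive.

Let erlang_setT : erlang [set: R] = 1.
Proof.
rewrite /erlang; case: ifPn => [/andP[m0 mu0]|_]; last exact: probability_setT.
exact: integral_erlang_pdf.
Qed.

HB.instance Definition _ :=
  @Measure_isProbability.Build _ _ R erlang erlang_setT.

End erlang_prob.

(** * The appointment system

    Clients are numbered from [1]; [s j] is the service time of client [j].  The
    state [x = (k, u)] right after the arrival of client [j] consists of the
    number [k] of clients present (clients [(j - k).+1], ..., [j]) and the elapsed
    service time [u] of client [(j - k).+1], who is in service. *)

Section system.
Context {R : realType}.
Implicit Types (s : nat -> R) (tau : nat -> nat -> R -> R) (x : nat * R).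

(* Time, counted from the arrival of client [j], at which [r] of the clients
   present have been served, if the server does not run out of clients before;
   for [r = 0] this is [- x.2], the start of the service in progress. *)
Definition completion s (j : nat) x (r : nat) : R :=
  \sum_((j - x.1).+1 <= m < (j - x.1).+1 + r) s m - x.2.

Definition departures s j x (t : R) : nat :=
  (\sum_(1 <= r < x.1.+1) (completion s j x r <= t)%R)%N.

(* State right after the arrival of client [j.+1], at time [t] after the arrival
   of client [j]. If all clients have left, client [j.+1] starts service at once;
   otherwise the service in progress started upon the last departure (or
   [x.2] before the arrival of client [j], if nobody has left). *)
Definition next_state s j x (t : R) : nat * R :=
  let r := departures s j x t in
  ((x.1 - r).+1, if (r < x.1)%N then t - completion s j x r else 0).

(* Server idle time between the arrivals of clients [j] and [j.+1]. *)
Definition idle_time s j x (t : R) : R := Num.max 0 (t - completion s j x x.1).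

(* Waiting time of client [j]: zero if alone, even in the state [(1, u)], [u > 0]. *)
Definition waiting_time s j x : R :=
  if (x.1 <= 1)%N then 0 else completion s j x x.1.-1.

(* [tau j k u] is the time until the arrival of client [j.+1]. *)
Definition is_policy tau : Prop :=
  forall j k, measurable_fun [set: R] (tau j k) /\ forall u, 0 <= tau j k u.

Definition decision tau j x : R := tau j x.1 x.2.

(* State right after the arrival of client [i + e], starting from [x] right
   after the arrival of client [i]. *)
Fixpoint state tau s (i : nat) x (e : nat) : nat * R :=
  if e is e'.+1 then
    let y := state tau s i x e' in
    next_state s (i + e') y (decision tau (i + e') y)
  else x.

Definition cost (omega : R) (n : nat) tau s (i : nat) x : R :=
  omega * (\sum_(i <= j < n)
    let y := state tau s i x (j - i) in idle_time s j y (decision tau j y))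
  + (1 - omega) * (\sum_(i <= j < n.+1)
    waiting_time s j (state tau s i x (j - i))).

End system.

Section value.
Context d (T : measurableType d) (R : realType) (P : probability T R).

Definition cond_expectation (X : T -> R) (A : set T) : \bar R :=
  ((fine (P A))^-1%:E * \int[P]_(w in A) (X w)%:E)%E.

(* Mutual independence of the service times of clients [1, ..., n]; subfamilies
   are covered by taking [A j = setT]. *)
Definition mutually_independent (n : nat) (S : nat -> {RV P >-> R}) : Prop :=
  forall A : nat -> set R, (forall j, measurable (A j)) ->
    P (\bigcap_(j in [set j | (1 <= j <= n)%N]) (S j @^-1` A j)) =
    (\prod_(1 <= j < n.+1) P (S j @^-1` A j))%E.

(* In the state [(k, u)] at the arrival of client [i], the service time of client
   [(i - k).+1] has the law of [B] given [B > u], and is independent of the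
   service times of the later clients, which are copies of [B]: we condition the
   i.i.d. family [S] on [S (i - k).+1 > u]. *)
Definition min_cost (S : nat -> {RV P >-> R}) (omega : R) (n i k : nat) (u : R)
    : \bar R :=
  ereal_inf
    [set cond_expectation (fun w => cost omega n tau (fun j => S j w) i (k, u))
           [set w | u < S (i - k).+1 w] | tau in [set tau | is_policy tau]].

Definition erlang_mixture (K : nat) (mu p : R) (B : {RV P >-> R}) : Prop :=
  forall A, measurable A ->
    (distribution P B A =
     p%:E * erlang_prob K mu A + (1 - p)%:E * erlang_prob K.+1 mu A)%E.

End value.

(** * Coefficients of the recursion *)

Section coefficients.
Context {R : realType}.
Variables (K : nat) (mu p : R).

Definition erlang_cdf (m : nat) (t : R) : R := fine (erlang_prob m mu `]-oo, t]).

Definition idle_erlang (j : nat) (t : R) : R :=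
  (\int[lebesgue_measure]_(s in `[0%R, t]) erlang_cdf j s)%R.

Definition fbar_phase (k z : nat) (t : R) : R :=
  if (z <= K)%N then
    \sum_(0 <= m < k.+1) binomial_pmf k (1 - p) m *
      idle_erlang (k * K - z + 1 + m) t
  else
    \sum_(0 <= m < k) binomial_pmf k.-1 (1 - p) m *
      idle_erlang (k.-1 * K + 1 + m) t.

Definition hbar_phase (k z : nat) : R :=
  if (k <= 1)%N then 0
  else if (z <= K)%N then
    ((k%:R - 1) * (K%:R + 1 - p) + 1 - z%:R) / mu
  else ((k%:R - 2) * (K%:R + 1 - p) + 1) / mu.

(* The two Erlang variables are the coordinates under the product measure. *)
Definition psi (v t : R) (a b : nat) : R :=
  fine ((erlang_prob a mu \x erlang_prob (b - a) mu)%E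
    [set xy : R * R | t - v <= xy.1 <= t /\ t < xy.1 + xy.2]).

Definition psi_mix (v t : R) (I : nat) : R :=
  p * psi v t I (I + K) + (1 - p) * psi v t I (I + K + 1).

Definition q_phase (k l z : nat) (v t : R) : R :=
  if (z <= K)%N then
    \sum_(0 <= m < (k - l + 1).+1) binomial_pmf (k - l + 1) (1 - p) m *
      psi_mix v t ((k - l + 1) * K - z + m + 1)
  else
    \sum_(0 <= m < (k - l).+1) binomial_pmf (k - l) (1 - p) m *
      psi_mix v t ((k - l) * K + m + 1).

Definition down_phase (k z : nat) (t : R) : R :=
  if (z <= K)%N then
    \sum_(0 <= m < k.+1) binomial_pmf k (1 - p) m *
      erlang_cdf (k * K - z + 1 + m) t
  else
    \sum_(0 <= m < k) binomial_pmf k.-1 (1 - p) m *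
      erlang_cdf (k.-1 * K + 1 + m) t.

Definition phase_weight (z : nat) (t : R) : R :=
  if (z <= K)%N then expR (- (mu * t)) * (mu * t) ^+ z.-1 / (z.-1)`!%:R
  else (1 - p) * expR (- (mu * t)) * (mu * t) ^+ K / K`!%:R.

Context d (T : measurableType d) (P : probability T R).
Variable B : {RV P >-> R}.

Definition survival (t : R) : R := fine (ccdf B t).

Definition phase_prob (z : nat) (t : R) : R := phase_weight z t / survival t.

Definition fbar (k : nat) (u t : R) : R :=
  \sum_(1 <= z < K.+2) phase_prob z u * fbar_phase k z t.

Definition hbar (k : nat) (u : R) : R :=
  \sum_(1 <= z < K.+2) phase_prob z u * hbar_phase k z.

Definition p_dens (k l : nat) (u v t : R) : R :=
  \sum_(1 <= z < K.+2) phase_prob z u * (fun v' => q_phase k l z v' t)^`()%classic v.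

Definition P_down (k : nat) (u t : R) : R :=
  \sum_(1 <= z < K.+2) phase_prob z u * down_phase k z t.

Definition P_up (u t : R) : R := survival (u + t) / survival u.

End coefficients.

(* Main.v *)
Require Import Defs.
From HB Require Import structures.
From mathcomp Require Import all_boot all_order all_algebra.
From mathcomp Require Import all_classical all_reals all_analysis.
From mathcomp Require Import measurable_realfun.
From mathcomp Require Import ring lra zify.

Set Implicit Arguments.
Unset Strict Implicit.
Unset Printing Implicit Defensive.

Import Order.TTheory GRing.Theory Num.Theory.
Import numFieldNormedType.Exports.

Local Open Scope classical_set_scope.
Local Open Scope ring_scope.

(** In the state [(k, u)] the service in progress is in phase [z] with conditional
    probability [phase_prob z u], and given [z] the time until the [r]-th departure is a
    binomial mixture of Erlang variables. This rests on two identities: the density of an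
    Erlang variable at [u + x] is a combination, with the weights of a Poisson variable in
    [u], of Erlang densities at [x], and Erlang densities of the same rate are stable under
    convolution. Conditioning on the time of the last departure before the next arrival then
    expresses the expected cost of a fixed policy by the Bellman operator applied to the
    expected cost from the next arrival onwards; the derivative of [psi] is the product of
    an Erlang density and an Erlang tail, which is how [p_dens] arises.

    Passing to the infimum over policies requires measurable near-optimal decisions. By
    backward induction the optimal cost is bounded, measurable in [u] and upper
    semicontinuous from the right, and the Bellman operator preserves the latter both in [u]
    and in [t]. The infimum over [t] is therefore an infimum over the nonnegative rationals,
    and the first near-optimal rational in an enumeration is a measurable choice. *)

(** * Erlang distributions *)

(** Until the very end, costs are integrated over the event that the service in progress exceeds
    [u], without division by its probability. In this form an arrival without departures is the
    plain shift to [u + t], and the factor [survival B v] in the derivative of [q_phase] cancels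
    against the normalization of the next cost. The recursion closes because, for [0 < r < k],
    exactly [r] clients leave when the [r]-th departure occurs at some [x <= t] and the next service
    exceeds [t - x]: the latter is the conditioning event of the next state and concerns services
    independent of [x]. The obstacle to the upper bound is that one policy must serve every state
    reachable at the next arrival, so the induction carries policies that are near-optimal at all
    states simultaneously. The Bellman operator amplifies a uniform error by at most
    [(K + 1) k + 1]: once for each of [k] terms in each of [K + 1] phases, and once for the case
    without departures. Tolerances are divided by this constant. *)

Section lebesgue_reflection.
Context {R : realType}.
Notation leb := (@lebesgue_measure R).
Local Open Scope ereal_scope.

Lemma measurable_reflection (c : R) : measurable_fun setT (fun x : R => (c - x)%R).
Proof. by apply: measurable_funB => //; exact: measurable_cst. Qed.

(** A reflection turns a half-open interval into one that is closed at the other end and has the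
    same length; uniqueness of Lebesgue measure then gives all measurable sets. *)
Lemma lebesgue_measure_reflection (c : R) (A : set R) : measurable A ->
  leb ((fun x => c - x)%R @^-1` A) = leb A.
Proof.
move=> mA.
pose f : measurableTypeR R -> measurableTypeR R := fun x => (c - x)%R.
have mf : measurable_fun setT f by exact: measurable_reflection.
pose F : {mfun measurableTypeR R >-> measurableTypeR R} :=
  HB.pack f (isMeasurableFun.Build _ _ _ _ _ mf).
rewrite [RHS](@lebesgue_measure_unique R (pushforward leb F))//.
move=> _ [[a b] _ <-] /=.
rewrite /pushforward /=.
rewrite (_ : F @^-1` _ = `[(c - b)%R, (c - a)%R[%classic); last first.
  apply/seteqP; split => x /=; rewrite !in_itv/= /f; lra.
rewrite !lebesgue_measure_itv/= !lte_fin ltrD2l ltrN2.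
by case: ifPn => // _; rewrite -!EFinB; congr EFin; ring.
Qed.

Lemma ge0_integral_reflection (c : R) (f : R -> \bar R) :
  measurable_fun setT f -> (forall x, 0 <= f x) ->
  \int[leb]_x f (c - x)%R = \int[leb]_x f x.
Proof.
move=> mf f0.
pose g : measurableTypeR R -> measurableTypeR R := fun x => (c - x)%R.
have mg : measurable_fun setT g by exact: measurable_reflection.
pose F : {mfun measurableTypeR R >-> measurableTypeR R} :=
  HB.pack g (isMeasurableFun.Build _ _ _ _ _ mg).
transitivity (\int[pushforward leb F]_x f x).
  by rewrite ge0_integral_pushforward//= => y _; exact: f0.
apply: eq_measure_integral => A mA _.
exact: lebesgue_measure_reflection.
Qed.

(** A translation is a composition of two reflections. *)
Lemma ge0_integral_translation (c : R) (f : R -> \bar R) :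
  measurable_fun setT f -> (forall x, 0 <= f x) ->
  \int[leb]_x f (c + x)%R = \int[leb]_x f x.
Proof.
move=> mf f0.
rewrite -[RHS](ge0_integral_reflection c)//.
rewrite -[RHS](@ge0_integral_reflection 0 (fun x => f (c - x)%R))//; last first.
  by apply: measurableT_comp => //; exact: measurable_reflection.
by apply: eq_integral => x _; congr f; rewrite sub0r opprK.
Qed.

End lebesgue_reflection.

(** * Integration against a measure with a density *)

Section integral_density.
Import HBNNSimple.
Context d (T : measurableType d) (R : realType).
Variables (mu nu : {measure set T -> \bar R}) (f : T -> R).
Local Open Scope ereal_scope.
Hypotheses (mf : measurable_fun setT f) (f0 : forall x, (0 <= f x)%R).
Hypothesis nuE : forall A, measurable A -> nu A = \int[mu]_(x in A) (f x)%:E.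

Let integral_density_indic (A : set T) : measurable A ->
  \int[nu]_x (\1_A x)%:E = \int[mu]_x ((f x)%:E * (\1_A x)%:E).
Proof.
move=> mA; rewrite integral_indic// setIT nuE// integral_mkcond.
apply: eq_integral => x _; rewrite /patch indicE.
by case: ifPn; rewrite (mule1, mule0).
Qed.

Let integral_density_nnsfun (g : {nnsfun T >-> R}) :
  \int[nu]_x (g x)%:E = \int[mu]_x ((f x)%:E * (g x)%:E).
Proof.
under [LHS]eq_integral do rewrite fimfunE -fsumEFin//.
rewrite [LHS]ge0_integral_fsum//; last 2 first.
  - by move=> r; exact/measurable_EFinP/measurableT_comp.
  - by move=> n x _; rewrite EFinM nnfun_muleindic_ge0.
have rge0 r x : 0 <= (r * \1_(g @^-1` [set r]) x)%:E.
  by rewrite EFinM nnfun_muleindic_ge0.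
transitivity (\int[mu]_x (\sum_(y \in range g)
    (f x)%:E * (y * \1_(g @^-1` [set y]) x)%:E)); last first.
  by apply: eq_integral => x _; rewrite [in RHS]fimfunE -fsumEFin// ge0_mule_fsumr.
rewrite [RHS]ge0_integral_fsum//; last 2 first.
  - move=> r; apply: emeasurable_funM; first exact/measurable_EFinP.
    exact/measurable_EFinP/measurableT_comp.
  - by move=> r x _; apply: mule_ge0 => //; rewrite lee_fin.
apply: eq_fsbigr => r /[!inE] -[x _ <-] {r}.
have gx0 : (0 <= (g x)%:E) by rewrite lee_fin.
have mfE : measurable_fun setT (EFin \o f) by exact/measurable_EFinP.
under [LHS]eq_integral do rewrite EFinM.
rewrite ge0_integralZl//; last by exact/measurable_EFinP.
rewrite integral_density_indic//.
under [RHS]eq_integral do rewrite EFinM muleCA.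
rewrite ge0_integralZl//.
- by apply: emeasurable_funM => //; exact/measurable_EFinP.
- by move=> y _; apply: mule_ge0 => //; rewrite lee_fin.
Qed.

Lemma ge0_integral_density (g : T -> \bar R) : measurable_fun setT g ->
  (forall x, 0 <= g x) -> \int[nu]_x g x = \int[mu]_x ((f x)%:E * g x).
Proof.
move=> mg g0; pose g_ := nnsfun_approx measurableT mg.
transitivity (limn (fun n => \int[nu]_x (g_ n x)%:E)).
  rewrite -monotone_convergence//=.
  - apply: eq_integral => ? /[!inE] xD; apply/esym/cvg_lim => //=.
    exact: cvg_nnsfun_approx.
  - by move=> n; exact/measurable_EFinP/measurable_funTS.
  - by move=> n ? _; rewrite lee_fin.
  - by move=> ? _ ? ? mn; rewrite lee_fin; exact/lefP/nd_nnsfun_approx.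
under eq_fun do rewrite integral_density_nnsfun.
rewrite -monotone_convergence//=.
- apply: eq_integral => x _; rewrite limeMl//.
  + by congr (_ * _); apply/cvg_lim => //; exact: cvg_nnsfun_approx.
  + by apply: cvgP; exact: cvg_nnsfun_approx.
- by move=> n; apply: emeasurable_funM => //; exact/measurable_EFinP/measurable_funTS.
- by move=> n x _; rewrite mule_ge0 ?lee_fin.
- move=> x _ a b ab; apply: lee_wpmul2l; rewrite lee_fin//.
  exact/lefP/nd_nnsfun_approx.
Qed.

End integral_density.

(** * Erlang densities: shifts and convolutions *)

Section erlang_density.
Context {R : realType}.
Notation leb := (@lebesgue_measure R).
Implicit Types (mu x u s : R) (i j a b : nat).

(** The probability that a Poisson process of rate [mu] has exactly [i] points up to time [x], that
    is, that a phase process without end is in phase [i.+1]. *)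
Definition poisson_weight mu i x : R := expR (- (mu * x)) * (mu * x) ^+ i / i`!%:R.

Lemma poisson_weight_ge0 mu i x : 0 < mu -> 0 <= x -> 0 <= poisson_weight mu i x.
Proof.
by move=> mu0 x0; rewrite !mulr_ge0 ?expR_ge0 ?exprn_ge0 ?invr_ge0// mulr_ge0// ltW.
Qed.

Lemma poisson_weight_le1 mu i x : 0 < mu -> 0 <= x -> poisson_weight mu i x <= 1.
Proof.
move=> mu0 x0; have mx0 : 0 <= mu * x by rewrite mulr_ge0// ltW.
rewrite /poisson_weight expRN -mulrA mulrC ler_pdivrMr ?expR_gt0// mul1r.
case: i => [|i].
  by rewrite expr0 fact0 divr1 -expR0 ler_expR.
by have := expR_ge1Dxn i mx0; apply: le_trans; rewrite lerDr.
Qed.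

Lemma erlang_pdfS mu j x : 0 <= x ->
  erlang_pdf j.+1 mu x = mu * poisson_weight mu j x.
Proof.
move=> x0; rewrite erlang_pdfE//= /poisson_weight exprMn exprS.
by rewrite -!mulrA; congr (_ * _); ring.
Qed.

Lemma erlang_pdf_le mu j x : 0 < mu -> (0 < j)%N -> erlang_pdf j mu x <= mu.
Proof.
case: j => // j mu0 _; have [x0|x0] := ltP x 0.
  by rewrite lt0_erlang_pdf// ltW.
by rewrite erlang_pdfS// ler_piMr ?poisson_weight_le1// ltW.
Qed.

(** This is the binomial expansion of [(u + x) ^+ j]. In probabilistic terms, [i] phases are
    completed by time [u], and by memorylessness a fresh Erlang variable of the remaining shape is
    left. *)
Lemma erlang_pdf_shift mu j u x : 0 <= u -> 0 <= x ->
  erlang_pdf j.+1 mu (u + x) =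
  \sum_(i < j.+1) poisson_weight mu i u * erlang_pdf (j - i).+1 mu x.
Proof.
move=> u0 x0; rewrite erlang_pdfS ?addr_ge0// /poisson_weight mulrDr opprD expRD.
rewrite addrC exprDn [in RHS](eq_bigr (fun i : 'I_j.+1 =>
  mu * (expR (- (mu * u)) * expR (- (mu * x))) / j`!%:R *
  ((mu * x) ^+ (j - i) * (mu * u) ^+ i *+ 'C(j, i)))); last first.
  move=> i _; rewrite erlang_pdfS// /poisson_weight.
  have ij : (i <= j)%N by rewrite -ltnS.
  rewrite -(bin_fact ij) -mulr_natl !natrM.
  have f0 k : k`!%:R != 0 :> R by rewrite pnatr_eq0 -lt0n fact_gt0.
  have C0 : 'C(j, i)%:R != 0 :> R by rewrite pnatr_eq0 -lt0n bin_gt0.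
  by field; rewrite !f0 C0.
rewrite -big_distrr/= -!mulrA; congr (_ * _).
by ring.
Qed.

Let T a b s x := x ^+ a / a`!%:R * ((s - x) ^+ b / b`!%:R).

(** Repeated integration by parts, carried out on primitives: each step raises the power of [x] and
    lowers that of [s - x], and the boundary term vanishes at both [0] and [s]. The normalization by
    factorials keeps all coefficients equal to [1]. *)
Let T_primitive a b s : exists2 F : R -> R,
  (forall x, is_derive x (1 : R) F (T a b s x)) &
  F s - F 0 = s ^+ (a + b).+1 / (a + b).+1`!%:R.
Proof.
have f0 k : k`!%:R != 0 :> R by rewrite pnatr_eq0 -lt0n fact_gt0.
have n0 k : k.+1%:R != 0 :> R by rewrite pnatr_eq0.
have dpow k x : is_derive x (1 : R) (fun x : R => x ^+ k.+1 / k.+1`!%:R) (x ^+ k / k`!%:R).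
  have -> : (fun x : R => x ^+ k.+1 / k.+1`!%:R) = (k.+1`!%:R)^-1 \*: (@id R) ^+ k.+1.
    by apply/funext => y; rewrite /= exprfctE mulrC.
  apply: is_derive_eq; rewrite /GRing.scale/= mulr1 factS natrM.
  by field; rewrite f0 ?nat1r n0.
have dpow' k x : is_derive x (1 : R) (fun x : R => (s - x) ^+ k.+1 / k.+1`!%:R)
    (- ((s - x) ^+ k / k`!%:R)).
  have -> : (fun x : R => (s - x) ^+ k.+1 / k.+1`!%:R) =
      (k.+1`!%:R)^-1 \*: (cst s - @id R) ^+ k.+1.
    by apply/funext => y; rewrite /= exprfctE mulrC.
  apply: is_derive_eq; rewrite /GRing.scale/= factS natrM.
  by field; rewrite f0 ?nat1r n0.
elim: b a => [|b IH] a.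
  exists (fun x => x ^+ a.+1 / a.+1`!%:R) => [x|].
    by apply: is_derive_eq (dpow a x) _; rewrite /T expr0 fact0 divr1 mulr1.
  by rewrite expr0n/= mul0r subr0 addn0.
have [F dF Fs] := IH a.+1.
exists (fun x => T a.+1 b.+1 s x + F x) => [x|].
  have h1 := dpow a x; have h2 := dpow' b x; have h3 := dF x.
  rewrite (_ : (fun x => _) = (fun x : R => x ^+ a.+1 / a.+1`!%:R) *
     (fun x : R => (s - x) ^+ b.+1 / b.+1`!%:R) + F)//.
  by apply: is_derive_eq; rewrite /T /GRing.scale/=; ring.
by rewrite /T subrr !expr0n/= !mul0r mulr0 !add0r Fs addSnnS.
Qed.

(** The integrand lives on [[0, s]], where the two exponentials merge into a constant and a beta
    integral remains. At [s = 0] the right-hand side vanishes because its shape is at least [2]. *)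
Lemma erlang_pdf_convolution mu a b s : 0 < mu -> (0 < a)%N -> (0 < b)%N ->
  (\int[leb]_x (erlang_pdf a mu x * erlang_pdf b mu (s - x))%:E =
   (erlang_pdf (a + b) mu s)%:E)%E.
Proof.
case: a => // a; case: b => // b mu0 _ _.
have conv0 x : x \notin `[0, s] ->
    erlang_pdf a.+1 mu x * erlang_pdf b.+1 mu (s - x) = 0.
  rewrite in_itv/= negb_and -!ltNge => /orP[x0|sx].
    by rewrite lt0_erlang_pdf ?mul0r.
  by rewrite (@lt0_erlang_pdf _ b.+1) ?mulr0// subr_lt0.
have -> : (\int[leb]_x (erlang_pdf a.+1 mu x * erlang_pdf b.+1 mu (s - x))%:E =
   \int[leb]_(x in `[0%R, s])
     (mu ^+ (a + b).+2 * expR (- (mu * s)) * T a b s x)%:E)%E.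
  rewrite [RHS]integral_mkcond; apply: eq_integral => x _; rewrite /patch.
  case: ifPn; rewrite mem_setE; last by move=> /conv0 ->.
  rewrite in_itv/= => /andP[x0 xs]; congr EFin.
  rewrite !erlang_pdfE ?subr_ge0//= /T.
  rewrite (_ : - (mu * s) = - (mu * x) + - (mu * (s - x))); last by ring.
  by rewrite expRD !exprS exprD; ring.
have [s0|s0|<-] := ltgtP 0 s.
- have [F dF Fs] := T_primitive a b s.
  set c := mu ^+ _ * expR _.
  have dcF x : is_derive x (1 : R) (c \*: F) (c * T a b s x).
    by have h := dF x; apply: is_derive_eq.
  have cderiv (f f' : R -> R) : (forall x, is_derive x (1 : R) f (f' x)) -> continuous f.
    by move=> df x; apply: differentiable_continuous; apply/derivable1_diffP.
  rewrite (@continuous_FTC2 _ _ (c \*: F))//.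
  + rewrite -EFinB/= /GRing.scale/= -mulrBr Fs addSn addnS erlang_pdfE ?ltW//=.
    by congr EFin; rewrite /c; ring.
  + apply: continuous_subspaceT => x.
    apply: cvgM; first exact: cvg_cst.
    apply: cvgM; apply: cvgM; try exact: cvg_cst.
      exact: exprn_continuous.
    apply: (@continuous_comp _ _ _ (fun x => s - x) (fun x => x ^+ b)).
      by apply: cvgB; [exact: cvg_cst|exact: cvg_id].
    exact: exprn_continuous.
  + split.
    * by move=> x _.
    * by apply: cvg_at_right_filter; exact: cderiv dcF _.
    * by apply: cvg_at_left_filter; exact: cderiv dcF _.
  + by move=> x _; rewrite derive1E derive_val.
- by rewrite set_itv_ge ?integral_set0 ?lt0_erlang_pdf// bnd_simp -ltNge.
- rewrite set_itv1 integral_set1 addSn addnS erlang_pdfE//= expr0n/=.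
  by rewrite mulr0 !mul0r.
Qed.

End erlang_density.

(** * Erlang laws: distribution function, idle time, mean, one-sided moduli *)

Section erlang_law.
Context {R : realType}.
Notation leb := (@lebesgue_measure R).
Variables (mu : R) (mu0 : 0 < mu).
Implicit Types (x t u v : R) (j a b : nat).
Local Notation erl := (fun j => erlang_pdf j mu).

Let merl j : measurable_fun setT (EFin \o erlang_pdf j mu).
Proof. by apply/measurable_EFinP; exact: measurable_erlang_pdf. Qed.

Lemma ge0_integral_erlang_prob j (f : R -> \bar R) : (0 < j)%N ->
  measurable_fun setT f -> (forall x, 0 <= f x)%E ->
  (\int[erlang_prob j mu]_x f x =
   \int[leb]_x ((erlang_pdf j mu x)%:E * f x))%E.
Proof.
(* [erlang_prob] and [lebesgue_measure] live on two different canonical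
   measurable structures of [R], whence the push-forward along the identity. *)
move=> j0 mf f0.
have mid : measurable_fun setT (idfun : measurableTypeR R -> R).
  by move=> _ A mA; rewrite setTI.
pose I : {mfun measurableTypeR R >-> R} :=
  HB.pack (idfun : measurableTypeR R -> R) (isMeasurableFun.Build _ _ _ _ _ mid).
have merlx : measurable_fun setT (erlang_pdf j mu) by exact: measurable_erlang_pdf.
rewrite (@ge0_integral_density _ _ R (pushforward leb I) (erlang_prob j mu)
  (erlang_pdf j mu))//.
- rewrite ge0_integral_pushforward//=.
  + by apply: emeasurable_funM => //; exact: merl.
  + by move=> x _; rewrite mule_ge0// lee_fin erlang_pdf_ge0.
- by move=> x; exact: erlang_pdf_ge0.
- move=> A mA; rewrite /= /erlang_prob j0 mu0 ge0_integral_pushforward//=.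
  + by apply: measurable_funTS; exact: merl.
  + by move=> x _; rewrite lee_fin erlang_pdf_ge0.
Qed.

Lemma erlang_probE j A : (0 < j)%N -> measurable A ->
  (erlang_prob j mu A = \int[leb]_x ((erlang_pdf j mu x)%:E * (\1_A x)%:E))%E.
Proof.
move=> j0 mA; rewrite -ge0_integral_erlang_prob//.
  by rewrite integral_indic// setIT.
by apply/measurable_EFinP; exact: measurable_indic.
Qed.

Lemma erlang_cdfE j t : (0 < j)%N ->
  (\int[leb]_x ((erlang_pdf j mu x)%:E * ((x <= t)%R%:R)%:E) =
   (erlang_cdf mu j t)%:E)%E.
Proof.
move=> j0; rewrite /erlang_cdf fineK ?fin_num_measure// erlang_probE//.
by apply: eq_integral => x _; rewrite indicE mem_setE in_itv.
Qed.

Lemma erlang_cdf_ge0 j t : 0 <= erlang_cdf mu j t.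
Proof. by rewrite fine_ge0. Qed.

Lemma erlang_cdf_le1 j t : erlang_cdf mu j t <= 1.
Proof. by rewrite -lee_fin fineK ?fin_num_measure// probability_le1. Qed.

Lemma nondecreasing_erlang_cdf j : {homo erlang_cdf mu j : x y / x <= y}.
Proof.
move=> x y xy; rewrite fine_le ?fin_num_measure// le_measure ?inE//.
by apply: subset_itvl; rewrite bnd_simp.
Qed.

Lemma measurable_erlang_cdf j : measurable_fun setT (erlang_cdf mu j).
Proof.
by apply: nondecreasing_measurable => // x y *; exact: nondecreasing_erlang_cdf.
Qed.

(** Tonelli on the region [x <= y], [0 <= y <= t]: integrating out [y] leaves the positive part of
    [t - x], integrating out [x] leaves the distribution function. *)
Lemma idle_erlangE j t : (0 < j)%N ->
  (\int[leb]_x ((erlang_pdf j mu x)%:E * (Num.max 0 (t - x))%:E) =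
   (idle_erlang mu j t)%:E)%E.
Proof.
move=> j0.
pose f (z : R * R) : \bar R :=
  ((erlang_pdf j mu z.1)%:E * ((z.1 <= z.2)%R%:R * (0 <= z.2 <= t)%R%:R)%:E)%E.
have mf : measurable_fun setT f.
  apply: emeasurable_funM.
    by apply: (measurableT_comp (merl j)).
  apply/measurable_EFinP/measurable_funM.
    apply: (@measurableT_comp _ _ _ _ _ _ (fun b : bool => b%:R : R)) => //.
    exact: measurable_fun_ler.
  apply: (@measurableT_comp _ _ _ _ _ _ (fun b : bool => b%:R : R)) => //.
  by apply: measurable_and; apply: measurable_fun_ler.
have f0 z : (0 <= f z)%E.
  by rewrite mule_ge0// lee_fin ?erlang_pdf_ge0// mulr_ge0.
have -> : (idle_erlang mu j t)%:E = (\int[leb]_(s in `[0%R, t]) (erlang_cdf mu j s)%:E)%E.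
  rewrite /idle_erlang /Rintegral fineK//.
  rewrite ge0_fin_numE; last by apply: integral_ge0 => x _; rewrite lee_fin erlang_cdf_ge0.
  apply: (@le_lt_trans _ _ (\int[leb]_(s in `[0%R, t]) (cst 1%E) s)%E).
    apply: ge0_le_integral => //=.
    - by move=> x _; rewrite lee_fin erlang_cdf_ge0.
    - by apply: measurable_funTS; apply/measurable_EFinP; exact: measurable_erlang_cdf.
    - by move=> x _; rewrite lee_fin erlang_cdf_le1.
  rewrite integral_cst// mul1e /= lebesgue_measure_itv/=; case: ifP => // _.
  by rewrite -EFinB ltry.
transitivity (\int[leb]_x \int[leb]_y f (x, y))%E.
  apply: eq_integral => x _; rewrite /f/=.
  have [x0|x0] := ltP x 0.
    by rewrite lt0_erlang_pdf// mul0e integral0_eq// => y _; rewrite mul0e.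
  transitivity (\int[leb]_y
      ((erlang_pdf j mu x)%:E * (\1_(`[x, t]%classic) y)%:E))%E; last first.
    apply: eq_integral => y _; rewrite indicE mem_setE in_itv/=; congr (_ * _%:E)%E.
    rewrite -natrM mulnb; congr (nat_of_bool _)%:R.
    by apply/andP/andP => [[xy yt]|[xy /andP[_ yt]]]; rewrite xy ?(le_trans x0 xy).
  rewrite ge0_integralZl//; last first.
  - by rewrite lee_fin erlang_pdf_ge0.
  - by apply/measurable_EFinP; exact: measurable_indic.
  congr (_ * _)%E.
  rewrite integral_indic// setIT /= lebesgue_measure_itv/= lte_fin.
  case: ltP => [xt|tx]; last by rewrite max_l// subr_le0.
  by rewrite -EFinB max_r// subr_ge0 ltW.
rewrite (@fubini_tonelli _ _ _ _ _ leb leb f mf f0).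
rewrite [RHS]integral_mkcond; apply: eq_integral => y _; rewrite patchE mem_setE in_itv/=.
rewrite /fubini_G /f/=; case: ifPn => yt.
  rewrite -erlang_cdfE//; apply: eq_integral => x _.
  by rewrite mulr1.
by rewrite integral0_eq// => x _; rewrite mulr0 mule0.
Qed.

(** Multiplying the density of shape [j] by [x] gives [j / mu] times the density of shape [j.+1],
    which has mass one. *)
Lemma erlang_mean j : (0 < j)%N ->
  (\int[leb]_x ((erlang_pdf j mu x)%:E * (Num.max 0 x)%:E) = (j%:R / mu)%:E)%E.
Proof.
case: j => // j _.
rewrite -[RHS]mule1 -(@integral_erlang_pdf R j.+2 mu)//.
rewrite -ge0_integralZl//; last 3 first.
- exact: merl.
- by move=> x _; rewrite lee_fin erlang_pdf_ge0.
- by rewrite lee_fin divr_ge0// ltW.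
apply: eq_integral => x _; have [x0|x0] := ltP x 0.
  by rewrite !lt0_erlang_pdf// mul0e mule0.
rewrite -!EFinM !erlang_pdfE//=; congr EFin.
rewrite factS natrM !exprS.
have f0 : j`!%:R != 0 :> R by rewrite pnatr_eq0 -lt0n fact_gt0.
by field; rewrite ?nat1r ?f0 ?pnatr_eq0 ?lt0r_neq0.
Qed.

(** The shift formula is applied with the increment [e] as the time already elapsed. The term
    without a completed phase is at most the density at [x]; each of the [j] others has a weight of
    at most [mu * e] and a density of at most [mu]. *)
Lemma erlang_pdf_right_modulus j x e : 0 <= x -> 0 <= e ->
  erlang_pdf j.+1 mu (x + e) <= erlang_pdf j.+1 mu x + j%:R * mu ^+ 2 * e.
Proof.
move=> x0 e0; rewrite addrC erlang_pdf_shift// big_ord_recl subn0.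
apply: lerD.
  by rewrite ler_piMl ?erlang_pdf_ge0 ?poisson_weight_le1.
have -> : j%:R * mu ^+ 2 * e = \sum_(i < j) mu * e * mu.
  by rewrite sumr_const card_ord -[RHS]mulr_natl; ring.
apply: ler_sum => i _; apply: ler_pM.
- exact: poisson_weight_ge0.
- exact: erlang_pdf_ge0.
- rewrite /poisson_weight lift0 exprS factS natrM.
  have -> : expR (- (mu * e)) * (mu * e * (mu * e) ^+ i) / (i.+1%:R * i`!%:R) =
      (mu * e) * (poisson_weight mu i e / i.+1%:R).
    have f0 : i`!%:R != 0 :> R by rewrite pnatr_eq0 -lt0n fact_gt0.
    by rewrite /poisson_weight; field; rewrite f0 nat1r pnatr_eq0.
  rewrite ler_piMr//; first by rewrite mulr_ge0// ltW.
  rewrite ler_pdivrMr ?ltr0n// mul1r (le_trans (poisson_weight_le1 _ _ _))//.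
  by rewrite ler1n.
- exact: erlang_pdf_le.
Qed.

Lemma integral_erlang_pdf_itv_le j u v : (0 < j)%N -> u <= v ->
  (\int[leb]_(x in `]u, v]) (erlang_pdf j mu x)%:E <= (mu * (v - u))%:E)%E.
Proof.
move=> j0 uv.
apply: (@le_trans _ _ (\int[leb]_(x in `]u, v]) (cst mu%:E) x)%E).
  apply: ge0_le_integral => //=.
  - by move=> x _; rewrite lee_fin erlang_pdf_ge0.
  - by apply: measurable_funTS; exact: (merl j).
  - by move=> x _; rewrite lee_fin erlang_pdf_le.
rewrite integral_cst//= lebesgue_measure_itv/= lte_fin.
by case: ltP => uv'; rewrite ?mule0 ?lee_fin ?mulr_ge0 ?subr_ge0// ltW.
Qed.

Lemma erlang_prob_itv_le j u v : (0 < j)%N -> u <= v ->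
  (erlang_prob j mu `]u, v] <= (mu * (v - u))%:E)%E.
Proof.
move=> j0 uv; rewrite /erlang_prob j0 mu0/=.
exact: integral_erlang_pdf_itv_le.
Qed.

Lemma erlang_cdf_right_modulus j x e : (0 < j)%N -> 0 <= e ->
  erlang_cdf mu j (x + e) <= erlang_cdf mu j x + mu * e.
Proof.
move=> j0 e0; rewrite -lee_fin EFinD !fineK ?fin_num_measure//.
have -> : `]-oo, (x + e)%R]%classic = `]-oo, x] `|` `]x, (x + e)%R].
  by rewrite -itv_bndbnd_setU// bnd_simp lerDl.
rewrite (le_trans (measureU2 _ _ _))// leeD2l//.
have := @erlang_prob_itv_le j x (x + e) j0; rewrite lerDl e0 => /(_ isT).
by rewrite (_ : x + e - x = e)//; ring.
Qed.

Lemma idle_erlang_right_modulus j x e : (0 < j)%N -> 0 <= e ->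
  idle_erlang mu j (x + e) <= idle_erlang mu j x + e.
Proof.
move=> j0 e0; rewrite -lee_fin EFinD -!idle_erlangE//.
rewrite -[in leRHS](mule1 e%:E) -(@integral_erlang_pdf R j mu)//.
have mmax c : measurable_fun setT (fun y : R => (Num.max 0 (c - y))%:E : \bar R).
  apply/measurable_EFinP; apply: measurable_maxr; first exact: measurable_cst.
  exact: measurable_reflection.
have mm c : measurable_fun setT
    (fun y : R => ((erlang_pdf j mu y)%:E * (Num.max 0 (c - y))%:E : \bar R)%E).
  by apply: emeasurable_funM => //; exact: merl.
have merlj := merl j.
have erl0 y : (0 <= (erlang_pdf j mu y)%:E)%E by rewrite lee_fin erlang_pdf_ge0.
have max0 c : 0 <= Num.max 0 c :> R by rewrite le_max lexx.
rewrite -ge0_integralZl//.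
rewrite -ge0_integralD//; first last.
- exact: measurable_funeM.
- by move=> y _; rewrite mule_ge0// lee_fin.
- exact: mm.
- by move=> y _; rewrite mule_ge0// lee_fin.
apply: ge0_le_integral => //=.
- by move=> y _; rewrite mule_ge0// lee_fin.
- exact: mm.
- by apply: emeasurable_funD; [exact: mm|exact: (measurable_funeM e%:E (merl j))].
move=> y _; rewrite -!EFinM -EFinD lee_fin [e * _]mulrC -mulrDr.
rewrite ler_wpM2l ?erlang_pdf_ge0// ge_max addr_ge0//=.
by have := lexx (Num.max 0 (x - y)); rewrite {1}ge_max => /andP[_]; lra.
Qed.

End erlang_law.

(** * The derivative of [psi] *)

Section psi_derivative.
Context {R : realType}.
Notation leb := (@lebesgue_measure R).
Variables (mu : R) (mu0 : 0 < mu).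
Implicit Types (x t u v : R) (j a b : nat).

Definition erlang_tail j v : R := fine (erlang_prob j mu `]v, +oo[).

Lemma erlang_tailE j v : erlang_tail j v = 1 - erlang_cdf mu j v.
Proof.
apply/eqP; rewrite eq_sym subr_eq -eqe EFinD !fineK ?fin_num_measure//.
rewrite -measureU//.
- rewrite setUC -itv_bndbnd_setU// set_itvE; apply/eqP/esym.
  exact: (@probability_setT _ _ _ (erlang_prob j mu)).
- apply/seteqP; split => x //= -[] /=; rewrite !in_itv/= andbT => vx.
  by rewrite leNgt vx.
Qed.

Lemma erlang_tail_ge0 j v : 0 <= erlang_tail j v.
Proof. by rewrite fine_ge0. Qed.

Lemma erlang_tail_le1 j v : erlang_tail j v <= 1.
Proof. by rewrite erlang_tailE gerBl erlang_cdf_ge0. Qed.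

Lemma measurable_erlang_tail j : measurable_fun setT (erlang_tail j).
Proof.
rewrite (funext (erlang_tailE j)).
by apply: measurable_funB => //; exact: measurable_erlang_cdf.
Qed.

Let continuous_erlang_pdf j x : 0 < x -> {for x, continuous (erlang_pdf j mu)}.
Proof.
move=> x0.
pose f x : R := mu ^+ j * x ^+ j.-1 * expR (- (mu * x)) / (j.-1)`!%:R.
have cf : {for x, continuous f}.
  apply: cvgM; last exact: cvg_cst.
  apply: cvgM; first by apply: cvgM; [exact: cvg_cst|exact: exprn_continuous].
  apply: (@continuous_comp _ _ _ (fun x => - (mu * x)) expR); last exact: continuous_expR.
  by apply: cvgN; apply: cvgM; [exact: cvg_cst|exact: cvg_id].
rewrite /prop_for /continuous_at erlang_pdfE ?ltW//.
apply: cvg_trans cf; apply: near_eq_cvg.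
near=> y; rewrite erlang_pdfE//; near: y.
by apply: (@cvgr_ge _ _ _ _ id x); first exact: cvg_id.
Unshelve. all: end_near. Qed.

Let continuous_erlang_tail j x : (0 < j)%N -> {for x, continuous (erlang_tail j)}.
Proof.
move=> j0; rewrite /prop_for /continuous_at.
have lip y z : y <= z -> `|erlang_tail j y - erlang_tail j z| <= mu * (z - y).
  move=> yz; rewrite !erlang_tailE.
  rewrite (_ : _ - _ - _ = erlang_cdf mu j z - erlang_cdf mu j y); last by ring.
  rewrite ger0_norm ?subr_ge0 ?nondecreasing_erlang_cdf//.
  have := @erlang_cdf_right_modulus R mu mu0 j y (z - y) j0.
  by rewrite subr_ge0 yz addrC subrK => /(_ isT); rewrite lerBlDr addrC.
apply/cvgrPdist_le => e e0; near=> y.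
have ye : `|x - y| <= e / mu.
  near: y; apply: (@cvgr_dist_le _ _ _ _ _ id); [exact: cvg_id|exact: divr_gt0].
rewrite (@le_trans _ _ (mu * `|x - y|))//; last first.
  by rewrite mulrC -ler_pdivlMr.
have [xy|yx] := leP x y.
  by rewrite [in leRHS]distrC (@ger0_norm _ (y - x)) ?subr_ge0// lip.
by rewrite distrC (@ger0_norm _ (x - y)) ?subr_ge0 ?lip// ltW.
Unshelve. all: end_near. Qed.

(** Given that the first variable equals [x], the second has to exceed [t - x]. The substitution
    [y = t - x] turns the window for [x] into [0 <= y <= v], so that [v] becomes the upper limit of
    integration; [y] is the elapsed time of the service in progress at time [t]. *)
Lemma psiE v t a b : (0 < a < b)%N ->
  psi mu v t a b = (\int[leb]_(y in `[0%R, v])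
     (erlang_pdf a mu (t - y) * erlang_tail (b - a) y))%R.
Proof.
move=> /andP[a0 ab]; have ba0 : (0 < b - a)%N by rewrite subn_gt0.
rewrite /psi /Rintegral; congr fine.
set A := [set xy | _].
have mA : measurable A.
  rewrite (_ : A = (fun xy : R * R =>
     ((t - v <= xy.1) && (xy.1 <= t)) && (t < xy.1 + xy.2)) @^-1` [set true]).
    rewrite -[X in measurable X]setTI; apply: measurable_and => //.
      by apply: measurable_and; apply: measurable_fun_ler.
    by apply: measurable_fun_ltr => //; exact: measurable_funD.
  by apply/seteqP; split => -[x y] /=; [move=> [-> ->]|move/andP].
have mtail := measurable_erlang_tail (b - a).
pose g y := ((erlang_pdf a mu (t - y))%:E * (erlang_tail (b - a) y *
   (0 <= y <= v)%R%:R)%:E)%E.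
have mg : measurable_fun setT g.
  apply: emeasurable_funM; apply/measurable_EFinP.
    apply: (@measurableT_comp _ _ _ _ _ _ (erlang_pdf a mu)).
      exact: measurable_erlang_pdf.
    exact: measurable_reflection.
  apply: measurable_funM => //.
  apply: (@measurableT_comp _ _ _ _ _ _ (fun b : bool => b%:R : R)) => //.
  by apply: measurable_and; apply: measurable_fun_ler.
have g0 y : (0 <= g y)%E.
  by rewrite mule_ge0// lee_fin ?erlang_pdf_ge0// mulr_ge0 ?erlang_tail_ge0.
transitivity (\int[leb]_y g y)%E; last first.
  rewrite [RHS]integral_mkcond; apply: eq_integral => y _; rewrite patchE mem_setE in_itv/= /g.
  by case: ifPn => _; rewrite /= -EFinM ?mulr1 ?mulr0.
rewrite -(ge0_integral_reflection t mg g0).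
rewrite [LHS]ge0_integral_erlang_prob//; last first.
  exact: measurable_fun_xsection.
apply: eq_integral => x _; rewrite /g subKr; congr (_ * _)%E.
rewrite subr_ge0 lerBlDl -lerBlDr andbC [LHS]/=.
rewrite (_ : xsection A x = if t - v <= x <= t then `]t - x, +oo[%classic else set0).
  case: ifPn => _; last by rewrite measure0 mulr0.
  by rewrite mulr1 fineK ?fin_num_measure.
apply/seteqP; split => y; rewrite /xsection/= inE/=.
  by case=> h ty; rewrite ifT//= in_itv/= andbT ltrBlDl.
case: ifPn => // h; rewrite /= in_itv/= andbT ltrBlDl => ty.
by split.
Qed.

Lemma derive_psi v t a b : (0 < a < b)%N -> 0 < v < t ->
  is_derive v (1 : R) (fun v => psi mu v t a b)
    (erlang_pdf a mu (t - v) * erlang_tail (b - a) v).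
Proof.
move=> ab /andP[v0 vt]; have /andP[a0 ab'] := ab.
have ba0 : (0 < b - a)%N by rewrite subn_gt0.
pose g y := erlang_pdf a mu (t - y) * erlang_tail (b - a) y.
have -> : (fun v => psi mu v t a b) = (fun v => \int[leb]_(y in `[0%R, v]) g y)%R.
  by apply/funext => w; rewrite psiE.
have gbd y : `|g y| <= mu.
  rewrite ger0_norm; last by rewrite mulr_ge0 ?erlang_pdf_ge0 ?erlang_tail_ge0.
  by rewrite -[leRHS]mulr1 ler_pM ?erlang_pdf_ge0 ?erlang_tail_ge0 ?erlang_pdf_le
    ?erlang_tail_le1.
have mg : measurable_fun setT g.
  apply: measurable_funM; last exact: measurable_erlang_tail.
  apply: (@measurableT_comp _ _ _ _ _ _ (erlang_pdf a mu)).
    exact: measurable_erlang_pdf.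
  exact: measurable_reflection.
have ig : leb.-integrable `[0, t] (EFin \o g).
  apply: measurable_bounded_integrable => //.
  - by rewrite /= lebesgue_measure_itv/=; case: ifPn => _; rewrite ?ltry.
  - exact: measurable_funTS.
  - by exists mu; split; [exact: num_real|move=> M muM x _ /=; rewrite (le_trans (gbd x))// ltW].
(* The argument [t - v] of the density is positive; at [0] the density of shape [1] jumps. *)
have cg : {for v, continuous g}.
  apply: cvgM; last exact: continuous_erlang_tail.
  apply: (@continuous_comp _ _ _ (fun y => t - y) (erlang_pdf a mu)).
    by apply: cvgB; [exact: cvg_cst|exact: cvg_id].
  by apply: continuous_erlang_pdf; rewrite subr_gt0.
have [dF FE] := continuous_FTC1_closed vt ig v0 cg.
by split; [exact: dF|rewrite -derive1E; exact: FE].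
Qed.

End psi_derivative.

(** * Mixtures over the phases *)

Section binomial_mixture.
Context {R : realType}.
Variables (K : nat) (mu p : R).
Hypothesis p01 : 0 <= p <= 1.
Implicit Types (r z j : nat) (f g : nat -> R).

Let onem_p01 : 0 <= 1 - p <= 1.
Proof. by move: p01 => /andP[? ?]; apply/andP; split; lra. Qed.

Definition binomial_mix r f : R := \sum_(0 <= m < r.+1) binomial_pmf r (1 - p) m * f m.

Lemma binomial_mix0 f : binomial_mix 0 f = f 0.
Proof. by rewrite /binomial_mix big_nat1 /binomial_pmf !expr0 mulr1n !mul1r. Qed.

(** Pascal's rule, read as conditioning on one trial: with probability [1 - p] that service has an
    additional phase. *)
Lemma binomial_mixS r f : binomial_mix r.+1 f =
  p * binomial_mix r f + (1 - p) * binomial_mix r (fun m => f m.+1).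
Proof.
have pK : unstable.onem (1 - p) = p by rewrite /unstable.onem opprB addrC subrK.
rewrite /binomial_mix big_nat_recl//.
(* The vanishing term at [m = r.+1] is added so that both parts of Pascal's rule run over the same
   range. *)
have E : \sum_(0 <= m < r.+1) binomial_pmf r (1 - p) m * f m =
    binomial_pmf r (1 - p) 0 * f 0 +
    \sum_(0 <= m < r.+1) binomial_pmf r (1 - p) m.+1 * f m.+1.
  have h : binomial_pmf r (1 - p) r.+1 = 0 by rewrite /binomial_pmf bin_small.
  rewrite [in RHS]big_nat_recr//= h mul0r addr0.
  by rewrite big_nat_recl.
rewrite E mulrDr !big_distrr/= -addrA -big_split/=; congr (_ + _).
  by rewrite /binomial_pmf pK !subn0 !expr0 !bin0 exprS; ring.
apply: eq_bigr => m _; rewrite mulrA [in X in _ = _ + X]mulrA -mulrDl; congr (_ * _).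
rewrite /binomial_pmf pK subSS binS mulrnDr; congr (_ + _).
  case: (ltnP m r) => mr; last by rewrite !bin_small// !mulr0n mulr0.
  by rewrite -mulrnAr mulrCA !exprS -subnSK// exprS mulrnAr; ring.
by rewrite exprS -mulrA mulrnAr.
Qed.

Lemma binomial_mix1 r : binomial_mix r (fun=> 1) = 1.
Proof.
by elim: r => [|r IH]; rewrite ?binomial_mix0// binomial_mixS IH; ring.
Qed.

Lemma eq_binomial_mix r f g : (forall m, f m = g m) ->
  binomial_mix r f = binomial_mix r g.
Proof. by move=> fg; apply: eq_bigr => m _; rewrite fg. Qed.

Lemma binomial_mix_affine r a b f :
  binomial_mix r (fun m => a + b * f m) = a + b * binomial_mix r f.
Proof.
rewrite -[in RHS](mulr1 a) -(binomial_mix1 r) /binomial_mix !big_distrr -big_split/=.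
by apply: eq_bigr => m _; ring.
Qed.

Lemma binomial_mix_mean r : binomial_mix r (fun m => m%:R) = r%:R * (1 - p).
Proof.
elim: r => [|r IH]; first by rewrite binomial_mix0 mul0r.
rewrite binomial_mixS IH (@eq_binomial_mix _ _ (fun m => 1 + 1 * m%:R)).
  by rewrite binomial_mix_affine IH -natr1; ring.
by move=> m; rewrite mul1r nat1r.
Qed.

Lemma ler_binomial_mix r f g : (forall m, f m <= g m) ->
  binomial_mix r f <= binomial_mix r g.
Proof.
by move=> fg; apply: ler_sum => m _; rewrite ler_wpM2l ?binomial_pmf_ge0.
Qed.

(* The law of the number of exponential phases until the [r]-th departure, when
   the service in progress is in phase [z]. *)
Definition phase_mix r z f : R :=
  if (z <= K)%N then binomial_mix r (fun m => f (r * K - z + 1 + m)%N)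
  else binomial_mix r.-1 (fun m => f (r.-1 * K + 1 + m)%N).

(** The [+ 1] in the index keeps all shapes positive, away from the Dirac mass that [erlang_prob] is
    at shape [0]. *)
Lemma eq_phase_mix r z f g : (forall j, (0 < j)%N -> f j = g j) ->
  phase_mix r z f = phase_mix r z g.
Proof.
move=> fg; rewrite /phase_mix; case: ifPn => _; apply: eq_binomial_mix => m.
  by rewrite fg// addn1.
by rewrite fg// addn1.
Qed.

Lemma ler_phase_mix r z f g : (forall j, (0 < j)%N -> f j <= g j) ->
  phase_mix r z f <= phase_mix r z g.
Proof.
move=> fg; rewrite /phase_mix; case: ifPn => _; apply: ler_binomial_mix => m.
  by rewrite fg// addn1.
by rewrite fg// addn1.
Qed.

Lemma phase_mix_affine r z a b f :
  phase_mix r z (fun j => a + b * f j) = a + b * phase_mix r z f.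
Proof. by rewrite /phase_mix; case: ifPn => _; rewrite binomial_mix_affine. Qed.

Lemma phase_mixZ r z b f : phase_mix r z (fun j => b * f j) = b * phase_mix r z f.
Proof.
rewrite -[RHS]add0r -phase_mix_affine.
by apply: eq_phase_mix => j _; rewrite add0r.
Qed.

Lemma phase_mixD r z f g :
  phase_mix r z (fun j => f j + g j) = phase_mix r z f + phase_mix r z g.
Proof.
by rewrite /phase_mix /binomial_mix; case: ifPn => _; rewrite -big_split/=;
  apply: eq_bigr => m _; rewrite mulrDr.
Qed.

Lemma phase_mix_cst r z a : phase_mix r z (fun=> a) = a.
Proof.
transitivity (phase_mix r z (fun j => a + 0 * 0)).
  by apply: eq_phase_mix => j _; rewrite mul0r addr0.
by rewrite phase_mix_affine mul0r addr0.
Qed.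

Lemma phase_mix_ge0 r z f : (forall j, (0 < j)%N -> 0 <= f j) -> 0 <= phase_mix r z f.
Proof. by move=> f0; rewrite -(phase_mix_cst r z 0); exact: ler_phase_mix. Qed.

(** The additional departure requires a full service, of [K] phases with probability [p] and of
    [K.+1] phases otherwise. For [r = 0] it would be the departure of the client already in
    service. *)
Lemma phase_mixS r z f : (0 < r)%N -> phase_mix r.+1 z f =
  p * phase_mix r z (fun j => f (j + K)%N) +
  (1 - p) * phase_mix r z (fun j => f (j + K.+1)%N).
Proof.
case: r => // r _; rewrite /phase_mix; case: ifPn => zK.
  rewrite binomial_mixS; congr (_ * _ + _ * _); apply: eq_binomial_mix => m;
    congr f; rewrite !mulSn; lia.
rewrite /= binomial_mixS; congr (_ * _ + _ * _); apply: eq_binomial_mix => m;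
  congr f; rewrite mulSn; lia.
Qed.

Lemma phase_mix1 z f : (0 < z <= K.+1)%N -> phase_mix 1 z f =
  if (z <= K)%N then p * f (K - z).+1 + (1 - p) * f (K - z).+2 else f 1.
Proof.
move=> /andP[z0 zK]; rewrite /phase_mix; case: ifPn => h.
  by rewrite binomial_mixS !binomial_mix0 !mul1n !addn0 !addn1.
by rewrite binomial_mix0 mul0n.
Qed.

(** The arriving client waits until departure [k.-1]; the formula for [hbar_phase] is the mean
    number of phases until then, with binomial mean [k.-1 * (1 - p)], divided by the rate. *)
Lemma hbar_phaseE k z : (0 < z <= K.+1)%N -> (1 < k)%N ->
  hbar_phase K mu p k z = phase_mix k.-1 z (fun j => j%:R / mu).
Proof.
case: k => [|[|k]]// /andP[z0 zK] _; rewrite /hbar_phase /phase_mix/=.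
have E r a : binomial_mix r (fun m => (a + 1 + m)%:R / mu) =
    (a%:R + 1 + r%:R * (1 - p)) / mu.
  rewrite (@eq_binomial_mix _ _ (fun m => (a%:R + 1) / mu + mu^-1 * m%:R)).
    by rewrite binomial_mix_affine binomial_mix_mean; ring.
  by move=> m; rewrite !natrD; ring.
case: ifPn => h; rewrite E; congr (_ / _).
  rewrite natrB ?natrM -?natr1; first by ring.
  by rewrite mulSn; lia.
rewrite natrM -!natr1; ring.
Qed.

End binomial_mixture.

(** * The density of the time until the [r]-th departure *)

Section work_density.
Context {R : realType}.
Notation leb := (@lebesgue_measure R).
Variables (K : nat) (mu p : R).
Hypotheses (K0 : (0 < K)%N) (mu0 : 0 < mu) (p01 : 0 <= p <= 1).
Implicit Types (r z j : nat) (u s : R).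

Let p0 : 0 <= p. Proof. by case/andP: p01. Qed.
Let p1 : 0 <= 1 - p. Proof. by case/andP: p01 => _; rewrite subr_ge0. Qed.

Lemma phase_weight_ge0 z u : 0 <= u -> 0 <= phase_weight K mu p z u.
Proof.
move=> u0; rewrite /phase_weight; case: ifPn => _; first exact: poisson_weight_ge0.
have := poisson_weight_ge0 K mu0 u0; rewrite /poisson_weight -!mulrA => h.
by rewrite mulr_ge0.
Qed.

Definition service_pdf x : R :=
  p * erlang_pdf K mu x + (1 - p) * erlang_pdf K.+1 mu x.

Lemma service_pdf_ge0 x : 0 <= service_pdf x.
Proof. by rewrite addr_ge0// mulr_ge0// erlang_pdf_ge0. Qed.

Lemma measurable_service_pdf : measurable_fun setT service_pdf.
Proof.
by apply: measurable_funD; apply: measurable_funM => //; exact: measurable_erlang_pdf.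
Qed.

(* On the event that the service in progress lasts longer than [u], the density of
   the time until the [r]-th departure (not normalized). *)
Definition work_pdf r u x : R := \sum_(1 <= z < K.+2)
  phase_weight K mu p z u * phase_mix K p r z (fun j => erlang_pdf j mu x).

Lemma work_pdf_ge0 r u x : 0 <= u -> 0 <= work_pdf r u x.
Proof.
move=> u0; apply: sumr_ge0 => z _; rewrite mulr_ge0 ?phase_weight_ge0//.
by apply: phase_mix_ge0 => // j _; exact: erlang_pdf_ge0.
Qed.

Lemma measurable_work_pdf r u : measurable_fun setT (work_pdf r u).
Proof.
apply: measurable_sum => z; apply: measurable_funM => //.
rewrite /phase_mix; case: (leqP z K) => _; apply: measurable_sum => m;
  by apply: measurable_funM => //; exact: measurable_erlang_pdf.
Qed.

Lemma lt0_work_pdf r u x : x < 0 -> work_pdf r u x = 0.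
Proof.
move=> x0; rewrite /work_pdf big1// => z _.
rewrite (_ : phase_mix _ _ _ _ _ = 0) ?mulr0//.
by rewrite -[RHS](phase_mix_cst K p r z); apply: eq_phase_mix => j _; rewrite lt0_erlang_pdf.
Qed.

(** The shift formula is applied to both Erlang components. Their terms with fewer than [K]
    completed phases combine into the phases up to [K]; the one remaining term, from shape [K.+1],
    is phase [K.+1] with its factor [1 - p]. *)
Lemma work_pdf1 u x : 0 <= u -> 0 <= x -> work_pdf 1 u x = service_pdf (u + x).
Proof.
move=> u0 x0; rewrite /work_pdf /service_pdf; case: K K0 => // K' _.
rewrite !erlang_pdf_shift// big_add1/= big_mkord.
rewrite big_ord_recr/= [in X in _ = _ + X]big_ord_recr/= mulrDr addrA; congr (_ + _).
  rewrite !big_distrr -big_split/=; apply: eq_bigr => i _.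
  rewrite phase_mix1//; last by rewrite /= ltnS ltnW// ltnS.
  rewrite /phase_weight (ltn_ord i)/= /poisson_weight.
  rewrite subSS subSn; last by rewrite -ltnS.
  by ring.
by rewrite phase_mix1 ?ltnS ?leqnn// /phase_weight !ltnn subnn /poisson_weight; ring.
Qed.

Lemma ge0_integral_lincomb d (T : measurableType d) (m : {measure set T -> \bar R})
    (I : Type) (s : seq I) (a : I -> R) (g : I -> T -> R) (phi : T -> \bar R) (c : I -> R) :
  (forall i, 0 <= a i) -> (forall i, measurable_fun setT (g i)) ->
  (forall i x, 0 <= g i x) -> measurable_fun setT phi -> (forall x, 0 <= phi x)%E ->
  (forall i, \int[m]_x ((g i x)%:E * phi x) = (c i)%:E)%E ->
  (\int[m]_x ((\sum_(i <- s) a i * g i x)%:E * phi x) = (\sum_(i <- s) a i * c i)%:E)%E.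
Proof.
move=> a0 mg g0 mphi phi0 gc.
have mgphi i : measurable_fun setT (fun x => (g i x)%:E * phi x)%E.
  by apply: emeasurable_funM => //; exact/measurable_EFinP.
have gphi0 i x : (0 <= (g i x)%:E * phi x)%E by rewrite mule_ge0// lee_fin.
transitivity (\int[m]_x (\sum_(i <- s) ((a i)%:E * ((g i x)%:E * phi x))))%E.
  apply: eq_integral => x _; rewrite -sumEFin ge0_sume_distrl.
    by apply: eq_bigr => i _; rewrite muleA -EFinM.
  by move=> i _; rewrite lee_fin mulr_ge0.
rewrite ge0_integral_sum//.
- rewrite -sumEFin; apply: eq_bigr => i _.
  by rewrite ge0_integralZl// ?gc ?EFinM// lee_fin.
- by move=> i; exact: measurable_funeM.
- by move=> i x _; rewrite mule_ge0// lee_fin.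
Qed.

Lemma ge0_integral_phase_mix r z (phi : R -> \bar R) (c : nat -> R) :
  measurable_fun setT phi -> (forall x, 0 <= phi x)%E ->
  (forall j, (0 < j)%N -> \int[leb]_x ((erlang_pdf j mu x)%:E * phi x) = (c j)%:E)%E ->
  (\int[leb]_x ((phase_mix K p r z (fun j => erlang_pdf j mu x))%:E * phi x) =
   (phase_mix K p r z c)%:E)%E.
Proof.
move=> mphi phi0 phic; rewrite /phase_mix.
have pmf0 n m : 0 <= binomial_pmf n (1 - p) m.
  by rewrite binomial_pmf_ge0// p1 gerBl.
case: ifPn => _; rewrite /binomial_mix; apply: ge0_integral_lincomb => // m.
- exact: measurable_erlang_pdf.
- by move=> x; exact: erlang_pdf_ge0.
- by rewrite phic// addn1.
- exact: measurable_erlang_pdf.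
- by move=> x; exact: erlang_pdf_ge0.
- by rewrite phic// addn1.
Qed.

(** Reduces an expectation at a departure time to one computation per Erlang shape; mean, idle time
    and distribution function all enter through [c]. *)
Lemma ge0_integral_work_pdf r u (phi : R -> \bar R) (c : nat -> R) : 0 <= u ->
  measurable_fun setT phi -> (forall x, 0 <= phi x)%E ->
  (forall j, (0 < j)%N -> \int[leb]_x ((erlang_pdf j mu x)%:E * phi x) = (c j)%:E)%E ->
  (\int[leb]_x ((work_pdf r u x)%:E * phi x) =
   (\sum_(1 <= z < K.+2) phase_weight K mu p z u * phase_mix K p r z c)%:E)%E.
Proof.
move=> u0 mphi phi0 phic; apply: ge0_integral_lincomb => //.
- by move=> z; exact: phase_weight_ge0.
- move=> z; rewrite /phase_mix; case: (leqP z K) => _; apply: measurable_sum => m;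
    by apply: measurable_funM => //; exact: measurable_erlang_pdf.
- by move=> z x; apply: phase_mix_ge0 => // j _; exact: erlang_pdf_ge0.
- by move=> z; exact: ge0_integral_phase_mix.
Qed.

(** Convolution with a service density sends shape [j] to [j + K] and [j + K.+1] with weights [p]
    and [1 - p], which is the recursion [phase_mixS]. *)
Lemma work_pdf_convolution r u s : 0 <= u -> (0 < r)%N ->
  (\int[leb]_x ((work_pdf r u x)%:E * (service_pdf (s - x))%:E) =
   (work_pdf r.+1 u s)%:E)%E.
Proof.
move=> u0 r0.
have mr : measurable_fun setT (fun x : R => s - x) by exact: measurable_reflection.
rewrite (@ge0_integral_work_pdf _ _ _
  (fun j => p * erlang_pdf (j + K) mu s + (1 - p) * erlang_pdf (j + K.+1) mu s))//.
- congr EFin; apply: eq_bigr => z _; congr (_ * _).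
  rewrite phase_mixS// -!phase_mixZ.
  rewrite /phase_mix; case: ifPn => _; rewrite /binomial_mix -big_split/=;
  by apply: eq_bigr => m _; rewrite -mulrDr.
- apply/measurable_EFinP; apply: (measurableT_comp measurable_service_pdf mr).
- by move=> x; rewrite lee_fin service_pdf_ge0.
move=> j j0.
have merl i : measurable_fun setT (fun x : R => (erlang_pdf i mu x)%:E : \bar R).
  by apply/measurable_EFinP; exact: measurable_erlang_pdf.
have merl' i : measurable_fun setT (fun x : R => (erlang_pdf i mu (s - x))%:E : \bar R).
  by apply: (measurableT_comp (merl i) mr).
have mm i : measurable_fun [set: measurableTypeR R]
    (fun x : R => (erlang_pdf j mu x * erlang_pdf i mu (s - x))%:E : \bar R).
  by under eq_fun do rewrite EFinM; exact: (emeasurable_funM (merl j) (merl' i)).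
have ge0 i x : (0 <= (erlang_pdf j mu x * erlang_pdf i mu (s - x))%:E)%E.
  by rewrite lee_fin mulr_ge0 ?erlang_pdf_ge0.
rewrite EFinD !EFinM -!erlang_pdf_convolution//.
rewrite -!ge0_integralZl// -ge0_integralD//.
- by apply: eq_integral => x _; rewrite -!EFinM -EFinD; congr EFin; rewrite /service_pdf; ring.
- by move=> x _; rewrite mule_ge0// lee_fin.
- exact: measurable_funeM.
- by move=> x _; rewrite mule_ge0// lee_fin.
- exact: measurable_funeM.
Qed.

End work_density.

(** * Independence of the service times *)

Section sequence_space.
Context {R : realType}.

(** Rectangles in all coordinates generate the product sigma-algebra and, unlike preimages under
    single coordinates, are closed under intersection. *)
Definition cylinder : set (set (nat -> R)) :=
  [set [set s | forall j, A j (s j)] | A in [set A | forall j, measurable (A j)]].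

Definition seqspace := g_sigma_algebraType cylinder.

Lemma setI_closed_cylinder : setI_closed cylinder.
Proof.
move=> _ _ [A mA <-] [B mB <-]; exists (fun j => A j `&` B j).
  by move=> j; exact: measurableI.
apply/seteqP; split => s /=; first by move=> h; split => j; case: (h j).
by move=> [sA sB] j; split.
Qed.

Lemma cylinderT : cylinder setT.
Proof. by exists (fun=> setT) => //; apply/seteqP; split. Qed.

Lemma measurable_seqspaceE : @measurable _ seqspace = <<s cylinder >>.
Proof. by []. Qed.

Lemma measurable_coord (j : nat) : measurable_fun setT (fun s : seqspace => s j).
Proof.
move=> _ A mA; rewrite setTI; apply: sub_sigma_algebra.
exists (fun i => if i == j then A else setT); first by move=> i; case: ifPn.
apply/seteqP; split => s /=; first by move=> /(_ j); rewrite eqxx.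
by move=> sA i; case: eqP => // ->.
Qed.

Lemma measurable_to_seqspace d (W : measurableType d) (f : W -> seqspace) :
  (forall j, measurable_fun setT (fun w => f w j)) -> measurable_fun setT f.
Proof.
move=> mf; apply: (measurability _ measurable_seqspaceE) => _ [_ [A mA <-] <-].
rewrite (_ : _ `&` _ = \bigcap_j (fun w => f w j) @^-1` A j).
  by apply: bigcapT_measurable => j; rewrite -[X in measurable X]setTI; exact: mf.
rewrite setTI; apply/seteqP; split => w /=; first by move=> h j _; exact: h.
by move=> h j; exact: h.
Qed.

End sequence_space.
Arguments seqspace R : clear implicits.

(** * Independence of earlier and later clients *)

Section independence.
Context d (T : measurableType d) (R : realType) (P : probability T R).
Local Open Scope ereal_scope.

(** For fixed [E] both sides are finite measures in [B]: the law of [V] restricted to [E], and the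
    law of [V] scaled by [P E]. They agree on a generating pi-system. *)
Lemma independent_sigma_algebra d' (T' : measurableType d') (G : set (set T'))
    (V : {mfun T >-> T'}) (E : set T) : measurable E ->
  measurable = <<s G >> -> setI_closed G -> G setT ->
  (forall B, G B -> P (V @^-1` B `&` E) = P (V @^-1` B) * P E) ->
  forall B, measurable B -> P (V @^-1` B `&` E) = P (V @^-1` B) * P E.
Proof.
move=> mE mG GI GT PG B mB.
have k0 : (0 <= fine (P E))%R by rewrite fine_ge0.
pose m1 := pushforward (mrestr P mE) V.
pose m2 := mscale (NngNum k0) (distribution P V).
have m2E C : m2 C = P (V @^-1` C) * P E.
  by rewrite /m2 /mscale /= fineK ?fin_num_measure// muleC.
rewrite -m2E.
apply: (@measure_unique _ R T' G (fun=> setT) mG GI _ _ m1 m2) => //.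
- by rewrite bigcup_const//; exists 0%N.
- by move=> C GC; rewrite [RHS]m2E -PG.
- move=> _; rewrite /= /m1 /pushforward /mrestr/= preimage_setT setTI.
  by rewrite (le_lt_trans (probability_le1 _ _))// ltry.
Qed.

Variables (n : nat) (X : nat -> T -> R).
Hypothesis mX : forall j, measurable_fun setT (X j).
Hypothesis indepX : forall A : nat -> set R, (forall j, measurable (A j)) ->
  P (\bigcap_(j in [set j | (1 <= j <= n)%N]) (X j @^-1` A j)) =
  (\prod_(1 <= j < n.+1) P (X j @^-1` A j))%E.

(** Coordinates outside the range are set to [0] instead of being dropped, so that all blocks live
    in one space and can be fed to [cost] directly. *)
Definition block (a b : nat) (w : T) : seqspace R :=
  fun j => if (a <= j < b)%N then X j w else 0%R.

Lemma measurable_block a b : measurable_fun setT (block a b).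
Proof.
by apply: measurable_to_seqspace => j; rewrite /block; case: (_ && _).
Qed.

HB.instance Definition _ a b :=
  isMeasurableFun.Build _ _ _ _ (block a b) (measurable_block a b).

Let block_cylinder a b (A : nat -> set R) :
    (forall j, ~~ (a <= j < b)%N -> A j 0%R) ->
  block a b @^-1` [set s | forall j, A j (s j)] =
  \bigcap_(j in [set j | (a <= j < b)%N]) (X j @^-1` A j).
Proof.
move=> A0; apply/seteqP; split => w /=.
  by move=> h j /= abj; have := h j; rewrite /block abj.
by move=> h j; rewrite /block; case: ifPn => // abj; [exact: h|exact: A0].
Qed.

Let block_cylinder0 a b (A : nat -> set R) j : ~~ (a <= j < b)%N -> ~ A j 0%R ->
  block a b @^-1` [set s | forall j, A j (s j)] = set0.
Proof.
move=> abj Aj0; rewrite -subset0 => w /= /(_ j).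
by rewrite /block (negbTE abj).
Qed.

Let PbigcapX a b (A : nat -> set R) : (forall j, measurable (A j)) ->
  (1 <= a)%N -> (a <= b)%N -> (b <= n.+1)%N ->
  P (\bigcap_(j in [set j | (a <= j < b)%N]) (X j @^-1` A j)) =
  \prod_(a <= j < b) P (X j @^-1` A j).
Proof.
move=> mA a1 ab bn.
pose A' j := if (a <= j < b)%N then A j else setT.
have := indepX (A := A'); rewrite (_ : \bigcap_(j in _) _ =
    \bigcap_(j in [set j | (a <= j < b)%N]) (X j @^-1` A j)); last first.
  apply/seteqP; split => w /= h j /=.
    move=> abj; have := h j; rewrite /= /A' abj; apply.
    by case/andP: abj => aj jb; rewrite (leq_trans a1 aj) -ltnS (leq_trans jb).
  by move=> _; rewrite /A'; case: ifPn => // /h.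
move=> ->; last by move=> j; rewrite /A'; case: ifPn.
rewrite (big_cat_nat a1 (leq_trans ab bn))/= (big_cat_nat ab bn)/=.
rewrite [X in X * _]big_nat_cond [X in X * _]big1 ?mul1e; last first.
  move=> j /andP[/andP[_ ja] _].
  by rewrite /A' leqNgt ja /= preimage_setT probability_setT.
rewrite [X in _ * X]big_nat_cond [X in _ * X]big1 ?mule1; last first.
  move=> j /andP[/andP[bj _] _].
  by rewrite /A' [(j < b)%N]ltnNge bj andbF /= preimage_setT probability_setT.
by apply: eq_big_nat => j abj; rewrite /A' abj.
Qed.

Let independent_cylinders b (A B : nat -> set R) :
  (forall j, measurable (A j)) -> (forall j, measurable (B j)) ->
  (1 <= b <= n.+1)%N ->
  P (block 1 b @^-1` [set s | forall j, A j (s j)] `&`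
     block b n.+1 @^-1` [set s | forall j, B j (s j)]) =
  P (block 1 b @^-1` [set s | forall j, A j (s j)]) *
  P (block b n.+1 @^-1` [set s | forall j, B j (s j)]).
Proof.
move=> mA mB /andP[b1 bn].
(* If a rectangle excludes the filler [0] at a coordinate outside its block, its preimage is empty
   and both sides vanish; otherwise these coordinates impose no constraint. *)
have [[j [hj Aj]]|hA] := pselect (exists j, ~~ (1 <= j < b)%N /\ ~ A j 0%R).
  by rewrite (block_cylinder0 hj Aj) set0I measure0 mul0e.
have [[j [hj Bj]]|hB] := pselect (exists j, ~~ (b <= j < n.+1)%N /\ ~ B j 0%R).
  by rewrite (block_cylinder0 hj Bj) setI0 measure0 mule0.
have A0 j : ~~ (1 <= j < b)%N -> A j 0%R.
  by move=> hj; apply: contrapT => Aj; apply: hA; exists j.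
have B0 j : ~~ (b <= j < n.+1)%N -> B j 0%R.
  by move=> hj; apply: contrapT => Bj; apply: hB; exists j.
rewrite !block_cylinder//.
pose C j := if (j < b)%N then A j else B j.
rewrite !PbigcapX// (_ : _ `&` _ =
    \bigcap_(j in [set j | (1 <= j < n.+1)%N]) (X j @^-1` C j)).
  rewrite PbigcapX//; last by move=> j; rewrite /C; case: ifPn.
  rewrite (big_cat_nat b1 bn)/=; congr (_ * _).
    by apply: eq_big_nat => j /andP[_ jb]; rewrite /C jb.
  by apply: eq_big_nat => j /andP[bj _]; rewrite /C ltnNge bj.
apply/seteqP; split => w /=.
  move=> [hw1 hw2] j /= /andP[j1 jn]; rewrite /C; case: ltnP => jb.
    by apply: hw1 => /=; rewrite j1.
  by apply: hw2 => /=; rewrite jb.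
move=> h; split => j /= /andP[].
  by move=> j1 jb; have := h j; rewrite /= /C jb; apply; rewrite j1 (leq_trans jb).
move=> bj jn; have := h j; rewrite /= /C [(j < b)%N]ltnNge bj; apply.
by rewrite jn (leq_trans b1 bj).
Qed.

Lemma independent_blocks b (A B : set (seqspace R)) : (1 <= b <= n.+1)%N ->
  measurable A -> measurable B ->
  P (block 1 b @^-1` A `&` block b n.+1 @^-1` B) =
  P (block 1 b @^-1` A) * P (block b n.+1 @^-1` B).
Proof.
move=> b1n mA mB.
have mpre a c C : measurable C -> measurable (block a c @^-1` C).
  by move=> mC; rewrite -[X in measurable X]setTI; exact: measurable_block.
apply: (@independent_sigma_algebra _ (seqspace R) cylinder (block 1 b)) => //.
- exact: mpre.
- exact: setI_closed_cylinder.
- exact: cylinderT.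
move=> _ [A' mA' <-]; rewrite setIC muleC.
apply: (@independent_sigma_algebra _ (seqspace R) cylinder (block b n.+1)) => //.
- by apply: mpre; apply: sub_sigma_algebra; exists A'.
- exact: setI_closed_cylinder.
- exact: cylinderT.
move=> _ [B' mB' <-]; rewrite setIC muleC.
exact: independent_cylinders.
Qed.

(** Independence identifies the joint law of the two blocks with the product of their laws, and
    Tonelli applies. *)
Lemma ge0_integral_blocks b (G : seqspace R * seqspace R -> \bar R) :
  (1 <= b <= n.+1)%N -> measurable_fun setT G -> (forall z, 0 <= G z) ->
  \int[P]_w G (block 1 b w, block b n.+1 w) =
  \int[P]_w1 \int[P]_w2 G (block 1 b w1, block b n.+1 w2).
Proof.
move=> b1n mG G0.
pose V1 : {RV P >-> seqspace R} := block 1 b.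
pose V2 : {RV P >-> seqspace R} := block b n.+1.
have mV : measurable_fun setT (fun w => (block 1 b w, block b n.+1 w)).
  by apply/measurable_fun_pairP; split; exact: measurable_block.
pose V : {RV P >-> (seqspace R * seqspace R)%type} :=
  HB.pack (fun w => (block 1 b w, block b n.+1 w)) (isMeasurableFun.Build _ _ _ _ _ mV).
transitivity (\int[distribution P V]_z G z).
  by rewrite ge0_integral_distribution.
transitivity (\int[distribution P V1 \x distribution P V2]_z G z).
  apply: eq_measure_integral => C mC _.
  apply/esym; apply: product_measure_unique => // A B mA mB.
  by rewrite /distribution /pushforward/= -independent_blocks.
rewrite (@fubini_tonelli1 _ _ _ _ _ (distribution P V1) (distribution P V2) G)//.
rewrite ge0_integral_distribution//.
- apply: eq_integral => w1 _ /=; rewrite /fubini_F ge0_integral_distribution//.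
  exact: measurableT_comp.
- exact: measurable_fun_fubini_tonelli_F.
- by move=> x; apply: integral_ge0.
Qed.

End independence.

(** * Events as factors of the integrand *)

Section integral_indicator.
Context d (T : measurableType d) (R : realType).
Local Open Scope ereal_scope.

Lemma measurable_EFin_bool (b : T -> bool) : measurable_fun setT b ->
  measurable_fun setT (fun w => ((b w)%:R)%:E : \bar R).
Proof.
move=> mb; apply/measurable_EFinP.
exact: (measurableT_comp (f := fun b : bool => b%:R : R)).
Qed.

Lemma integral_boolE (m : {measure set T -> \bar R}) (b : T -> bool) (f : T -> \bar R) :
  \int[m]_(w in [set w | b w]) f w = \int[m]_w (((b w)%:R)%:E * f w).
Proof.
rewrite integral_mkcond; apply: eq_integral => w _; rewrite patchE mem_setE.
rewrite -topredE /=; case: (b w); by rewrite ?mulr1n ?mulr0n ?mul1e ?mul0e.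
Qed.

End integral_indicator.

(** * The joint law of a departure time and the later services *)

Section departure_law.
Context d (T : measurableType d) (R : realType) (P : probability T R).
Notation leb := (@lebesgue_measure R).
Variables (n K : nat) (mu p : R) (X : nat -> T -> R).
Hypotheses (K0 : (0 < K)%N) (mu0 : (0 < mu)%R) (p01 : (0 <= p <= 1)%R).
Hypothesis mX : forall j, measurable_fun setT (X j).
Hypothesis indepX : forall A : nat -> set R, (forall j, measurable (A j)) ->
  P (\bigcap_(j in [set j | (1 <= j <= n)%N]) (X j @^-1` A j)) =
  (\prod_(1 <= j < n.+1) P (X j @^-1` A j))%E.
Hypothesis lawX : forall j, (1 <= j <= n)%N -> forall phi : R -> \bar R,
  measurable_fun setT phi -> (forall x, 0 <= phi x)%E ->
  (\int[P]_w phi (X j w) = \int[leb]_x ((service_pdf K mu p x)%:E * phi x))%E.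
Local Open Scope ereal_scope.

Let mservice : measurable_fun setT (EFin \o service_pdf K mu p).
Proof. by apply/measurable_EFinP; exact: measurable_service_pdf. Qed.

Let service0 x : (0 <= (service_pdf K mu p x)%:E).
Proof. by rewrite lee_fin service_pdf_ge0. Qed.

Definition elapsed_work (a r : nat) (u : R) (w : T) : R :=
  (\sum_(a <= m < a + r) X m w - u)%R.

(** The departure time depends only on clients before [a + r] and is thus independent of the block
    starting there. Its law is a hypothesis here because the induction that establishes the law uses
    this splitting in its step. *)
Let split_of_law (a r : nat) (u : R) : (1 <= a)%N -> (a + r <= n.+1)%N -> (0 < r)%N ->
  (forall phi : R -> \bar R, measurable_fun setT phi -> (forall x, 0 <= phi x) ->
    \int[P]_(w in [set w | (u < X a w)%R]) phi (elapsed_work a r u w) =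
    \int[leb]_x ((work_pdf K mu p r u x)%:E * phi x)) ->
  forall G : R * seqspace R -> \bar R, measurable_fun setT G -> (forall z, 0 <= G z) ->
    \int[P]_(w in [set w | (u < X a w)%R])
      G (elapsed_work a r u w, block X (a + r) n.+1 w) =
    \int[leb]_x ((work_pdf K mu p r u x)%:E * \int[P]_w G (x, block X (a + r) n.+1 w)).
Proof.
move=> a1 arn r0 law G mG G0.
pose H (s : seqspace R * seqspace R) : \bar R := ((u < s.1 a)%R%:R)%:E *
  G ((\sum_(a <= m < a + r) s.1 m - u)%R, s.2).
have mcoord j : measurable_fun setT (fun s : seqspace R * seqspace R => s.1 j).
  exact: (measurableT_comp (measurable_coord j) measurable_fst).
have mH : measurable_fun setT H.
  apply: emeasurable_funM.
    by apply: measurable_EFin_bool; apply: measurable_fun_ltr.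
  apply: (measurableT_comp mG); apply/measurable_fun_pairP; split => /=.
    by apply: measurable_funB => //; apply: measurable_sum.
  exact: measurable_snd.
have H0 z : 0 <= H z by rewrite mule_ge0.
have blk j w : (a <= j < a + r)%N -> block X 1 (a + r) w j = X j w.
  by move=> /andP[aj jar]; rewrite /block jar (leq_trans a1 aj).
have blka w : block X 1 (a + r) w a = X a w.
  by rewrite blk// leqnn -{1}(addn0 a) ltn_add2l.
have blkS w : (\sum_(a <= m < a + r) block X 1 (a + r) w m - u)%R = elapsed_work a r u w.
  by congr (_ - _)%R; apply: eq_big_nat => j /blk.
transitivity (\int[P]_w H (block X 1 (a + r) w, block X (a + r) n.+1 w)).
  rewrite integral_boolE; apply: eq_integral => w _.
  by rewrite /H/= blka blkS.
rewrite (ge0_integral_blocks mX indepX)//; last first.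
  by rewrite arn andbT addn_gt0 a1.
have mGb : measurable_fun setT
    (fun z : R * T => G (z.1, block X (a + r) n.+1 z.2)).
  apply: (measurableT_comp mG); apply/measurable_fun_pairP; split => /=.
    exact: measurable_fst.
  exact: (measurableT_comp (measurable_block mX _ _) measurable_snd).
have mint : measurable_fun setT (fun x => \int[P]_w G (x, block X (a + r) n.+1 w)).
  exact: (@measurable_fun_fubini_tonelli_F _ _ _ _ _ P _ mGb).
rewrite -law; last 2 first.
- exact: mint.
- by move=> x; apply: integral_ge0.
rewrite integral_boolE; apply: eq_integral => w1 _.
rewrite /H /= blka blkS ge0_integralZl//.
apply: (measurableT_comp mG); apply/measurable_fun_pairP; split => /=.
  exact: measurable_cst.
exact: (measurable_block mX _ _).
Qed.

Lemma elapsed_workS a r u w : elapsed_work a r.+1 u w = (elapsed_work a r u w + X (a + r) w)%R.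
Proof.
rewrite /elapsed_work addnS big_nat_recr/= ?leq_addr//.
by rewrite addrAC.
Qed.

(** Induction on [r]: the first departure is a translation by [u] combined with [work_pdf1]; each
    further one adds an independent service, hence a convolution. *)
Lemma elapsed_work_law (a r : nat) (u : R) : (0 <= u)%R ->
  (1 <= a)%N -> (a + r <= n.+1)%N -> (0 < r)%N ->
  forall phi : R -> \bar R, measurable_fun setT phi -> (forall x, 0 <= phi x) ->
    \int[P]_(w in [set w | (u < X a w)%R]) phi (elapsed_work a r u w) =
    \int[leb]_x ((work_pdf K mu p r u x)%:E * phi x).
Proof.
move=> u0 a1 + r0; case: r r0 => // r _; elim: r => [|r IH] arn phi mphi phi0.
  have an : (1 <= a <= n)%N by rewrite a1 -ltnS -addn1.
  pose psi x : \bar R := ((u < x)%R%:R)%:E * phi (x - u)%R.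
  have mpsi : measurable_fun setT psi.
    apply: emeasurable_funM.
      by apply: measurable_EFin_bool; apply: measurable_fun_ltr.
    by apply: (measurableT_comp mphi); apply: measurable_funB.
  have psi0 x : 0 <= psi x by rewrite mule_ge0.
  transitivity (\int[P]_w psi (X a w)).
    rewrite integral_boolE; apply: eq_integral => w _.
    by rewrite /psi /elapsed_work addn1 big_nat1.
  rewrite lawX// -(ge0_integral_translation u)//; last 2 first.
  - by apply: emeasurable_funM.
  - by move=> x; rewrite mule_ge0.
  rewrite [RHS](_ : _ = \int[leb]_(x in `[0%R, +oo[)
      ((work_pdf K mu p 1 u x)%:E * phi x)); last first.
    rewrite [RHS]integral_mkcond; apply: eq_integral => x _.
    rewrite patchE mem_setE in_itv/= andbT; case: leP => // x0.
    by rewrite lt0_work_pdf// mul0e.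
  (* The event [u < X a] is strict while the density is supported on the closed half-line; they
     differ by the null point [0]. *)
  rewrite -integral_itv_obnd_cbnd; last first.
    apply: measurable_funTS; apply: emeasurable_funM => //.
    by apply/measurable_EFinP; exact: measurable_work_pdf.
  rewrite [RHS]integral_mkcond; apply: eq_integral => x _.
  rewrite patchE mem_setE in_itv/= andbT /psi ltrDl.
  case: ltP => x0; last by rewrite mul0e mule0.
  by rewrite mul1e work_pdf1// ?ltW// (_ : u + x - u = x)%R//; ring.
have arn' : (a + r.+1 <= n.+1)%N by rewrite (leq_trans _ arn)// leq_add2l.
have an : (1 <= a + r.+1 <= n)%N.
  by rewrite addn_gt0 a1/= -ltnS -addnS.
pose G (z : R * seqspace R) := phi (z.1 + z.2 (a + r.+1)%N)%R.
have mG : measurable_fun setT G.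
  apply: (measurableT_comp mphi); apply: measurable_funD => //.
  exact: (measurableT_comp (measurable_coord _)).
transitivity (\int[P]_(w in [set w | (u < X a w)%R])
      G (elapsed_work a r.+1 u w, block X (a + r.+1) n.+1 w)).
  apply: eq_integral => w _; rewrite /G elapsed_workS /= /block leqnn.
  by have /andP[_ h] := an; rewrite ltnS h.
rewrite (split_of_law a1 arn' _ (IH arn') mG)//; last by move=> z; exact: phi0.
pose F (z : R * R) := (work_pdf K mu p r.+1 u z.1)%:E *
  ((service_pdf K mu p (z.2 - z.1))%:E * phi z.2).
have mwork q : measurable_fun setT (EFin \o work_pdf K mu p q u).
  by apply/measurable_EFinP; exact: measurable_work_pdf.
have mF : measurable_fun setT F.
  apply: emeasurable_funM; first exact: (measurableT_comp (mwork r.+1)).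
  apply: emeasurable_funM; last exact: (measurableT_comp mphi).
  by apply: (measurableT_comp mservice); apply: measurable_funB.
have work0 q x : 0 <= (work_pdf K mu p q u x)%:E by rewrite lee_fin work_pdf_ge0.
have F0 z : 0 <= F z by rewrite !mule_ge0.
transitivity (\int[leb]_x \int[leb]_s F (x, s)).
  apply: eq_integral => x _; rewrite /F/=.
  have ms : measurable_fun [set: measurableTypeR R]
      (fun s : R => (service_pdf K mu p (s - x))%:E * phi s).
    apply: emeasurable_funM => //.
    by apply: (measurableT_comp mservice); apply: measurable_funB.
  rewrite ge0_integralZl//; last by move=> s _; rewrite mule_ge0.
  congr (_ * _); rewrite /G /=.
  transitivity (\int[P]_w phi (x + X (a + r.+1) w)%R).
    apply: eq_integral => w _; rewrite /block leqnn.
    by have /andP[_ h] := an; rewrite ltnS h.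
  rewrite (lawX an (phi := fun y => phi (x + y)%R)); last 2 first.
  - by apply: (measurableT_comp mphi); apply: measurable_funD.
  - by move=> y; exact: phi0.
  rewrite -(@ge0_integral_translation _ x (fun s => (service_pdf K mu p (s - x))%:E * phi s)).
  - by apply: eq_integral => y _; congr (_%:E * _); congr service_pdf; ring.
  - exact: ms.
  - by move=> s; rewrite mule_ge0.
rewrite (@fubini_tonelli _ _ _ _ _ leb leb F mF F0).
apply: eq_integral => s _; rewrite /F/=.
have ms : measurable_fun [set: measurableTypeR R]
    (fun x : R => (work_pdf K mu p r.+1 u x)%:E * (service_pdf K mu p (s - x))%:E).
  apply: emeasurable_funM; first exact: (mwork r.+1).
  by apply: (measurableT_comp mservice); exact: measurable_reflection.
rewrite -work_pdf_convolution// muleC -ge0_integralZl//; last first.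
  by move=> x _; rewrite mule_ge0.
by apply: eq_integral => x _; rewrite [RHS]muleC muleA.
Qed.

Lemma elapsed_work_split (a r : nat) (u : R) : (0 <= u)%R ->
  (1 <= a)%N -> (a + r <= n.+1)%N -> (0 < r)%N ->
  forall G : R * seqspace R -> \bar R, measurable_fun setT G -> (forall z, 0 <= G z) ->
    \int[P]_(w in [set w | (u < X a w)%R])
      G (elapsed_work a r u w, block X (a + r) n.+1 w) =
    \int[leb]_x ((work_pdf K mu p r u x)%:E * \int[P]_w G (x, block X (a + r) n.+1 w)).
Proof.
by move=> *; apply: split_of_law => // *; apply: elapsed_work_law.
Qed.

End departure_law.

(** * Dynamics of the system *)

Section system_dynamics.
Context {R : realType}.
Implicit Types (s : nat -> R) (tau : nat -> nat -> R -> R) (x : nat * R) (t : R).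

(** The fixpoint [state] peels off its last transition, whereas backward induction needs the first
    one. *)
Lemma stateS tau s i x e : state tau s i x e.+1 =
  state tau s i.+1 (next_state s i x (decision tau i x)) e.
Proof.
elim: e => [|e IH]; first by rewrite /= addn0.
by rewrite [LHS]/= -/(state tau s i x e.+1) IH /= addSnnS.
Qed.

Lemma cost_step omega n tau s i x : (i < n)%N ->
  cost omega n tau s i x =
  omega * idle_time s i x (decision tau i x) + (1 - omega) * waiting_time s i x +
  cost omega n tau s i.+1 (next_state s i x (decision tau i x)).
Proof.
move=> ilt; rewrite /cost [in LHS](big_ltn ilt)/=.
rewrite [in LHS](big_ltn (leqW ilt : (i < n.+1)%N)) subnn/=.
rewrite (eq_big_nat _ _ (F2 := fun j => let y :=
  state tau s i.+1 (next_state s i x (decision tau i x)) (j - i.+1) in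
    idle_time s j y (decision tau j y))).
  rewrite [X in (1 - omega) * (_ + X)](eq_big_nat _ _ (F2 := fun j =>
    waiting_time s j (state tau s i.+1 (next_state s i x (decision tau i x)) (j - i.+1)))).
    by ring.
  by move=> j /andP[ij _]; rewrite -stateS subnSK.
by move=> j /andP[ij _]; rewrite /= -stateS subnSK.
Qed.

Lemma cost_last omega n tau s x :
  cost omega n tau s n x = (1 - omega) * waiting_time s n x.
Proof. by rewrite /cost big_geq// big_nat1 subnn mulr0 add0r. Qed.

Lemma completionS s j x r :
  completion s j x r.+1 = completion s j x r + s ((j - x.1).+1 + r)%N.
Proof. by rewrite /completion addnS big_nat_recr/= ?leq_addr// addrAC. Qed.

(** A decreasing sequence of truth values is an initial segment, so counting the true ones gives its
    length. Applied to completion times, this turns [departures] into a threshold. *)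
Let sum_prefix (b : nat -> bool) k : (forall r, b r.+1 -> b r) ->
  ((\sum_(1 <= r < k.+1) b r <= k) /\
   (forall r, 1 <= r <= k -> b r = (r <= \sum_(1 <= r < k.+1) b r)))%N.
Proof.
move=> bS; elim: k => [|k [IHk IH]].
  by rewrite big_geq//; split => // r; case: r.
have bT r e : b (r + e)%N -> b r.
  by elim: e => [|e IHe]; rewrite ?addn0// addnS => /bS.
rewrite big_nat_recr//=; case bk: (b k.+1); last first.
  rewrite addn0; split; first exact: leqW.
  move=> r /andP[r1]; rewrite leq_eqVlt => /orP[/eqP ->|rk].
    by rewrite bk; apply/esym/negbTE; rewrite -ltnNge ltnS.
  by apply: IH; rewrite r1.
have ball r : (r <= k.+1)%N -> b r.
  by move=> rk; apply: (bT r (k.+1 - r)%N); rewrite subnKC.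
rewrite (_ : (\sum_(1 <= i < k.+1) b i)%N = k).
  by rewrite addn1; split => // r /andP[_ rk]; rewrite rk ball.
rewrite (eq_big_nat _ _ (F2 := fun=> 1%N)); first by rewrite sum_nat_const_nat muln1 subn1.
by move=> r /andP[_ rk]; rewrite ball// ltnW.
Qed.

Lemma departures_le s j x t : (departures s j x t <= x.1)%N.
Proof.
rewrite /departures -[leqRHS]muln1 -[X in (_ <= X * _)%N](subn1 x.1.+1).
by rewrite -sum_nat_const_nat; apply: leq_sum => r _; case: (_ <= _).
Qed.

Lemma completion_departures s j x t r : (forall m, 0 <= s m) ->
  (1 <= r <= x.1)%N -> (completion s j x r <= t) = (r <= departures s j x t)%N.
Proof.
move=> s0; have [|_] := @sum_prefix (fun r => completion s j x r <= t) x.1.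
  by move=> q; apply: le_trans; rewrite completionS lerDl.
exact.
Qed.

Lemma next_state_range s j x t : (x.1 <= j)%N ->
  (0 < (next_state s j x t).1 <= j.+1)%N.
Proof. by move=> xj; rewrite /next_state/= ltnS (leq_trans (leq_subr _ _)). Qed.

Lemma next_state_clients s j x t : (x.1 <= j)%N ->
  (j.+1 - (next_state s j x t).1 = j - x.1 + departures s j x t)%N.
Proof. by move=> xj; rewrite /next_state/=; have := departures_le s j x t; lia. Qed.

(** If the service in progress had lasted less than its elapsed time, another departure would have
    been counted. This is the invariant that keeps waiting times and costs nonnegative. *)
Lemma next_state_elapsed s j x t : (forall m, 0 <= s m) -> (x.1 <= j)%N -> (0 < x.1)%N ->
  (next_state s j x t).2 <= s (j.+1 - (next_state s j x t).1).+1.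
Proof.
move=> s0 xj x0; rewrite next_state_clients// /next_state/=.
case: ltnP => // rx.
rewrite lerBlDr -addSn addrC -completionS ltW// ltNge completion_departures//.
by rewrite ltnn.
Qed.

Lemma waiting_time_ge0 s j x : (forall m, 0 <= s m) -> x.2 <= s (j - x.1).+1 ->
  0 <= waiting_time s j x.
Proof.
move=> s0 xs; rewrite /waiting_time; case: ifPn => // x1.
have -> : x.1.-1 = (x.1 - 2).+1 by lia.
rewrite /completion addnS -addSn big_ltn ?leq_addr// addrAC addr_ge0 ?subr_ge0//.
exact: sumr_ge0.
Qed.

Lemma idle_time_ge0 s j x t : 0 <= idle_time s j x t.
Proof. by rewrite /idle_time le_max lexx. Qed.

Lemma cost_ge0 omega n tau s i x : 0 <= omega <= 1 -> (forall m, 0 <= s m) ->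
  (i <= n)%N -> (0 < x.1 <= i)%N -> x.2 <= s (i - x.1).+1 ->
  0 <= cost omega n tau s i x.
Proof.
move=> /andP[om0 om1] s0; move: {2}(n - i)%N (erefl (n - i)%N) => e.
elim: e i x => [|e IH] i x ne ni /andP[x0 xi] xs.
  have -> : i = n by lia.
  by rewrite cost_last mulr_ge0 ?subr_ge0 ?waiting_time_ge0//; have -> : n = i by lia.
rewrite cost_step; last by lia.
apply: addr_ge0.
  by rewrite addr_ge0 ?mulr_ge0 ?idle_time_ge0 ?subr_ge0 ?waiting_time_ge0.
apply: IH; [by lia|by lia|exact: next_state_range|exact: next_state_elapsed].
Qed.

Lemma eq_completion s s' j x r : (x.1 <= j)%N -> (r <= x.1)%N ->
  (forall m, (j - x.1 < m <= j)%N -> s m = s' m) ->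
  completion s j x r = completion s' j x r.
Proof.
move=> xj rx ss'; congr (_ - _); apply: eq_big_nat => m /andP[m1 m2].
by apply: ss'; lia.
Qed.

(** Clients up to [i - x.1] have left when client [i] arrives, and no later state refers to them.
    Hence the services may be replaced by a [block] starting at the client in service. *)
Lemma eq_cost omega n tau s s' i x : (i <= n)%N -> (x.1 <= i)%N ->
  (forall m, (i - x.1 < m <= n)%N -> s m = s' m) ->
  cost omega n tau s i x = cost omega n tau s' i x.
Proof.
move: {2}(n - i)%N (erefl (n - i)%N) => e.
elim: e i x => [|e IH] i x ne ni xi ss'.
  have ni' : n = i by lia.
  rewrite ni' !cost_last /waiting_time; case: ifPn => // x1.
  by congr (_ * _); apply: eq_completion => //; [lia|move=> m mi; apply: ss'; lia].
have cE r : (r <= x.1)%N -> completion s i x r = completion s' i x r.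
  by move=> rx; apply: eq_completion => // m mi; apply: ss'; lia.
have dE t : departures s i x t = departures s' i x t.
  by apply: eq_big_nat => r /andP[_ rx]; rewrite cE.
have nE t : next_state s i x t = next_state s' i x t.
  by rewrite /next_state dE; case: ltnP => // rx; rewrite cE// ltnW.
rewrite [LHS]cost_step; last by lia.
rewrite [RHS]cost_step; last by lia.
rewrite /idle_time /waiting_time !cE ?leq_pred// nE; congr (_ + _).
apply: IH; [lia|lia| |].
  by have /andP[] := next_state_range s' (decision tau i x) xi.
by move=> m; rewrite next_state_clients// => mi; apply: ss'; lia.
Qed.

(** Decisions before client [i] have no influence, so the decision rule of one client can be changed
    without affecting the costs after it. *)
Lemma eq_cost_policy omega n tau tau' s i x : (i <= n)%N ->
  (forall j, (i <= j < n)%N -> tau j = tau' j) ->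
  cost omega n tau s i x = cost omega n tau' s i x.
Proof.
move: {2}(n - i)%N (erefl (n - i)%N) => e.
elim: e i x => [|e IH] i x ne ni tt'.
  have -> : i = n by lia.
  by rewrite !cost_last.
rewrite [LHS]cost_step; last by lia.
rewrite [RHS]cost_step; last by lia.
rewrite /decision tt'; last by lia.
by congr (_ + _); apply: IH; [lia|lia|move=> j jn; apply: tt'; lia].
Qed.

End system_dynamics.

(** * Measurability of the dynamics *)

Section measurable_dynamics.
Context d (W : measurableType d) (R : realType).

(** The random number of clients or departures occurs as an index, as in [tau j k u]; splitting over
    its countably many values reduces to a fixed index. *)
Lemma measurable_fun_nat_index d' (U : measurableType d') (N : W -> nat) (f : nat -> W -> U) :
  measurable_fun setT N -> (forall k, measurable_fun setT (f k)) ->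
  measurable_fun setT (fun w => f (N w) w).
Proof.
move=> mN mf _ A mA; rewrite setTI.
rewrite (_ : _ @^-1` _ = \bigcup_k (N @^-1` [set k] `&` f k @^-1` A)).
  apply: bigcup_measurable => k _; apply: measurableI.
    by rewrite -[X in measurable X]setTI; exact: mN.
  by rewrite -[X in measurable X]setTI; exact: mf.
apply/seteqP; split => w /=; first by move=> h; exists (N w).
by case=> k _ [/= <-].
Qed.

Lemma measurable_addn (f g : W -> nat) : measurable_fun setT f -> measurable_fun setT g ->
  measurable_fun setT (fun w => (f w + g w)%N).
Proof.
move=> mf mg; apply: (@measurable_fun_nat_index _ _ f (fun k w => (k + g w)%N)) => // k.
by apply: (@measurable_fun_nat_index _ _ g (fun l w => (k + l)%N)).
Qed.

Variables (s : W -> nat -> R) (ms : forall j, measurable_fun setT (fun w => s w j)).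

Lemma measurable_completion j k (v : W -> R) r : measurable_fun setT v ->
  measurable_fun setT (fun w => completion (s w) j (k, v w) r).
Proof. by move=> mv; apply: measurable_funB => //=; apply: measurable_sum. Qed.

Lemma measurable_departures j k (v t : W -> R) : measurable_fun setT v ->
  measurable_fun setT t ->
  measurable_fun setT (fun w => departures (s w) j (k, v w) (t w)).
Proof.
move=> mv mt; rewrite /departures /=.
suff h r : measurable_fun setT (fun w => (completion (s w) j (k, v w) r <= t w)%R : nat).
  suff : forall q, measurable_fun setT
      (fun w => (\sum_(1 <= r < q.+1) (completion (s w) j (k, v w) r <= t w)%R)%N) by exact.
  elim=> [|q IH].
    by rewrite (_ : (fun w => _) = cst 0%N)//; apply/funext => w; rewrite big_geq.
  by under eq_fun do rewrite big_nat_recr//=; exact: measurable_addn.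
apply: (@measurableT_comp _ _ _ _ _ _ nat_of_bool) => //.
by apply: measurable_fun_ler => //; exact: measurable_completion.
Qed.

Lemma measurable_next_state j (x : W -> nat * R) (t : W -> R) :
  measurable_fun setT x -> measurable_fun setT t ->
  measurable_fun setT (fun w => next_state (s w) j (x w) (t w)).
Proof.
move=> /measurable_fun_pairP[mx1 mx2] mt.
under eq_fun do rewrite (surjective_pairing (x _)).
apply: (@measurable_fun_nat_index _ _ (fst \o x)
  (fun k w => next_state (s w) j (k, (snd \o x) w) (t w))) => // k.
apply: (@measurable_fun_nat_index _ _
  (fun w => departures (s w) j (k, (snd \o x) w) (t w))
  (fun r w => ((k - r).+1, if (r < k)%N then t w - completion (s w) j (k, (snd \o x) w) r
                           else 0))) => [|r].
  exact: measurable_departures.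
apply/measurable_fun_pairP; split => /=.
  exact: measurable_cst.
case: (r < k)%N => /=; last exact: measurable_cst.
by apply: measurable_funB => //; exact: measurable_completion.
Qed.

Variables (tau : nat -> nat -> R -> R) (mtau : is_policy tau).

Lemma measurable_decision j (x : W -> nat * R) : measurable_fun setT x ->
  measurable_fun setT (fun w => decision tau j (x w)).
Proof.
move=> /measurable_fun_pairP[mx1 mx2].
apply: (@measurable_fun_nat_index _ _ (fst \o x) (fun k w => tau j k (x w).2)) => // k.
by apply: (measurableT_comp (proj1 (mtau j k))).
Qed.

Lemma measurable_state i (x : W -> nat * R) e : measurable_fun setT x ->
  measurable_fun setT (fun w => state tau (s w) i (x w) e).
Proof.
move=> mx; elim: e => //= e IH.
by apply: measurable_next_state => //; exact: measurable_decision.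
Qed.

Lemma measurable_idle_time j (x : W -> nat * R) (t : W -> R) :
  measurable_fun setT x -> measurable_fun setT t ->
  measurable_fun setT (fun w => idle_time (s w) j (x w) (t w)).
Proof.
move=> /measurable_fun_pairP[mx1 mx2] mt.
under eq_fun do rewrite (surjective_pairing (x _)).
apply: (@measurable_fun_nat_index _ _ (fst \o x)
  (fun k w => idle_time (s w) j (k, (snd \o x) w) (t w))) => // k.
apply: measurable_maxr => //; apply: measurable_funB => //.
exact: measurable_completion.
Qed.

Lemma measurable_waiting_time j (x : W -> nat * R) : measurable_fun setT x ->
  measurable_fun setT (fun w => waiting_time (s w) j (x w)).
Proof.
move=> /measurable_fun_pairP[mx1 mx2].
under eq_fun do rewrite (surjective_pairing (x _)).
apply: (@measurable_fun_nat_index _ _ (fst \o x)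
  (fun k w => waiting_time (s w) j (k, (snd \o x) w))) => // k.
rewrite /waiting_time/=; case: (k <= 1)%N => //.
exact: measurable_completion.
Qed.

Lemma measurable_cost omega n i (x : W -> nat * R) : measurable_fun setT x ->
  measurable_fun setT (fun w => cost omega n tau (s w) i (x w)).
Proof.
move=> mx; have mst e : measurable_fun setT (fun w => state tau (s w) i (x w) e).
  exact: measurable_state.
apply: measurable_funD; apply: measurable_funM => //; apply: measurable_sum => j /=.
  by apply: measurable_idle_time => //; exact: measurable_decision.
exact: measurable_waiting_time.
Qed.

End measurable_dynamics.

(** * The Bellman operator *)

(* One-sided versions of continuity: the Erlang density of shape [1] jumps upwards at [0],
   so that only upper bounds on the increase of the functions below hold. *)
Section right_upper_semicontinuity.
Context {R : realType}.
Implicit Types (f g : R -> \bar R) (x : R).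
Local Open Scope ereal_scope.

Definition right_usc f : Prop := forall x e, (0 <= x)%R -> (0 < e)%R ->
  exists2 d : R, (0 < d)%R & forall h, (0 <= h < d)%R -> f (x + h)%R <= f x + e%:E.

(** The constant may depend on the point: for the integral terms of the Bellman operator it grows
    with [t]. *)
Definition right_lipschitz_at f x : Prop := exists2 c : R, (0 <= c)%R &
  forall h, (0 <= h)%R -> f (x + h)%R <= f x + (c * h)%:E.

Lemma right_lipschitz_atD f g x : right_lipschitz_at f x -> right_lipschitz_at g x ->
  right_lipschitz_at (f \+ g) x.
Proof.
move=> [c c0 cf] [c' c'0 cg]; exists (c + c')%R; first exact: addr_ge0.
by move=> h h0 /=; rewrite mulrDl EFinD addeACA leeD ?cf ?cg.
Qed.

Lemma right_lipschitz_at_sum (I : eqType) (r : seq I) (F : I -> R -> \bar R) x :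
  (forall i, i \in r -> right_lipschitz_at (F i) x) ->
  right_lipschitz_at (fun y => \sum_(i <- r) F i y) x.
Proof.
elim: r => [|i r IH] hF.
  by exists 0%R => // h h0; rewrite !big_nil mul0r adde0.
have hi : right_lipschitz_at (F i) x by apply: hF; rewrite mem_head.
have /IH hr : forall j, j \in r -> right_lipschitz_at (F j) x.
  by move=> j jr; apply: hF; rewrite in_cons jr orbT.
have [c c0 hc] := right_lipschitz_atD hi hr.
by exists c => // h h0; rewrite !big_cons; exact: hc.
Qed.

Lemma right_lipschitz_usc f g : (forall x, (0 <= x)%R -> right_lipschitz_at f x) ->
  right_usc g -> right_usc (f \+ g).
Proof.
move=> hf hg x e x0 e0; have [c c0 hc] := hf x x0.
have e20 : (0 < e / 2)%R by rewrite divr_gt0.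
have [d d0 hd] := hg x _ x0 e20.
(* Dividing by [c + 1] covers the case [c = 0]. *)
have c10 : (0 < c + 1)%R by rewrite ltr_wpDl.
exists (Num.min d (e / 2 / (c + 1))%R); first by rewrite lt_min d0 divr_gt0.
move=> h /andP[h0]; rewrite lt_min => /andP[hd' hc'] /=.
rewrite [e in leRHS]splitr EFinD addeACA; apply: leeD; last by rewrite hd// h0.
apply: le_trans (hc h h0) _; rewrite leeD2l// lee_fin.
rewrite (@le_trans _ _ ((c + 1) * h)%R)//; first by rewrite ler_wpM2r// lerDl.
by rewrite mulrC -ler_pdivlMr// ltW.
Qed.

Lemma eq_right_usc f g : (forall x, (0 <= x)%R -> f x = g x) -> right_usc g -> right_usc f.
Proof.
move=> fg hg x e x0 e0; have [d d0 hd] := hg x e x0 e0; exists d => // h hhd.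
by rewrite !fg//; [exact: hd|case/andP: hhd => h0 _; rewrite addr_ge0].
Qed.

End right_upper_semicontinuity.

(** * Estimates for the unnormalized Bellman operator *)

Section bellman_operator.
Context {R : realType}.
Notation leb := (@lebesgue_measure R).
Variables (K : nat) (mu p omega : R).
Hypotheses (K0 : (0 < K)%N) (mu0 : (0 < mu)%R) (p01 : (0 <= p <= 1)%R).
Hypothesis omega01 : (0 <= omega <= 1)%R.
Implicit Types (C : nat -> R -> \bar R) (k z r l : nat) (u v t e : R).

Let om0 : 0 <= omega. Proof. by case/andP: omega01. Qed.
Let om1 : 0 <= 1 - omega. Proof. by case/andP: omega01 => _; rewrite subr_ge0. Qed.

Definition erlang_mix r z x : R := phase_mix K p r z (fun j => erlang_pdf j mu x).

Lemma erlang_mix_ge0 r z x : 0 <= erlang_mix r z x.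
Proof. by apply: phase_mix_ge0 => // j _; exact: erlang_pdf_ge0. Qed.

Lemma measurable_erlang_mix r z : measurable_fun setT (erlang_mix r z).
Proof.
rewrite /erlang_mix /phase_mix; case: (leqP z K) => _; apply: measurable_sum => m;
  by apply: measurable_funM => //; exact: measurable_erlang_pdf.
Qed.

Lemma work_pdfE r u x : work_pdf K mu p r u x =
  \sum_(1 <= z < K.+2) phase_weight K mu p z u * erlang_mix r z x.
Proof. by []. Qed.

Lemma fbar_phaseE k z t : (0 < k)%N ->
  fbar_phase K mu p k z t = phase_mix K p k z (fun j => idle_erlang mu j t).
Proof.
by case: k => // k _; rewrite /fbar_phase /phase_mix /binomial_mix; case: ifPn.
Qed.

Lemma down_phaseE k z t : (0 < k)%N ->
  down_phase K mu p k z t = phase_mix K p k z (fun j => erlang_cdf mu j t).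
Proof.
by case: k => // k _; rewrite /down_phase /phase_mix /binomial_mix; case: ifPn.
Qed.

Lemma fbar_phase_ge0 k z t : (0 < k)%N -> 0 <= fbar_phase K mu p k z t.
Proof.
move=> k0; rewrite fbar_phaseE//; apply: phase_mix_ge0 => // j _.
by apply: Rintegral_ge0 => x _; exact: erlang_cdf_ge0.
Qed.

Lemma hbar_phase_ge0 k z : (0 < z <= K.+1)%N -> 0 <= hbar_phase K mu p k z.
Proof.
move=> zK; have [k1|k1] := leqP k 1; first by rewrite /hbar_phase k1.
rewrite hbar_phaseE//; apply: phase_mix_ge0 => // j _.
by rewrite divr_ge0// ltW.
Qed.

Lemma down_phase_ge0 k z t : (0 < k)%N -> 0 <= down_phase K mu p k z t.
Proof.
by move=> k0; rewrite down_phaseE//; apply: phase_mix_ge0 => // j _; exact: erlang_cdf_ge0.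
Qed.

Lemma down_phase_le1 k z t : (0 < k)%N -> down_phase K mu p k z t <= 1.
Proof.
move=> k0; rewrite down_phaseE// -[leRHS](phase_mix_cst K p k z).
by apply: ler_phase_mix => // j _; exact: erlang_cdf_le1.
Qed.

Definition phase_running_cost k z t : R :=
  omega * fbar_phase K mu p k z t + (1 - omega) * hbar_phase K mu p k z.

Lemma phase_running_cost_ge0 k z t : (0 < k)%N -> (0 < z <= K.+1)%N ->
  0 <= phase_running_cost k z t.
Proof.
by move=> k0 zK; rewrite addr_ge0// mulr_ge0// ?fbar_phase_ge0 ?hbar_phase_ge0.
Qed.

Local Open Scope ereal_scope.

(* The contribution of the phase [z] of the service in progress, when [C] is the cost
   after the next arrival and some service ends before that arrival. *)
Definition phase_cost C k z t : \bar R :=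
  (phase_running_cost k z t)%:E +
  \sum_(1 <= r < k) \int[leb]_(v in `]0%R, t[)
    ((erlang_mix r z (t - v))%:E * C (k - r).+1 v) +
  (down_phase K mu p k z t)%:E * C 1%N 0%R.

(** Phases are weighted without division by the survival probability, so the case without departures
    carries no factor [P_up]. *)
Definition bellman C k u t : \bar R :=
  \sum_(1 <= z < K.+2) (phase_weight K mu p z u)%:E * phase_cost C k z t +
  C k.+1 (u + t)%R.

Lemma phase_cost_ge0 C k z t : (0 < k)%N -> (0 < z <= K.+1)%N -> (0 <= t)%R ->
  (forall l v, (0 < l <= k.+1)%N -> (0 <= v)%R -> 0 <= C l v) ->
  0 <= phase_cost C k z t.
Proof.
move=> k0 zK t0 C0; rewrite !adde_ge0//.
- by rewrite lee_fin phase_running_cost_ge0.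
- rewrite big_nat; apply: sume_ge0 => r /andP[r0 rk]; apply: integral_ge0 => v /=.
  rewrite in_itv/= => /andP[v0 _]; rewrite mule_ge0 ?lee_fin ?erlang_mix_ge0//.
  by rewrite C0 ?ltW//= ltnS leq_subr.
- by rewrite mule_ge0 ?lee_fin ?down_phase_ge0 ?C0.
Qed.

(** Stated on the half-line because the Bellman equation identifies [value] at nonnegative elapsed
    times only. *)
Definition nonneg_measurable k C : Prop := forall l, (0 < l <= k)%N ->
  measurable_fun (`[0%R, +oo[ : set R) (C l) /\ (forall v, (0 <= v)%R -> 0 <= C l v).

Lemma integral_erlang_mix r z : \int[leb]_x (erlang_mix r z x)%:E = 1.
Proof.
rewrite -[RHS](_ : (phase_mix K p r z (fun=> 1%R))%:E = _); last by rewrite phase_mix_cst.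
rewrite -(ge0_integral_phase_mix K mu0 p01 r z (phi := cst 1))//.
- by apply: eq_integral => x _; rewrite /= mule1.
- move=> j j0; apply: etrans (integral_erlang_pdf j0 mu0).
  by apply: eq_integral => x _; rewrite /= mule1.
Qed.

Lemma integral_erlang_mix_le1 r z t : \int[leb]_(v in `]0%R, t[) (erlang_mix r z (t - v))%:E <= 1.
Proof.
have mm : measurable_fun [set: R] (fun x => (erlang_mix r z x)%:E : \bar R).
  by apply/measurable_EFinP; exact: measurable_erlang_mix.
have m0 x : 0 <= (erlang_mix r z x)%:E by rewrite lee_fin erlang_mix_ge0.
rewrite -(integral_erlang_mix r z) -(ge0_integral_reflection t mm m0).
apply: ge0_subset_integral => //.
by apply: (measurableT_comp mm); exact: measurable_reflection.
Qed.

Let measurable_mixC C r z l t : measurable_fun (`[0%R, +oo[ : set R) (C l) ->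
  measurable_fun (`]0%R, t[ : set R) (fun v => (erlang_mix r z (t - v))%:E * C l v).
Proof.
move=> mC; apply: emeasurable_funM.
  apply: measurable_funTS; apply/measurable_EFinP.
  by apply: (measurableT_comp (measurable_erlang_mix r z)); exact: measurable_reflection.
apply: measurable_funS mC => // v /=; rewrite !in_itv/= => /andP[/ltW ->]//.
Qed.

Let measurable_mix r z t : measurable_fun (`]0%R, t[ : set R) (fun v => (erlang_mix r z (t - v))%:E : \bar R).
Proof.
apply: measurable_funTS; apply/measurable_EFinP.
by apply: (measurableT_comp (measurable_erlang_mix r z)); exact: measurable_reflection.
Qed.

(** Each of the [k.-1] integrals has a kernel of mass at most one and the factor [down_phase] is a
    probability, so each of these [k] terms grows by at most [e]. *)
Lemma le_phase_cost C C' e k z t : (0 < k)%N -> (0 <= e)%R -> (0 <= t)%R ->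
  nonneg_measurable k C -> nonneg_measurable k C' ->
  (forall l v, (0 < l <= k)%N -> (0 <= v)%R -> C' l v <= C l v + e%:E) ->
  phase_cost C' k z t <= phase_cost C k z t + (k%:R * e)%:E.
Proof.
move=> k0 e0 t0 hC hC' CC'.
have -> : (k%:R * e)%:E = \sum_(1 <= r < k) e%:E + e%:E.
  by rewrite sumEFin -EFinD; congr EFin; rewrite sumr_const_nat -mulr_natl;
    case: k k0 {hC hC' CC'} => // k _; rewrite subSS subn0 -natr1; ring.
rewrite /phase_cost [leRHS]addeACA; apply: leeD.
  rewrite -[leRHS]addeA -big_split/=; apply: leeD => //.
  rewrite big_nat [leRHS]big_nat; apply: lee_sum => r /andP[r0 rk].
  have lk : (0 < (k - r).+1 <= k)%N by rewrite ltnS/= ltn_subrL k0 r0.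
  have [mC C0] := hC _ lk; have [mC' C'0] := hC' _ lk.
  have posv v : `]0%R, t[%classic v -> (0 <= v)%R by rewrite /= in_itv/= => /andP[/ltW].
  have mix0 v : 0 <= (erlang_mix r z (t - v))%:E by rewrite lee_fin erlang_mix_ge0.
  apply: (@le_trans _ _ (\int[leb]_(v in `]0%R, t[)
      ((erlang_mix r z (t - v))%:E * C (k - r).+1 v + (erlang_mix r z (t - v))%:E * e%:E))).
    apply: ge0_le_integral => //.
    - by move=> v /posv v0; rewrite mule_ge0 ?C'0.
    - exact: measurable_mixC.
    - apply: emeasurable_funD; first exact: measurable_mixC.
      by apply: emeasurable_funM; [exact: measurable_mix|exact: measurable_cst].
    - by move=> v /posv v0; rewrite -ge0_muleDr ?C0// lee_wpmul2l// CC'.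
  rewrite ge0_integralD//.
  - rewrite leeD2l//.
    under eq_integral do rewrite muleC.
    have eE : 0 <= e%:E by rewrite lee_fin.
    rewrite (ge0_integralZl lebesgue_measure (measurable_itv _) (@measurable_mix r z t)
      (fun v _ => mix0 v) eE).
    by rewrite -[leRHS]mule1 lee_wpmul2l// integral_erlang_mix_le1.
  - by move=> v /posv v0; rewrite mule_ge0 ?C0.
  - exact: measurable_mixC.
  - by move=> v _; rewrite mule_ge0.
  - by apply: emeasurable_funM; [exact: measurable_mix|exact: measurable_cst].
have [_ C0] := hC 1%N k0.
apply: (@le_trans _ _ ((down_phase K mu p k z t)%:E * (C 1%N 0%R + e%:E))).
  by rewrite lee_wpmul2l ?lee_fin ?down_phase_ge0// CC'.
rewrite ge0_muleDr ?C0//; rewrite leeD2l// -EFinM lee_fin ler_piMl//.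
exact: down_phase_le1.
Qed.

Lemma phase_weight_le1 z u : (0 <= u)%R -> (phase_weight K mu p z u <= 1)%R.
Proof.
move=> u0; rewrite /phase_weight; case: ifPn => _; first exact: poisson_weight_le1.
have /andP[p0 p1] := p01.
rewrite -2!mulrA [X in (_ * X)%R]mulrA -[leRHS]mulr1 ler_pM ?subr_ge0//.
- exact: poisson_weight_ge0.
- by rewrite gerBl.
- exact: poisson_weight_le1.
Qed.

(** Each of the [K.+1] phases has weight at most one and contributes [k * e]; the last term
    contributes [e]. The case [e = 0] is monotonicity, and [C = 0] yields upper bounds. *)
Lemma le_bellman C C' e k u t : (0 < k)%N -> (0 <= e)%R -> (0 <= u)%R -> (0 <= t)%R ->
  nonneg_measurable k.+1 C -> nonneg_measurable k.+1 C' ->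
  (forall l v, (0 < l <= k.+1)%N -> (0 <= v)%R -> C' l v <= C l v + e%:E) ->
  bellman C' k u t <= bellman C k u t + ((K.+1 * k).+1%:R * e)%:E.
Proof.
move=> k0 e0 u0 t0 hC hC' CC'.
have w D : nonneg_measurable k.+1 D -> nonneg_measurable k D.
  by move=> hD l /andP[l0 lk]; apply: hD; rewrite l0 ltnW.
have -> : ((K.+1 * k).+1%:R * e)%:E = \sum_(1 <= z < K.+2) (k%:R * e)%:E + e%:E.
  by rewrite sumEFin -EFinD; congr EFin; rewrite sumr_const_nat subSS subn0 -mulr_natl
    -natr1 natrM; ring.
rewrite /bellman [leRHS]addeACA; apply: leeD; last by rewrite CC' ?leqnn// addr_ge0.
rewrite -big_split/= big_nat [leRHS]big_nat; apply: lee_sum => z zK.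
have pw0 := phase_weight_ge0 K mu0 p01 z u0.
apply: (@le_trans _ _ ((phase_weight K mu p z u)%:E * (phase_cost C k z t + (k%:R * e)%:E))).
  rewrite lee_wpmul2l ?lee_fin// le_phase_cost//; [exact: w|exact: w|].
  by move=> l v /andP[l0 lk]; apply: CC'; rewrite l0 ltnW.
rewrite ge0_muleDr ?lee_fin ?mulr_ge0//; last first.
  by apply: phase_cost_ge0 => // l v lk; have [_] := hC l lk; apply.
by rewrite leeD2l// lee_fin ler_piMl ?mulr_ge0 ?phase_weight_le1.
Qed.

Lemma measurable_phase_weight z : measurable_fun setT (phase_weight K mu p z).
Proof.
have mE : measurable_fun setT (fun u : R => expR (- (mu * u))).
  by apply: measurableT_comp => //; apply: measurableT_comp.
have mX i : measurable_fun setT (fun u : R => ((mu * u) ^+ i)%R).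
  by apply: (@measurableT_comp _ _ _ _ _ _ (fun x : R => (x ^+ i)%R)) => //;
    exact: measurable_funM.
rewrite /phase_weight; case: (leqP z K) => _; apply: measurable_funM => //;
  apply: measurable_funM => //; exact: measurable_funM.
Qed.

Let poisson_weight_right_modulus i u h : (0 <= u)%R -> (0 <= h)%R ->
  (poisson_weight mu i (u + h) <= poisson_weight mu i u + i%:R * mu * h)%R.
Proof.
move=> u0 h0; have := erlang_pdf_right_modulus mu0 i u0 h0.
rewrite !erlang_pdfS ?addr_ge0// => H.
rewrite -(ler_pM2l mu0) (le_trans H)// mulrDr lerD2l.
by rewrite expr2 !mulrA [(mu * _)%R]mulrC.
Qed.

Lemma phase_weight_right_modulus z u h : (0 <= u)%R -> (0 <= h)%R ->
  (phase_weight K mu p z (u + h) <= phase_weight K mu p z u + z%:R * mu * h)%R.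
Proof.
move=> u0 h0; rewrite /phase_weight; case: leqP => zK.
  apply: le_trans (poisson_weight_right_modulus z.-1 u0 h0) _.
  by rewrite lerD2l ler_wpM2r// ler_wpM2r ?ler_nat ?leq_pred// ltW.
have /andP[p0 p1] := p01.
have E v : ((1 - p) * expR (- (mu * v)) * (mu * v) ^+ K / K`!%:R =
  (1 - p) * poisson_weight mu K v)%R by rewrite /poisson_weight !mulrA.
apply: (@le_trans _ _ ((1 - p) * (poisson_weight mu K u + K%:R * mu * h))%R).
  by rewrite E ler_wpM2l ?subr_ge0// poisson_weight_right_modulus.
rewrite E mulrDr lerD2l -!mulrA; apply: (@le_trans _ _ (K%:R * (mu * h))%R).
  by rewrite ler_piMl ?gerBl// !mulr_ge0// ltW.
by rewrite ler_wpM2r ?ler_nat ?(ltnW zK)// mulr_ge0// ltW.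
Qed.

Lemma erlang_mix_le r z x : (erlang_mix r z x <= mu)%R.
Proof.
rewrite -[leRHS](phase_mix_cst K p r z); apply: ler_phase_mix => // j j0.
exact: erlang_pdf_le.
Qed.

Lemma erlang_mix_right_modulus r z : exists2 c : R, (0 <= c)%R & forall x h,
  (0 <= x)%R -> (0 <= h)%R -> (erlang_mix r z (x + h) <= erlang_mix r z x + c * h)%R.
Proof.
exists (phase_mix K p r z (fun j => (j.-1)%:R * mu ^+ 2)%R).
  by apply: phase_mix_ge0 => // j _; rewrite mulr_ge0// exprn_ge0// ltW.
move=> x h x0 h0; rewrite mulrC -phase_mixZ -phase_mixD.
apply: ler_phase_mix => // -[|j]// _.
by rewrite [leRHS]addrC [(h * _)%R]mulrC addrC erlang_pdf_right_modulus.
Qed.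

(** Summing over the phases first recovers [work_pdf]. This grouping by departures matches the cost
    of a policy and the stated recursion, while the grouping by phases suits the estimates. *)
Lemma bellmanE C k u t : (0 < k)%N -> (0 <= u)%R -> (0 <= t)%R ->
  nonneg_measurable k.+1 C ->
  bellman C k u t =
  (omega * (\sum_(1 <= z < K.+2) phase_weight K mu p z u * fbar_phase K mu p k z t) +
   (1 - omega) * (\sum_(1 <= z < K.+2) phase_weight K mu p z u * hbar_phase K mu p k z))%R%:E +
  \sum_(1 <= r < k) \int[leb]_(v in `]0%R, t[)
    ((work_pdf K mu p r u (t - v))%:E * C (k - r).+1 v) +
  (\sum_(1 <= z < K.+2) phase_weight K mu p z u * down_phase K mu p k z t)%R%:E * C 1%N 0%R +
  C k.+1 (u + t)%R.
Proof.
move=> k0 u0 t0 hC; rewrite /bellman; congr (_ + _).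
have pw0 z : (0 <= phase_weight K mu p z u)%R by exact: phase_weight_ge0.
have [_ C10] : measurable_fun (`[0%R, +oo[ : set R) (C 1%N) /\
  (forall v, (0 <= v)%R -> 0 <= C 1%N v) by exact: hC.
pose I r z := \int[leb]_(v in `]0%R, t[) ((erlang_mix r z (t - v))%:E * C (k - r).+1 v).
have mix0 r z x : 0 <= (erlang_mix r z x)%:E by rewrite lee_fin erlang_mix_ge0.
have posv v : `]0%R, t[%classic v -> (0 <= v)%R by rewrite /= in_itv/= => /andP[/ltW].
have hCr r : (0 < r < k)%N -> measurable_fun (`[0%R, +oo[ : set R) (C (k - r).+1) /\
  (forall v, (0 <= v)%R -> 0 <= C (k - r).+1 v).
  by move=> /andP[r0 rk]; apply: hC; rewrite /= ltnS leq_subr.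
have I0 r z : (0 < r < k)%N -> 0 <= I r z.
  move=> /hCr[_ C0]; apply: integral_ge0 => v /posv v0.
  by rewrite mule_ge0 ?C0.
transitivity (\sum_(1 <= z < K.+2)
   ((phase_weight K mu p z u * phase_running_cost k z t)%:E +
    \sum_(1 <= r < k) (phase_weight K mu p z u)%:E * I r z +
    (phase_weight K mu p z u * down_phase K mu p k z t)%R%:E * C 1%N 0%R)).
  apply: eq_big_nat => z zK; rewrite /phase_cost.
  have S0 : 0 <= \sum_(1 <= r < k) I r z.
    by rewrite big_nat; apply: sume_ge0 => r; exact: I0.
  have d0 : 0 <= (down_phase K mu p k z t)%:E by rewrite lee_fin down_phase_ge0.
  have r0 : 0 <= (phase_running_cost k z t)%:E by rewrite lee_fin phase_running_cost_ge0.
  rewrite ge0_muleDr ?adde_ge0 ?mule_ge0 ?C10// ge0_muleDr// muleA -!EFinM.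
  congr (_ + _ + _); rewrite big_nat [RHS]big_nat ge0_sume_distrr// => r.
  exact: I0.
rewrite [LHS]big_split [X in X + _ = _]big_split/=; congr (_ + _ + _).
- rewrite sumEFin; congr EFin; rewrite !big_distrr -big_split/=.
  by apply: eq_bigr => z _; rewrite /phase_running_cost; ring.
- rewrite exchange_big/= [LHS]big_nat [RHS]big_nat; apply: eq_bigr => r rk.
  have [mC C0] := hCr r rk.
  transitivity (\int[leb]_(v in `]0%R, t[) (\sum_(1 <= z < K.+2)
      (phase_weight K mu p z u)%:E * ((erlang_mix r z (t - v))%:E * C (k - r).+1 v))); last first.
    apply: eq_integral => v; rewrite inE => /posv v0; rewrite work_pdfE -sumEFin ge0_sume_distrl.
      by apply: eq_bigr => z _; rewrite EFinM muleA.
    by move=> z _; rewrite lee_fin mulr_ge0 ?erlang_mix_ge0.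
  have mm z := @measurable_mixC C r z (k - r).+1 t mC.
  have mC0 z v : `]0%R, t[%classic v -> 0 <= (erlang_mix r z (t - v))%:E * C (k - r).+1 v.
    by move=> /posv v0; rewrite mule_ge0 ?C0.
  rewrite ge0_integral_sum//.
  + apply: eq_bigr => z _; rewrite ge0_integralZl//; first exact: mm.
      by move=> v; exact: mC0.
    by rewrite lee_fin.
  + by move=> z; apply: measurable_funeM; exact: mm.
  + by move=> z v /mC0 h; rewrite mule_ge0 ?lee_fin.
- rewrite -ge0_sume_distrl ?sumEFin// => z _.
  by rewrite lee_fin mulr_ge0 ?down_phase_ge0.
Qed.

Variables (C : nat -> R -> \bar R) (k : nat) (M : R).
Hypotheses (k0 : (0 < k)%N) (M0 : (0 <= M)%R).
Hypothesis hC : nonneg_measurable k.+1 C.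
Hypothesis CM : forall l v, (0 < l <= k.+1)%N -> (0 <= v)%R -> C l v <= M%:E.

Let hC' : nonneg_measurable k C.
Proof. by move=> l /andP[l0 lk]; apply: hC; rewrite l0 ltnW. Qed.

Lemma phase_cost_le z t : (0 <= t)%R ->
  phase_cost C k z t <= (phase_running_cost k z t + k%:R * M)%:E.
Proof.
move=> t0.
have h0 : nonneg_measurable k (fun _ _ => 0 : \bar R).
  by move=> l _; split => //; exact: measurable_cst.
apply: le_trans (le_phase_cost z k0 M0 t0 h0 hC' _) _.
  by move=> l v /andP[l0 lk] v0; rewrite add0e CM// l0 ltnW.
rewrite EFinD leeD2r// /phase_cost mule0 adde0 big1 ?adde0// => r _.
by under eq_integral do rewrite mule0; rewrite integral0.
Qed.

Lemma phase_cost_fin_num z t : (0 < z <= K.+1)%N -> (0 <= t)%R ->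
  phase_cost C k z t \is a fin_num.
Proof.
move=> zK t0; rewrite ge0_fin_numE.
  by apply: le_lt_trans (phase_cost_le _ t0) _; rewrite ltry.
by apply: phase_cost_ge0 => // l v lk; have [_] := hC lk; apply.
Qed.

Lemma bellman_le u t : (0 <= u)%R -> (0 <= t)%R -> bellman C k u t <=
  ((\sum_(1 <= z < K.+2) phase_running_cost k z t) + (K.+1 * k).+1%:R * M)%:E.
Proof.
move=> u0 t0.
have h0 : nonneg_measurable k.+1 (fun _ _ => 0 : \bar R).
  by move=> l _; split => //; exact: measurable_cst.
apply: le_trans (le_bellman k0 M0 u0 t0 h0 hC _) _.
  by move=> l v lk v0; rewrite add0e CM.
rewrite EFinD leeD2r// /bellman adde0 -sumEFin big_nat [leRHS]big_nat.
apply: lee_sum => z zK; rewrite /phase_cost mule0 adde0 big1 ?adde0; last first.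
  by move=> r _; under eq_integral do rewrite mule0; rewrite integral0.
by rewrite -EFinM lee_fin ler_piMl ?phase_running_cost_ge0 ?phase_weight_le1.
Qed.

Lemma measurable_bellman t : (0 <= t)%R ->
  measurable_fun (`[0%R, +oo[ : set R) (fun u => bellman C k u t).
Proof.
move=> t0; apply: emeasurable_funD.
  apply: emeasurable_sum => z.
  apply: emeasurable_funM; last exact: measurable_cst.
  by apply: measurable_funTS; apply/measurable_EFinP; exact: measurable_phase_weight.
have /(_ k.+1) [|mC _] := hC; first by rewrite leqnn.
apply: (measurable_comp (F := `[0%R, +oo[ : set R)) mC _ => //.
  move=> _ [v /= v0 <-]; move: v0; rewrite !in_itv/= !andbT => v0.
  exact: addr_ge0.
by apply: measurable_funTS; apply: measurable_funD.
Qed.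

(** For fixed [t], only the phase weights and the argument of the last term move with [u]; the
    weights are one-sidedly Lipschitz and their coefficients are finite. *)
Lemma right_usc_bellman_elapsed t : (0 <= t)%R -> right_usc (C k.+1) ->
  right_usc (fun u => bellman C k u t).
Proof.
move=> t0 rC.
apply: (right_lipschitz_usc (g := fun u => C k.+1 (u + t)%R)); last first.
  move=> x e x0 e0; have [d d0 hd] := rC (x + t)%R e (addr_ge0 x0 t0) e0.
  by exists d => // h hhd; rewrite addrAC; exact: hd.
move=> u u0; apply: right_lipschitz_at_sum => z; rewrite mem_index_iota => zK.
have A0 : 0 <= phase_cost C k z t.
  by apply: phase_cost_ge0 => // l v lk; have [_] := hC lk; apply.
have Afin := phase_cost_fin_num zK t0.
exists (z%:R * mu * fine (phase_cost C k z t))%R.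
  by rewrite !mulr_ge0 ?fine_ge0// ltW.
move=> h h0; rewrite -(fineK Afin) -!EFinM -EFinD lee_fin /=.
rewrite [leRHS](_ : _ = (phase_weight K mu p z u + z%:R * mu * h) * fine (phase_cost C k z t))%R.
  by rewrite ler_wpM2r ?fine_ge0 ?phase_weight_right_modulus.
by ring.
Qed.

Lemma running_cost_right_lipschitz z t :
  right_lipschitz_at (fun t => (phase_running_cost k z t)%:E) t.
Proof.
exists omega => // h h0; rewrite -EFinD lee_fin /phase_running_cost addrAC lerD2r.
rewrite -mulrDr ler_wpM2l// !fbar_phaseE//.
rewrite -[h in leRHS](phase_mix_cst K p k z) -phase_mixD.
by apply: ler_phase_mix => // j j0; exact: idle_erlang_right_modulus.
Qed.

Lemma down_phase_right_lipschitz z t :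
  right_lipschitz_at (fun t => (down_phase K mu p k z t)%:E * C 1%N 0%R) t.
Proof.
have [_ C0] := hC' (l := 1%N) k0.
have Cfin : C 1%N 0%R \is a fin_num.
  by rewrite ge0_fin_numE ?C0// (le_lt_trans (CM _ _)) ?ltry.
exists (mu * fine (C 1%N 0%R))%R; first by rewrite mulr_ge0 ?fine_ge0 ?C0// ltW.
move=> h h0; rewrite -(fineK Cfin) -!EFinM -EFinD lee_fin /=.
rewrite mulrAC -mulrDl ler_wpM2r ?fine_ge0 ?C0// !down_phaseE//.
rewrite -[(mu * h)%R](phase_mix_cst K p k z) -phase_mixD.
by apply: ler_phase_mix => // j j0; exact: erlang_cdf_right_modulus.
Qed.

(** On the old interval, of length [t], the kernel grows by at most [c * h], which gives
    [c * M * t]. On the new interval, of length [h], the kernel is at most [mu], which gives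
    [mu * M]. *)
Lemma integral_right_lipschitz r z l t : (0 < l <= k)%N -> (0 <= t)%R ->
  right_lipschitz_at (fun t => \int[leb]_(v in `]0%R, t[)
    ((erlang_mix r z (t - v))%:E * C l v)) t.
Proof.
move=> lk t0; have [c c0 hc] := erlang_mix_right_modulus r z.
have [mC C0] := hC' lk.
have CMl v : (0 <= v)%R -> C l v <= M%:E by move=> v0; rewrite CM//; have /andP[-> /leqW] := lk.
exists (c * M * t + mu * M)%R.
  by rewrite addr_ge0// !mulr_ge0// ltW.
move=> h h0.
pose f v := (erlang_mix r z (t + h - v))%:E * C l v.
have mix0 r' x : 0 <= (erlang_mix r' z x)%:E by rewrite lee_fin erlang_mix_ge0.
have sub1 : (`]0%R, (t + h)%R[ : set R) `<=` (`]0%R, t[ : set R) `|` `[t, (t + h)%R[.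
  move=> v; rewrite /= !in_itv/= => /andP[v0 vh]; case: (ltP v t) => vt; [left|right].
    by rewrite v0.
  by rewrite vh.
have posU v : (`]0%R, t[%classic `|` `[t, (t + h)%R[%classic : set R) v -> (0 <= v)%R.
  by rewrite /= !in_itv/= => -[/andP[/ltW//]|/andP[/(le_trans t0)]].
have mf : measurable_fun (`]0%R, t[%classic `|` `[t, (t + h)%R[%classic : set R) f.
  apply: emeasurable_funM.
    apply: measurable_funTS; apply/measurable_EFinP.
    by apply: (measurableT_comp (measurable_erlang_mix r z)); exact: measurable_reflection.
  by apply: measurable_funS mC => // v /posU /=; rewrite in_itv/= andbT.
have mU : measurable (`]0%R, t[%classic `|` `[t, (t + h)%R[%classic : set R).
  exact: measurableU.
have f0 v : (`]0%R, t[%classic `|` `[t, (t + h)%R[%classic : set R) v -> 0 <= f v.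
  by move=> /posU v0; rewrite mule_ge0 ?C0.
apply: (@le_trans _ _ (\int[leb]_(v in `]0%R, t[ `|` `[t, (t + h)%R[) f v)).
  by apply: ge0_subset_integral => //; exact: measurableU.
rewrite ge0_integral_setU//; last first.
  apply/disj_setPS => v [] /=; rewrite !in_itv/= => /andP[_ vt] /andP[tv _].
  by have := lt_le_trans vt tv; rewrite ltxx.
have -> : ((c * M * t + mu * M) * h)%:E = (c * M * t * h)%:E + (mu * M * h)%:E.
  by rewrite -EFinD mulrDl.
rewrite [leRHS]addeA; apply: leeD.
  apply: (@le_trans _ _ (\int[leb]_(v in `]0%R, t[)
      ((erlang_mix r z (t - v))%:E * C l v + (c * M * h)%:E))).
    apply: ge0_le_integral => //.
    - by move=> v v0; apply: f0; left.
    - by apply: (measurable_funS mU _ mf) => v; left.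
    - by apply: emeasurable_funD; [exact: measurable_mixC|exact: measurable_cst].
    - move=> v /= v0t; have v0 := posU v (or_introl v0t).
      apply: (@le_trans _ _ ((erlang_mix r z (t - v) + c * h)%:E * C l v)).
        rewrite lee_wpmul2r ?C0// lee_fin addrAC hc// subr_ge0.
        by move: v0t; rewrite in_itv/= => /andP[_ /ltW].
      rewrite EFinD ge0_muleDl ?lee_fin ?erlang_mix_ge0 ?mulr_ge0//.
      by rewrite leeD2l// [(c * M * h)%R]mulrAC [leRHS]EFinM lee_wpmul2l ?lee_fin ?mulr_ge0 ?CMl.
  rewrite ge0_integralD//.
  - rewrite leeD2l// integral_cst//= lebesgue_measure_itv/= lte_fin.
    case: ltP => [_|]; last by rewrite mule0 lee_fin !mulr_ge0.
    by rewrite -EFinB subr0 -EFinM lee_fin mulrAC.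
  - by move=> v v0; rewrite mule_ge0 ?C0// (posU v (or_introl v0)).
  - exact: measurable_mixC.
  - by move=> v _; rewrite lee_fin !mulr_ge0.
apply: (@le_trans _ _ (\int[leb]_(v in `[t, (t + h)%R[) (mu * M)%:E)).
  apply: ge0_le_integral => //.
  - by move=> v v0; apply: f0; right.
  - by apply: (measurable_funS mU _ mf) => v; right.
  - move=> v /= v0t; have v0 := posU v (or_intror v0t).
    by rewrite EFinM lee_pmul ?C0 ?CMl// lee_fin erlang_mix_le.
rewrite integral_cst//= lebesgue_measure_itv/= lte_fin.
case: ltP => [_|]; last by rewrite mule0 lee_fin !mulr_ge0// ltW.
by rewrite -EFinB -EFinM lee_fin addrAC subrr add0r.
Qed.

Lemma phase_cost_right_lipschitz z t : (0 <= t)%R ->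
  right_lipschitz_at (phase_cost C k z) t.
Proof.
move=> t0; apply: right_lipschitz_atD; last exact: down_phase_right_lipschitz.
apply: right_lipschitz_atD; first exact: running_cost_right_lipschitz.
apply: right_lipschitz_at_sum => r; rewrite mem_index_iota => /andP[r0 rk].
by apply: integral_right_lipschitz => //; rewrite ltnS/= ltn_subrL k0 r0.
Qed.

Lemma right_usc_bellman u : (0 <= u)%R -> right_usc (C k.+1) ->
  right_usc (bellman C k u).
Proof.
move=> u0 rC.
apply: (right_lipschitz_usc (g := fun t => C k.+1 (u + t)%R)); last first.
  move=> x e x0 e0; have [d d0 hd] := rC (u + x)%R e (addr_ge0 u0 x0) e0.
  by exists d => // h hhd; rewrite addrA; exact: hd.
move=> t t0; apply: right_lipschitz_at_sum => z; rewrite mem_index_iota => zK.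
have [c c0 hc] := phase_cost_right_lipschitz z t0.
have pw0 := phase_weight_ge0 K mu0 p01 z u0.
exists (phase_weight K mu p z u * c)%R; first exact: mulr_ge0.
move=> h h0; rewrite -mulrA EFinM -ge0_muleDr.
- by rewrite lee_wpmul2l ?lee_fin ?hc.
- by apply: phase_cost_ge0 => // l v lk; have [_] := hC lk; apply.
- by rewrite lee_fin mulr_ge0.
Qed.

End bellman_operator.

(** * Expected cost of a policy *)

Section policy_evaluation.
Context d (T : measurableType d) (R : realType) (P : probability T R).
Notation leb := (@lebesgue_measure R).
Variables (n K : nat) (mu p omega : R) (X : nat -> T -> R).
Hypotheses (K0 : (0 < K)%N) (mu0 : (0 < mu)%R) (p01 : (0 <= p <= 1)%R).
Hypothesis omega01 : (0 <= omega <= 1)%R.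
Hypothesis mX : forall j, measurable_fun setT (X j).
Hypothesis X0 : forall j w, (0 < X j w)%R.
Hypothesis indepX : forall A : nat -> set R, (forall j, measurable (A j)) ->
  P (\bigcap_(j in [set j | (1 <= j <= n)%N]) (X j @^-1` A j)) =
  (\prod_(1 <= j < n.+1) P (X j @^-1` A j))%E.
Hypothesis lawX : forall j, (1 <= j <= n)%N -> forall phi : R -> \bar R,
  measurable_fun setT phi -> (forall x, 0 <= phi x)%E ->
  (\int[P]_w phi (X j w) = \int[leb]_x ((service_pdf K mu p x)%:E * phi x))%E.
Local Open Scope ereal_scope.

Let om0 : (0 <= omega)%R. Proof. by case/andP: omega01. Qed.
Let om1 : (0 <= 1 - omega)%R. Proof. by case/andP: omega01 => _; rewrite subr_ge0. Qed.
Let X_ge0 w m : (0 <= X m w)%R. Proof. exact: ltW. Qed.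

Definition expected_cost tau (i k : nat) (u : R) : \bar R :=
  \int[P]_(w in [set w | (u < X (i - k).+1 w)%R])
    (cost omega n tau (X ^~ w) i (k, u))%:E.

Lemma expected_waiting_time i k u : (0 < k <= i)%N -> (i <= n)%N -> (0 <= u)%R ->
  \int[P]_(w in [set w | (u < X (i - k).+1 w)%R]) (waiting_time (X ^~ w) i (k, u))%:E =
  (\sum_(1 <= z < K.+2) phase_weight K mu p z u * hbar_phase K mu p k z)%R%:E.
Proof.
move=> /andP[k0 ki] ni u0; have [k1|k1] := leqP k 1.
  rewrite integral0_eq; last by move=> w _; rewrite /waiting_time/= k1.
  by rewrite big1// => z _; rewrite /hbar_phase k1 mulr0.
set a := (i - k).+1.
have ak : (a + k.-1 <= n.+1)%N by rewrite /a; move: k0 ki ni; clear; lia.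
have k10 : (0 < k.-1)%N by rewrite -ltnS prednK.
(* Truncation makes the integrand nonnegative everywhere; on the conditioning event it changes
   nothing. *)
pose phi x : \bar R := (Num.max 0 x)%:E.
have mphi : measurable_fun setT phi.
  by apply/measurable_EFinP; exact: measurable_maxr.
have phi0 x : 0 <= phi x by rewrite lee_fin le_max lexx.
transitivity (\int[P]_(w in [set w | (u < X a w)%R]) phi (elapsed_work X a k.-1 u w)).
  apply: eq_integral => w; rewrite inE/= => uX; rewrite /phi max_r.
    by rewrite /waiting_time /= leqNgt k1.
  have := @waiting_time_ge0 _ (X ^~ w) i (k, u) (X_ge0 w) (ltW uX).
  by rewrite /waiting_time /= leqNgt k1.
rewrite (elapsed_work_law K0 mu0 p01 mX indepX lawX u0 (ltn0Sn _) ak k10 mphi phi0).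
rewrite (ge0_integral_work_pdf K mu0 p01 k.-1 u0 mphi phi0 (c := fun j => (j%:R / mu)%R)).
  by congr EFin; apply: eq_big_nat => z zK; rewrite hbar_phaseE.
by move=> j j0; exact: erlang_mean.
Qed.

Section fixed_policy.
Variable tau : nat -> nat -> R -> R.
Hypothesis ptau : is_policy tau.

(** The cost from client [i] on as a function of elapsed time and services. It is truncated because
    the cost is only known to be nonnegative while the elapsed time does not exceed the service. *)
Let H i l (z : R * seqspace R) : \bar R :=
  (Num.max 0 (cost omega n tau z.2 i (l, z.1)))%:E.

Let H_ge0 i l z : 0 <= H i l z.
Proof. by rewrite lee_fin le_max lexx. Qed.

Let measurable_H d' (W : measurableType d') i l (v : W -> R) (s : W -> nat -> R) :
  measurable_fun setT v -> (forall j, measurable_fun setT (fun w => s w j)) ->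
  measurable_fun setT (fun w => H i l (v w, s w)).
Proof.
move=> mv ms; apply/measurable_EFinP; apply: measurable_maxr => //.
apply: (measurable_cost ms ptau omega n i (x := fun w => (l, v w))).
by apply/measurable_fun_pairP; split; [exact: measurable_cst|exact: mv].
Qed.

Let H_cost i l v w : (i <= n)%N -> (0 < l <= i)%N -> (v <= X (i - l).+1 w)%R ->
  H i l (v, X ^~ w) = (cost omega n tau (X ^~ w) i (l, v))%:E.
Proof.
move=> ni li vX; rewrite /H max_r//.
by apply: cost_ge0 => //; exact: X_ge0.
Qed.

Let H_block i l v w b : (i <= n)%N -> (0 < l <= i)%N -> (i - l).+1 = b ->
  H i l (v, block X b n.+1 w) = H i l (v, X ^~ w).
Proof.
move=> ni /andP[l0 li] ilb; congr (Num.max 0 _)%:E.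
apply: eq_cost => // m /andP[/= m1 m2]; rewrite /block ltnS m2 andbT.
by rewrite ifT// -ilb.
Qed.

Let expected_costE i l v : (i <= n)%N -> (0 < l <= i)%N ->
  expected_cost tau i l v =
  \int[P]_w (((v < X (i - l).+1 w)%R%:R)%:E * H i l (v, X ^~ w)).
Proof.
move=> ni li; rewrite /expected_cost integral_boolE; apply: eq_integral => w _.
by case: ltP => vX; rewrite ?mul1e ?mul0e// H_cost// ltW.
Qed.

Lemma expected_cost_ge0 i l v : (i <= n)%N -> (0 < l <= i)%N ->
  0 <= expected_cost tau i l v.
Proof.
by move=> ni li; rewrite expected_costE//; apply: integral_ge0 => w _; rewrite mule_ge0.
Qed.

Lemma measurable_expected_cost i l : (i <= n)%N -> (0 < l <= i)%N ->
  measurable_fun setT (expected_cost tau i l).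
Proof.
move=> ni li; rewrite (_ : expected_cost tau i l = fun v =>
    \int[P]_w (((v < X (i - l).+1 w)%R%:R)%:E * H i l (v, X ^~ w))); last first.
  by apply/funext => v; exact: expected_costE.
apply: (@measurable_fun_fubini_tonelli_F _ _ _ _ _ P (fun z : R * T =>
   ((z.1 < X (i - l).+1 z.2)%R%:R)%:E * H i l (z.1, X ^~ z.2))); last first.
  by move=> z; rewrite mule_ge0// lee_fin.
apply: emeasurable_funM.
  apply: measurable_EFin_bool; apply: measurable_fun_ltr => //.
  exact: (measurableT_comp (mX _) measurable_snd).
apply: measurable_H => // j.
exact: (measurableT_comp (mX _) measurable_snd).
Qed.

Variables (i k : nat) (u : R).
Hypotheses (i1n : (0 < i < n)%N) (ki : (0 < k <= i)%N) (u0 : (0 <= u)%R).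

Let t := tau i k u.
Let t0 : (0 <= t)%R. Proof. exact: (proj2 (ptau i k)). Qed.
Let a := (i - k).+1.
Let dep w := departures (X ^~ w) i (k, u) t.

Let completionE r w : completion (X ^~ w) i (k, u) r = elapsed_work X a r u w.
Proof. by []. Qed.

Let depE r w : (1 <= r <= k)%N -> (elapsed_work X a r u w <= t)%R = (r <= dep w)%N.
Proof. by move=> rk; rewrite -completionE completion_departures. Qed.

Let dep_le w : (dep w <= k)%N. Proof. exact: departures_le. Qed.

Let h r w : \bar R := H i.+1 (k - r).+1
  ((if (r < k)%N then t - elapsed_work X a r u w else 0)%R, X ^~ w).

(** The contribution of exactly [r] departures before the next arrival. The cases [r = 0],
    [0 < r < k] and [r = k] produce the three kinds of terms of the recursion. *)
Let piece r : \bar R := \int[P]_(w in [set w | (u < X a w)%R])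
  ((((dep w == r)%:R)%R)%:E * h r w).

Let melapsed r : measurable_fun setT (elapsed_work X a r u).
Proof. by apply: measurable_funB => //; apply: measurable_sum. Qed.

Let mh r : measurable_fun setT (h r).
Proof.
apply: measurable_H => //; case: (r < k)%N => //.
exact: measurable_funB.
Qed.

Let mdep r : measurable_fun setT (fun w => (((dep w == r)%:R)%R)%:E : \bar R).
Proof.
apply: measurable_EFin_bool.
have md : measurable_fun setT dep by exact: (measurable_departures mX).
by apply: (measurableT_comp (f := fun m : nat => m == r)) => //.
Qed.

Let mE r : measurable_fun setT (fun w => (((dep w == r)%:R)%R)%:E * h r w).
Proof. exact: emeasurable_funM. Qed.

Let piece_ge0 r w : 0 <= (((dep w == r)%:R)%R)%:E * h r w.
Proof. by apply: mule_ge0; [rewrite lee_fin|exact: H_ge0]. Qed.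

Let mEu : measurable [set w | (u < X a w)%R].
Proof.
rewrite -[X in measurable X]setTI.
exact: (measurable_fun_ltr (measurable_cst u) (mX a)).
Qed.

Let later_cost : \int[P]_(w in [set w | (u < X a w)%R])
    (cost omega n tau (X ^~ w) i.+1 (next_state (X ^~ w) i (k, u) t))%:E =
  \sum_(0 <= r < k.+1) piece r.
Proof.
have /andP[i0 ilt] := i1n; have /andP[k0 kile] := ki.
rewrite /piece -ge0_integral_sum//; last first.
  by move=> r; exact: measurable_funTS.
apply: eq_integral => w; rewrite inE/= => uX.
rewrite (bigD1_seq (dep w)) ?iota_uniq//=; last first.
  by rewrite mem_index_iota/= ltnS dep_le.
rewrite eqxx mul1e big1_seq ?adde0; last first.
  by move=> r /andP[/negbTE rd _]; rewrite eq_sym rd mul0e.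
have -> : next_state (X ^~ w) i (k, u) t = ((k - dep w).+1,
    (if (dep w < k)%N then t - elapsed_work X a (dep w) u w else 0)%R) by [].
rewrite /h H_cost//.
- by move: (dep_le w) kile; rewrite ltnS /=; clear; lia.
- have := @next_state_elapsed _ (X ^~ w) i (k, u) t (X_ge0 w) kile k0.
  exact.
Qed.

(** Nobody leaves exactly when the current service exceeds [u + t]. This event lies inside [u < X a]
    and is the conditioning event of the next state. *)
Let piece0 : piece 0%N = expected_cost tau i.+1 k.+1 (u + t)%R.
Proof.
have /andP[i0 ilt] := i1n; have /andP[k0 kile] := ki.
rewrite expected_costE// ?ltnS// /piece integral_boolE subSS -/a.
apply: eq_integral => w _.
have -> : (dep w == 0%N) = (u + t < X a w)%R.
  rewrite -leqn0 leqNgt -depE// -ltNge /elapsed_work addn1 big_nat1.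
  by rewrite ltrBrDl.
rewrite /h k0 subn0 (_ : t - elapsed_work X a 0%N u w = u + t)%R; last first.
  by rewrite /elapsed_work addn0 big_geq//; ring.
case: ltP => uX; first by rewrite mul1e.
rewrite mul0e ltNge (_ : X a w <= u + t)%R ?mul0e//.
by rewrite (le_trans uX)// lerDl.
Qed.

(** Conditioning on the time [x] of the [r]-th departure leaves an independent block, whose first
    service has to exceed [t - x]: an expected cost with elapsed time [t - x]. A reflection makes
    this elapsed time the variable of integration. *)
Let pieceS r : (0 < r < k)%N -> piece r =
  \int[leb]_(v in `]0%R, t[) ((work_pdf K mu p r u (t - v))%:E *
     expected_cost tau i.+1 (k - r).+1 v).
Proof.
have /andP[i0 ilt] := i1n; have /andP[k0 kile] := ki.
move=> /andP[r0 rk]; set l := (k - r).+1.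
have lE : (i.+1 - l).+1 = (a + r)%N by rewrite /l /a; move: rk kile; clear; lia.
have li : (0 < l <= i.+1)%N by rewrite /l; move: r0 kile; clear; lia.
have arn : (a + r <= n)%N by rewrite /a; move: rk kile ilt; clear; lia.
pose G (z : R * seqspace R) : \bar R := ((z.1 <= t)%R%:R)%:E *
  (((t - z.1 < z.2 (a + r)%N)%R%:R)%:E * H i.+1 l ((t - z.1)%R, z.2)).
have mcoord j : measurable_fun setT (fun z : R * seqspace R => z.2 j).
  exact: (measurableT_comp (measurable_coord j) measurable_snd).
have mtx : measurable_fun setT (fun z : R * seqspace R => (t - z.1)%R).
  exact: measurable_funB.
have mG : measurable_fun setT G.
  apply: emeasurable_funM.
    by apply: measurable_EFin_bool; apply: measurable_fun_ler.
  apply: emeasurable_funM; last exact: measurable_H.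
  by apply: measurable_EFin_bool; apply: measurable_fun_ltr.
have G0 z : 0 <= G z by rewrite !mule_ge0.
have blkE w : block X (a + r) n.+1 w (a + r)%N = X (a + r)%N w.
  by rewrite /block leqnn ltnS arn.
transitivity (\int[P]_(w in [set w | (u < X a w)%R])
    G (elapsed_work X a r u w, block X (a + r) n.+1 w)).
  apply: eq_integral => w _; rewrite /G /= blkE H_block//.
  rewrite /h rk -/l muleA; congr (_ * _); rewrite -EFinM; congr EFin.
  rewrite -natrM mulnb; congr ((nat_of_bool _)%:R)%R.
  (* Both comparisons become bounds on the number of departures: at least [r], but not [r.+1]. *)
  rewrite ltrBlDl -elapsed_workS ltNge depE ?r0 ?(ltnW rk)// depE//.
  by rewrite -ltnNge ltnS eqn_leq andbC.
rewrite (elapsed_work_split K0 mu0 p01 mX indepX lawX u0 (ltn0Sn _) (leqW arn) r0 mG G0).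
have mcl : measurable_fun setT (expected_cost tau i.+1 l).
  exact: measurable_expected_cost.
pose F x : \bar R := (work_pdf K mu p r u x)%:E *
  (((x <= t)%R%:R)%:E * expected_cost tau i.+1 l (t - x)%R).
have mF : measurable_fun [set: R] F.
  apply: emeasurable_funM.
    by apply/measurable_EFinP; exact: measurable_work_pdf.
  apply: emeasurable_funM.
    by apply: measurable_EFin_bool; apply: measurable_fun_ler.
  apply: (measurableT_comp mcl); exact: measurable_reflection.
have F0 x : 0 <= F x.
  by rewrite !mule_ge0 ?lee_fin ?work_pdf_ge0 ?expected_cost_ge0.
transitivity (\int[leb]_x F x).
  apply: eq_integral => x _; rewrite /F; congr (_ * _).
  rewrite expected_costE// lE -ge0_integralZl//.
  - by apply: eq_integral => w _; rewrite /G/= blkE H_block.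
  - apply: emeasurable_funM; last exact: measurable_H.
    by apply: measurable_EFin_bool; apply: measurable_fun_ltr.
  - by move=> w _; rewrite mule_ge0.
rewrite -(ge0_integral_reflection t mF F0).
have mi D : measurable D -> measurable_fun D (fun v : R => (work_pdf K mu p r u (t - v))%:E *
     expected_cost tau i.+1 l v).
  move=> mD; apply: measurable_funTS; apply: emeasurable_funM => //.
  apply/measurable_EFinP; apply: (measurableT_comp (measurable_work_pdf K mu p r u)).
  exact: measurable_reflection.
(* The endpoints are null, and the integrand vanishes outside the closed interval. *)
rewrite integral_itv_bndo_bndc; last exact: mi.
rewrite integral_itv_obnd_cbnd; last exact: mi.
rewrite [RHS]integral_mkcond; apply: eq_integral => v _.
rewrite patchE mem_setE in_itv/= /F subKr gerBl.
case: (leP 0%R v) => v0 /=; last by rewrite mul0e mule0.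
case: (leP v t) => vt; first by rewrite mul1e.
by rewrite lt0_work_pdf ?mul0e// subr_lt0.
Qed.

(** If all clients leave, the next one starts afresh whatever the time of the last departure, so the
    integral factorizes. Positivity of the services makes the conditioning event of the state
    [(1, 0)] the whole space. *)
Let piecek : piece k =
  (\sum_(1 <= z < K.+2) phase_weight K mu p z u * down_phase K mu p k z t)%R%:E *
  expected_cost tau i.+1 1 0%R.
Proof.
have /andP[i0 ilt] := i1n; have /andP[k0 kile] := ki.
have ak : (a + k)%N = i.+1 by rewrite /a; move: kile; clear; lia.
pose G (z : R * seqspace R) : \bar R := ((z.1 <= t)%R%:R)%:E * H i.+1 1 (0%R, z.2).
have mG : measurable_fun setT G.
  apply: emeasurable_funM.
    by apply: measurable_EFin_bool; apply: measurable_fun_ler.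
  apply: measurable_H => // j.
  exact: (measurableT_comp (measurable_coord j) measurable_snd).
have G0 z : 0 <= G z by rewrite mule_ge0.
transitivity (\int[P]_(w in [set w | (u < X a w)%R])
    G (elapsed_work X a k u w, block X (a + k) n.+1 w)).
  apply: eq_integral => w _; rewrite /G /= ak H_block// ?subSS ?subn0//.
  rewrite /h ltnn subnn; congr (_%:E * _).
  by rewrite depE ?k0//= eqn_leq dep_le.
have akn : (a + k <= n.+1)%N by rewrite ak leqW.
rewrite (elapsed_work_split K0 mu0 p01 mX indepX lawX u0 (ltn0Sn _) akn k0 mG G0).
have c0 : 0 <= expected_cost tau i.+1 1 0%R by exact: expected_cost_ge0.
transitivity (\int[leb]_x ((expected_cost tau i.+1 1 0%R) *
    ((work_pdf K mu p k u x)%:E * ((x <= t)%R%:R)%:E))).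
  apply: eq_integral => x _; rewrite muleCA; congr (_ * _).
  rewrite muleC expected_costE// -ge0_integralZl//.
  - apply: eq_integral => w _; rewrite /G /= ak H_block// ?subSS ?subn0//.
    by rewrite X0 mul1e.
  - apply: emeasurable_funM; last exact: measurable_H.
    by apply: measurable_EFin_bool; apply: measurable_fun_ltr.
  - by move=> w _; rewrite mule_ge0.
have mb : measurable_fun [set: R] (fun x => ((x <= t)%R%:R)%:E : \bar R).
  by apply: measurable_EFin_bool; apply: measurable_fun_ler.
have b0 x : 0 <= ((x <= t)%R%:R)%:E :> \bar R by rewrite lee_fin.
have mw : measurable_fun [set: R] (fun x => (work_pdf K mu p k u x)%:E : \bar R).
  by apply/measurable_EFinP; exact: measurable_work_pdf.
have w0 x : 0 <= (work_pdf K mu p k u x)%:E by rewrite lee_fin work_pdf_ge0.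
have mwb : measurable_fun [set: R] (fun x => (work_pdf K mu p k u x)%:E * ((x <= t)%R%:R)%:E).
  exact: emeasurable_funM mw mb.
have wb0 x : setT x -> 0 <= (work_pdf K mu p k u x)%:E * ((x <= t)%R%:R)%:E by move=> _; exact: mule_ge0.
rewrite (ge0_integralZl lebesgue_measure (@measurableT _ _) mwb wb0 c0) muleC.
rewrite (ge0_integral_work_pdf K mu0 p01 k u0 mb b0 (c := fun j => erlang_cdf mu j t)).
  congr (_ %:E * _); apply: eq_bigr => z _; congr (_ * _)%R.
  rewrite /down_phase /phase_mix /binomial_mix; case: ifPn => // _.
  by case: k k0.
by move=> j j0; exact: erlang_cdfE.
Qed.

Let idle_part : \int[P]_(w in [set w | (u < X a w)%R])
    (idle_time (X ^~ w) i (k, u) t)%:E =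
  (\sum_(1 <= z < K.+2) phase_weight K mu p z u * fbar_phase K mu p k z t)%R%:E.
Proof.
have /andP[i0 ilt] := i1n; have /andP[k0 kile] := ki.
have akn : (a + k <= n.+1)%N by rewrite /a; move: kile ilt; clear; lia.
pose phi x : \bar R := (Num.max 0 (t - x))%:E.
have mphi : measurable_fun setT phi.
  by apply/measurable_EFinP; apply: measurable_maxr => //; exact: measurable_reflection.
have phi0 x : 0 <= phi x by rewrite lee_fin le_max lexx.
rewrite (elapsed_work_law K0 mu0 p01 mX indepX lawX u0 (ltn0Sn _) akn k0 mphi phi0).
rewrite (ge0_integral_work_pdf K mu0 p01 k u0 mphi phi0 (c := fun j => idle_erlang mu j t)).
- congr (_ %:E); apply: eq_bigr => z _; congr (_ * _)%R.
  rewrite /fbar_phase /phase_mix /binomial_mix; case: ifPn => // _.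
  by case: k k0.
- by move=> j j0; exact: idle_erlangE.
Qed.

Let nonneg_measurable_expected_cost : nonneg_measurable k.+1 (expected_cost tau i.+1).
Proof.
have /andP[i0 ilt] := i1n; have /andP[k0 kile] := ki.
move=> l /andP[l0 lk]; have li : (0 < l <= i.+1)%N by rewrite l0 (leq_trans lk).
split => [|v _]; last exact: expected_cost_ge0.
by apply: measurable_funTS; exact: measurable_expected_cost.
Qed.

Lemma expected_cost_bellman : expected_cost tau i k u =
  bellman K mu p omega (expected_cost tau i.+1) k u t.
Proof.
have /andP[i0 ilt] := i1n; have /andP[k0 kile] := ki.
rewrite bellmanE//.
have mid : measurable_fun [set w | (u < X a w)%R]
    (fun w => (idle_time (X ^~ w) i (k, u) t)%:E : \bar R).
  apply: measurable_funTS; apply/measurable_EFinP.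
  exact: (measurable_idle_time mX).
have mwt : measurable_fun [set w | (u < X a w)%R]
    (fun w => (waiting_time (X ^~ w) i (k, u))%:E : \bar R).
  apply: measurable_funTS; apply/measurable_EFinP.
  exact: (measurable_waiting_time mX).
have mct : measurable_fun [set w | (u < X a w)%R]
    (fun w => (cost omega n tau (X ^~ w) i.+1 (next_state (X ^~ w) i (k, u) t))%:E : \bar R).
  apply: measurable_funTS; apply/measurable_EFinP.
  apply: (measurable_cost mX ptau omega n i.+1).
  exact: (measurable_next_state mX).
have omE0 : 0 <= omega%:E by rewrite lee_fin.
have omE1 : 0 <= (1 - omega)%:E by rewrite lee_fin.
have id0 w : 0 <= (idle_time (X ^~ w) i (k, u) t)%:E by rewrite lee_fin idle_time_ge0.
have wt0 w : [set w | (u < X a w)%R] w -> 0 <= (waiting_time (X ^~ w) i (k, u))%:E.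
  by move=> uX; rewrite lee_fin waiting_time_ge0//; exact: ltW.
have ct0 w : [set w | (u < X a w)%R] w ->
    0 <= (cost omega n tau (X ^~ w) i.+1 (next_state (X ^~ w) i (k, u) t))%:E.
  move=> uX; rewrite lee_fin cost_ge0//; first exact: next_state_range.
  exact: next_state_elapsed.
transitivity (\int[P]_(w in [set w | (u < X a w)%R])
    (omega%:E * (idle_time (X ^~ w) i (k, u) t)%:E +
     (1 - omega)%:E * (waiting_time (X ^~ w) i (k, u))%:E +
     (cost omega n tau (X ^~ w) i.+1 (next_state (X ^~ w) i (k, u) t))%:E)).
  by apply: eq_integral => w _; rewrite -!EFinM -!EFinD; congr EFin; exact: cost_step.
rewrite ge0_integralD//; last 2 first.
- by move=> w wE; rewrite adde_ge0// mule_ge0// wt0.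
- by apply: emeasurable_funD; exact: measurable_funeM.
rewrite ge0_integralD//; last 4 first.
- by move=> w wE; rewrite mule_ge0.
- exact: measurable_funeM.
- by move=> w wE; rewrite mule_ge0// wt0.
- exact: measurable_funeM.
rewrite ge0_integralZl// ge0_integralZl// idle_part expected_waiting_time//; last exact: ltnW.
rewrite later_cost -!EFinM -EFinD -!addeA; congr (_ + _).
rewrite big_nat_recr//= big_ltn// piece0 piecek.
rewrite [X in X + _ = _]addeC -addeA [X in _ + X = _]addeC; congr (_ + _).
by rewrite big_nat [RHS]big_nat; apply: eq_bigr => r rk; rewrite pieceS.
Qed.

End fixed_policy.
End policy_evaluation.

(** * Dynamic programming *)

Section measurable_selection.
Context d (W : measurableType d).

(** [N] picks the least index, so its level sets are differences of the [A m]. Where no index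
    qualifies it is [0], which adds a complement to the level set of [0]. *)
Lemma measurable_first_index (A : nat -> set W) : (forall m, measurable (A m)) ->
  exists2 N : W -> nat, measurable_fun setT N & forall w m, A m w -> A (N w) w.
Proof.
move=> mA.
have /choice[N hN] : forall w, exists N : nat,
    (forall m, A m w -> A N w /\ (N <= m)%N) /\ ((forall m, ~ A m w) -> N = 0%N).
  move=> w.
  have [[m Am]|noA] := pselect (exists m, A m w).
    have ex : exists m, `[< A m w >] by exists m; apply/asboolP.
    exists (ex_minn ex); case: ex_minnP => N /asboolP AN Nmin; split.
      by move=> q Aq; split => //; apply: Nmin; apply/asboolP.
    by move=> /(_ N).
  by exists 0%N; split => // m Am; case: noA; exists m.
exists N; last by move=> w m Am; have [/(_ _ Am)[]] := hN w.
move=> _ B _; rewrite setTI.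
rewrite (_ : N @^-1` B = \bigcup_(m in B)
    ((A m `\` \bigcup_(q in `I_m) A q) `|` (if m is 0%N then ~` \bigcup_q A q else set0))).
  apply: bigcup_measurable => m _; apply: measurableU.
    by apply: measurableD => //; apply: bigcup_measurable.
  by case: m => // ; apply: measurableC; exact: bigcupT_measurable.
apply/seteqP; split => w /=.
  move=> BN; exists (N w) => //; have [h1 h2] := hN w.
  have [[m Am]|noA] := pselect (exists m, A m w); [left|right].
    split; first by have [] := h1 _ Am.
    by case=> q /= qN /h1[_]; rewrite leqNgt qN.
  rewrite h2; last by move=> m Am; apply: noA; exists m.
  by case=> q _ Aq; apply: noA; exists q.
case=> m Bm [[Am hm]|]; have [h1 h2] := hN w.
  suff -> : N w = m by [].
  apply/eqP; rewrite eqn_leq; have [AN ->] := h1 _ Am; rewrite leqNgt.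
  by apply/negP => Nm; apply: hm; exists (N w).
case: m Bm => // B0 noA; rewrite h2// => m Am.
by apply: noA; exists m.
Qed.

End measurable_selection.

(** * A countable dense set of decisions *)

Section nonneg_rationals.
Context {R : realType}.

(** The absolute value makes every code an admissible decision; codes of no rational give [0]. *)
Definition nonneg_rat (m : nat) : R := `|ratr (odflt 0 (unpickle m : option rat))|.

Lemma nonneg_rat_ge0 m : 0 <= nonneg_rat m.
Proof. exact: normr_ge0. Qed.

(** The approximation is from the right, the only side on which [right_usc] bounds the increase. *)
Lemma nonneg_rat_dense (t e : R) : 0 <= t -> 0 < e ->
  exists2 m, t <= nonneg_rat m & nonneg_rat m < t + e.
Proof.
move=> t0 e0; have /rat_in_itvoo[q] : t < t + e by rewrite ltrDl.
rewrite in_itv/= => /andP[tq qe]; exists (pickle q); rewrite /nonneg_rat pickleK/=;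
  by rewrite ger0_norm// ltW// (le_lt_trans t0).
Qed.

End nonneg_rationals.

(** * Backward induction for an abstract cost [J] of policies *)

Section dynamic_programming.
Context {R : realType}.
Variables (n K : nat) (mu p omega : R).
Hypotheses (K0 : (0 < K)%N) (mu0 : (0 < mu)%R) (p01 : (0 <= p <= 1)%R).
Hypothesis omega01 : (0 <= omega <= 1)%R.
Local Open Scope ereal_scope.
Variable J : (nat -> nat -> R -> R) -> nat -> nat -> R -> \bar R.
Hypothesis J_bellman : forall tau i k u, is_policy tau -> (0 < i < n)%N -> (0 < k <= i)%N ->
  (0 <= u)%R -> J tau i k u = bellman K mu p omega (J tau i.+1) k u (tau i k u).
Hypothesis J_last : forall tau k u, is_policy tau -> (0 < k <= n)%N -> (0 <= u)%R ->
  J tau n k u = (\sum_(1 <= z < K.+2) phase_weight K mu p z u *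
    ((1 - omega) * hbar_phase K mu p k z))%R%:E.
Hypothesis J_local : forall tau tau' i, (i <= n)%N -> (forall j, (i <= j < n)%N -> tau j = tau' j) ->
  J tau i = J tau' i.
Hypothesis J_nonneg_measurable : forall tau i, is_policy tau -> (i <= n)%N ->
  nonneg_measurable i (J tau i).

Let B := bellman K mu p omega.

Definition value i k u : \bar R :=
  ereal_inf [set J tau i k u | tau in [set tau | is_policy tau]].

Lemma value_ge0 i k u : (i <= n)%N -> (0 < k <= i)%N -> (0 <= u)%R -> 0 <= value i k u.
Proof.
move=> ni ki u0; apply: le_ereal_inf_tmp => _ [tau ptau <-].
by have [_] := J_nonneg_measurable ptau ni ki; apply.
Qed.

(** The induction invariant. Boundedness makes values and Lipschitz constants finite, semicontinuity
    reduces infima to rationals, measurability permits the selection, and the last clause provides a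
    single policy for all states. *)
Definition regular i : Prop :=
  [/\ exists2 M : R, (0 <= M)%R &
        forall k u, (0 < k <= i)%N -> (0 <= u)%R -> value i k u <= M%:E,
      forall k, (0 < k <= i)%N -> measurable_fun (`[0%R, +oo[ : set R) (value i k),
      forall k, (0 < k <= i)%N -> right_usc (value i k) &
      forall e : R, (0 < e)%R -> exists2 tau, is_policy tau &
        forall k u, (0 < k <= i)%N -> (0 <= u)%R -> J tau i k u <= value i k u + e%:E].

Lemma value_le i k u tau : is_policy tau -> value i k u <= J tau i k u.
Proof. by move=> ptau; apply: ereal_inf_lbound; exists tau. Qed.

Let policy0 : is_policy (fun (_ _ : nat) (_ : R) => 0%R).
Proof. by move=> j k; split => //; exact: measurable_cst. Qed.

Lemma value_last k u : (0 < k <= n)%N -> (0 <= u)%R ->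
  value n k u = (\sum_(1 <= z < K.+2) phase_weight K mu p z u *
    ((1 - omega) * hbar_phase K mu p k z))%R%:E.
Proof.
move=> kn u0; apply/le_anti/andP; split.
  by rewrite -(J_last policy0)//; exact: value_le.
by apply: le_ereal_inf_tmp => _ [tau ptau <-]; rewrite J_last.
Qed.

Let om1 : (0 <= 1 - omega)%R. Proof. by case/andP: omega01 => _; rewrite subr_ge0. Qed.

Lemma regular_last : regular n.
Proof.
have h0 k z : (0 < z <= K.+1)%N -> (0 <= (1 - omega) * hbar_phase K mu p k z)%R.
  by move=> zK; rewrite mulr_ge0 ?hbar_phase_ge0.
split.
- exists (\sum_(1 <= k < n.+1) \sum_(1 <= z < K.+2) (1 - omega) * hbar_phase K mu p k z)%R.
    rewrite big_nat; apply: sumr_ge0 => k _; rewrite big_nat; apply: sumr_ge0 => z.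
    exact: h0.
  move=> k u kn u0; rewrite value_last// lee_fin.
  rewrite [leRHS](bigD1_seq k) ?mem_index_iota ?iota_uniq//=.
  apply: ler_wpDr.
    by apply: sumr_ge0 => j _; rewrite big_nat; apply: sumr_ge0 => z; exact: h0.
  rewrite big_nat [leRHS]big_nat; apply: ler_sum => z zK.
  by rewrite ler_piMl ?h0 ?phase_weight_le1.
- move=> k kn; apply: (eq_measurable_fun (fun u => (\sum_(1 <= z < K.+2)
    phase_weight K mu p z u * ((1 - omega) * hbar_phase K mu p k z))%R%:E)).
    by move=> u; rewrite inE/= in_itv/= andbT => u0; rewrite value_last.
  apply: measurable_funTS; apply/measurable_EFinP; apply: measurable_sum => z.
  by apply: measurable_funM => //; exact: measurable_phase_weight.
- move=> k kn; apply: (@eq_right_usc _ _ ((fun u => \sum_(1 <= z < K.+2)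
    (phase_weight K mu p z u * ((1 - omega) * hbar_phase K mu p k z))%R%:E) \+ cst 0)).
    by move=> u u0; rewrite value_last//= adde0 sumEFin.
  apply: right_lipschitz_usc; last first.
    by move=> x e x0 e0; exists 1%R => // h _; rewrite /= add0e lee_fin ltW.
  move=> u u0; apply: right_lipschitz_at_sum => z; rewrite mem_index_iota => zK.
  exists (z%:R * mu * ((1 - omega) * hbar_phase K mu p k z))%R.
    by rewrite mulr_ge0 ?h0// mulr_ge0// ltW.
  move=> h hh; rewrite -EFinD lee_fin mulrAC -mulrDl ler_wpM2r ?h0//.
  exact: phase_weight_right_modulus.
- move=> e e0; exists (fun _ _ _ => 0%R) => // k u kn u0.
  by rewrite J_last// value_last// leeDl// lee_fin ltW.
Qed.

Section step.
Variables (i : nat).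
Hypotheses (i1n : (0 < i < n)%N) (reg : regular i.+1).

Let V := value i.+1.

Let hV : nonneg_measurable i.+1 V.
Proof.
have /andP[i0 ilt] := i1n; have [_ mV _ _] := reg.
by move=> l li; split; [exact: mV|move=> v v0; exact: value_ge0].
Qed.

Let sub_range k l : (0 < k <= i)%N -> (0 < l <= k.+1)%N -> (0 < l <= i.+1)%N.
Proof. by move=> /andP[_ ki] /andP[-> lk]; rewrite (leq_trans lk). Qed.

Let hVk k : (0 < k <= i)%N -> nonneg_measurable k.+1 V.
Proof. by move=> ki l lk; apply: hV; exact: sub_range lk. Qed.

Let hJk tau k : is_policy tau -> (0 < k <= i)%N -> nonneg_measurable k.+1 (J tau i.+1).
Proof.
have /andP[i0 ilt] := i1n => ptau ki l lk.
by apply: J_nonneg_measurable => //; exact: sub_range lk.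
Qed.

Lemma value_bellman_ge k u : (0 < k <= i)%N -> (0 <= u)%R ->
  ereal_inf [set B V k u t | t in `[0%R, +oo[] <= value i k u.
Proof.
move=> ki u0; have /andP[k0 _] := ki.
apply: le_ereal_inf_tmp => _ [tau ptau <-]; rewrite J_bellman//.
have t0 : (0 <= tau i k u)%R by have [_] := ptau i k.
apply: (@le_trans _ _ (B V k u (tau i k u))).
  by apply: ereal_inf_lbound; exists (tau i k u) => //=; rewrite in_itv/= t0.
have := @le_bellman _ K mu p omega mu0 p01 omega01 (J tau i.+1) V 0%R k u (tau i k u) k0
  (lexx _) u0 t0 (hJk ptau ki) (hVk ki).
rewrite mulr0 adde0; apply => l v lk v0.
by rewrite adde0; exact: value_le.
Qed.

(** Decision rule [f] for client [i], followed by [tau]. By locality the change at [i] leaves the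
    cost from [i.+1] on intact, so only the error of [tau] is amplified. *)
Let J_switch tau (f : nat -> R -> R) (e : R) : is_policy tau -> (0 <= e)%R ->
  (forall k, measurable_fun setT (f k)) -> (forall k u, (0 <= f k u)%R) ->
  (forall k u, (0 < k <= i.+1)%N -> (0 <= u)%R -> J tau i.+1 k u <= V k u + e%:E) ->
  exists2 tau', is_policy tau' & forall k u, (0 < k <= i)%N -> (0 <= u)%R ->
    J tau' i k u <= B V k u (f k u) + ((K.+1 * k).+1%:R * e)%:E.
Proof.
move=> ptau e0 mf f0 Je.
pose tau' j := if j == i then f else tau j.
have ptau' : is_policy tau' by move=> j k; rewrite /tau'; case: eqP => // _; split.
exists tau' => // k u ki u0; have /andP[k0 _] := ki.
rewrite J_bellman// {2}/tau' eqxx.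
apply: le_bellman => //; [exact: hVk|exact: hJk|].
move=> l v lk v0; rewrite (@J_local tau' tau i.+1 (proj2 (andP i1n))); first by apply: Je => //; exact: sub_range lk.
by move=> j /andP[ij _]; rewrite /tau'; case: eqP ij => // ->; rewrite ltnn.
Qed.

(** For the upper bound at a given state and decision [t], the constant rule [t] can be used at
    client [i], followed by a uniformly near-optimal policy whose tolerance is divided by the
    amplification constant. *)
Lemma value_bellman k u : (0 < k <= i)%N -> (0 <= u)%R ->
  value i k u = ereal_inf [set B V k u t | t in `[0%R, +oo[].
Proof.
move=> ki u0; apply/le_anti; rewrite value_bellman_ge// andbT.
apply: le_ereal_inf_tmp => _ [t + <-]; rewrite /= in_itv/= andbT => t0.
apply/lee_addgt0Pr => e e0.
pose c : R := (K.+1 * k).+1%:R.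
have c0 : (0 < c)%R by rewrite ltr0n.
have ec0 : (0 < e / c)%R by rewrite divr_gt0.
have [_ _ _ /(_ _ ec0)[tau ptau Je]] := reg.
have [tau' ptau' J'] := @J_switch tau (fun _ _ => t) _ ptau (ltW ec0)
  (fun _ => measurable_cst _) (fun _ _ => t0) Je.
apply: le_trans (value_le _ _ _ ptau') _; apply: le_trans (J' _ _ ki u0) _.
by rewrite -/c mulrCA divff ?mulr1// gt_eqF.
Qed.

Let bounded : exists2 M : R, (0 <= M)%R & forall k u, (0 < k <= i)%N -> (0 <= u)%R ->
  value i k u <= M%:E.
Proof.
have [[M M0 VM] _ _ _] := reg.
pose f k := (\sum_(1 <= z < K.+2) phase_running_cost K mu p omega k z 0 +
  (K.+1 * k).+1%:R * M)%R.
have f0 k : (0 < k)%N -> (0 <= f k)%R.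
  move=> k0; rewrite addr_ge0 ?mulr_ge0// big_nat; apply: sumr_ge0 => z zK.
  exact: phase_running_cost_ge0.
exists (\sum_(1 <= k < i.+1) f k)%R.
  by rewrite big_nat; apply: sumr_ge0 => k /andP[k0 _]; exact: f0.
move=> k u ki u0; have /andP[k0 kile] := ki; rewrite value_bellman//.
(* Scheduling the next client at once has a cost bounded independently of [u]. *)
apply: (@le_trans _ _ (B V k u 0%R)).
  by apply: ereal_inf_lbound; exists 0%R => //=; rewrite in_itv/= lexx.
apply: (@le_trans _ _ (f k)%:E).
  apply: bellman_le => //; first exact: hVk.
  by move=> l v lk v0; apply: VM => //; exact: sub_range lk.
rewrite lee_fin [leRHS](bigD1_seq k) ?mem_index_iota ?iota_uniq//= lerDl.
by rewrite big_seq_cond; apply: sumr_ge0 => j; rewrite mem_index_iota => /andP[/andP[j0 _] _]; exact: f0.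
Qed.

Let fin_value k u : (0 < k <= i)%N -> (0 <= u)%R -> value i k u \is a fin_num.
Proof.
move=> ki u0; have [M M0 VM] := bounded; have /andP[_ ilt] := i1n.
by rewrite ge0_fin_numE ?value_ge0// ?(ltnW ilt)// (le_lt_trans (VM _ _ ki u0)) ?ltry.
Qed.

Let near_optimal k u e : (0 < k <= i)%N -> (0 <= u)%R -> (0 < e)%R ->
  exists2 t, (0 <= t)%R & B V k u t <= value i k u + e%:E.
Proof.
move=> ki u0 e0; have := fin_value ki u0; rewrite value_bellman// => Vfin.
have [_ [t + <-] /ltW Bt] := lb_ereal_inf_adherent e0 Vfin.
by rewrite /= in_itv/= andbT => t0; exists t.
Qed.

(** Half of [e] is spent on a near-optimal real decision, the other half on moving it slightly to
    the right to a rational. *)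
Let near_optimal_rat k u e : (0 < k <= i)%N -> (0 <= u)%R -> (0 < e)%R ->
  exists m, B V k u (nonneg_rat m) <= value i k u + e%:E.
Proof.
move=> ki u0 e0; have e20 : (0 < e / 2)%R by rewrite divr_gt0.
have /andP[k0 kile] := ki.
have [t t0 Bt] := near_optimal ki u0 e20.
have [[M M0 VM] _ rV _] := reg.
have rB : right_usc (B V k u).
  have VMk l v : (0 < l <= k.+1)%N -> (0 <= v)%R -> V l v <= M%:E.
    by move=> lk v0; apply: VM => //; exact: sub_range lk.
  have rVk : right_usc (V k.+1) by apply: rV; rewrite ltnS.
  exact: (@right_usc_bellman _ K mu p omega mu0 p01 omega01 V k M k0 M0 (hVk ki) VMk).
have [d d0 hd] := rB _ _ t0 e20.
have [m tm md] := nonneg_rat_dense t0 d0.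
exists m; rewrite -(subrKC t (nonneg_rat m)).
apply: le_trans (hd _ _) _; first by rewrite subr_ge0 tm ltrBlDl.
by rewrite [e in leRHS]splitr EFinD addeA leeD2r.
Qed.

Let measurable_B k t : (0 < k <= i)%N -> (0 <= t)%R ->
  measurable_fun (`[0%R, +oo[ : set R) (fun u => B V k u t).
Proof. by move=> ki t0; apply: measurable_bellman => //; exact: hVk. Qed.

Let measurable_value k : (0 < k <= i)%N ->
  measurable_fun (`[0%R, +oo[ : set R) (value i k).
Proof.
move=> ki.
apply: (eq_measurable_fun (fun u => einfs (fun m => B V k u (nonneg_rat m)) 0%N)).
  move=> u; rewrite inE/= in_itv/= andbT => u0; apply/le_anti/andP; split.
    apply/lee_addgt0Pr => e e0; have [m Bm] := near_optimal_rat ki u0 e0.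
    by apply: le_trans Bm; apply: ereal_inf_lbound; exists m.
  apply: le_ereal_inf_tmp => _ [m _ <-]; rewrite value_bellman//.
  by apply: ereal_inf_lbound; exists (nonneg_rat m) => //=; rewrite in_itv/= nonneg_rat_ge0.
apply: (measurable_fun_einfs (f := fun m u => B V k u (nonneg_rat m))) => m.
by apply: measurable_B => //; exact: nonneg_rat_ge0.
Qed.

(** A decision that is near-optimal at [u] is kept at [u + h]; it bounds the value there. *)
Let right_usc_value k : (0 < k <= i)%N -> right_usc (value i k).
Proof.
move=> ki u e u0 e0; have e20 : (0 < e / 2)%R by rewrite divr_gt0.
have /andP[k0 kile] := ki.
have [t t0 Bt] := near_optimal ki u0 e20.
have [[M M0 VM] _ rV _] := reg.
have rB : right_usc (fun u => B V k u t).
  have VMk l v : (0 < l <= k.+1)%N -> (0 <= v)%R -> V l v <= M%:E.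
    by move=> lk v0; apply: VM => //; exact: sub_range lk.
  have rVk : right_usc (V k.+1) by apply: rV; rewrite ltnS.
  exact: (@right_usc_bellman_elapsed _ K mu p omega mu0 p01 omega01 V k M k0 M0 (hVk ki) VMk).
have [d d0 hd] := rB _ _ u0 e20; exists d => // h hhd.
apply: (@le_trans _ _ (B V k (u + h)%R t)).
  rewrite value_bellman//; last by case/andP: hhd => h0 _; rewrite addr_ge0.
  by apply: ereal_inf_lbound; exists t => //=; rewrite in_itv/= t0.
apply: le_trans (hd _ hhd) _.
by rewrite [e in leRHS]splitr EFinD addeA leeD2r.
Qed.

Let near_optimal_policy (e : R) : (0 < e)%R -> exists2 tau, is_policy tau &
  forall k u, (0 < k <= i)%N -> (0 <= u)%R -> J tau i k u <= value i k u + e%:E.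
Proof.
move=> e0; have e20 : (0 < e / 2)%R by rewrite divr_gt0.
(* Using [i] in place of [k] makes the constant valid for all [k <= i] at once. *)
pose c : R := (K.+1 * i).+1%:R.
have c0 : (0 < c)%R by rewrite ltr0n.
have ec0 : (0 < e / 2 / c)%R by rewrite divr_gt0.
have [_ _ _ /(_ _ ec0)[tau ptau Je]] := reg.
have /choice[N hN] : forall k, exists N : R -> nat, measurable_fun setT N /\
    ((0 < k <= i)%N -> forall u, (0 <= u)%R ->
      B V k u (nonneg_rat (N u)) <= value i k u + (e / 2)%:E).
  move=> k; have [ki|nki] := boolP (0 < k <= i)%N; last first.
    by exists (cst 0%N); split => // ki; rewrite ki in nki.
  pose A m : set R := (`[0%R, +oo[ : set R) `&`
    [set u | B V k u (nonneg_rat m) <= value i k u + (e / 2)%:E].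
  have mA m : measurable (A m).
    apply: measurable_lee => //; first exact: (measurable_B ki (nonneg_rat_ge0 m)).
    by apply: emeasurable_funD; [exact: measurable_value|exact: measurable_cst].
  have [N mN hN] := measurable_first_index mA.
  exists N; split => // _ u u0; have [m Bm] := near_optimal_rat ki u0 e20.
  by have [] : A (N u) u by apply: (hN u m); split => //=; rewrite in_itv/= u0.
have mN k : measurable_fun setT (fun u => nonneg_rat (N k u) : R).
  have [mNk _] := hN k.
  by apply: (@measurableT_comp _ _ _ _ _ _ (@nonneg_rat R)).
have [tau' ptau' J'] := @J_switch tau (fun k u => nonneg_rat (N k u)) _ ptau (ltW ec0) mN
  (fun _ _ => nonneg_rat_ge0 _) Je.
exists tau' => // k u ki u0; apply: le_trans (J' _ _ ki u0) _.
rewrite [e in leRHS]splitr EFinD addeA; apply: leeD; first exact: (proj2 (hN k)).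
rewrite lee_fin mulrCA ler_piMr ?(ltW e20)// ler_pdivrMr// mul1r ler_nat ltnS leq_mul2l.
by case/andP: ki => _ ->; rewrite orbT.
Qed.

Lemma regular_step : regular i.
Proof.
by split; [exact: bounded|exact: measurable_value|exact: right_usc_value|exact: near_optimal_policy].
Qed.

End step.

Lemma regular_value i : (0 < i <= n)%N -> regular i.
Proof.
move=> /andP[i0 ni]; rewrite -(subKn ni); move: (leq_subr i n).
have : (n - i < n)%N by rewrite ltn_subrL i0 (leq_trans i0 ni).
elim: (n - i)%N => [|e IH] en _; first by rewrite subn0; exact: regular_last.
apply: regular_step; first by rewrite subn_gt0 en ltn_subrL (leq_trans _ en).
by rewrite (subnSK (ltnW en)); apply: IH; [exact: ltnW|exact/ltnW/ltnW].
Qed.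

Lemma bellman_equation i k u : (0 < i < n)%N -> (0 < k <= i)%N -> (0 <= u)%R ->
  value i k u = ereal_inf [set bellman K mu p omega (value i.+1) k u t | t in `[0%R, +oo[].
Proof.
by move=> /andP[i0 ilt] *; apply: value_bellman => //; rewrite ?i0//; exact: regular_value.
Qed.

Lemma nonneg_measurable_value i : (0 < i <= n)%N -> nonneg_measurable i (value i).
Proof.
move=> i0n; have [_ mV _ _] := regular_value i0n => l li.
by split; [exact: mV|move=> v v0; apply: value_ge0 => //; case/andP: i0n].
Qed.

End dynamic_programming.

(** * The minimal expected cost *)

Section phase_mix_derivative.
Context {R : realType}.
Variables (K : nat) (mu p : R).

Lemma is_derive_sum_seq (I : Type) (s : seq I) (F : I -> R -> R) (dF : I -> R) (v : R) :
  (forall j, is_derive v (1 : R) (F j) (dF j)) ->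
  is_derive v (1 : R) (fun x => (\sum_(j <- s) F j x)%R) (\sum_(j <- s) dF j)%R.
Proof.
move=> hF; elim: s => [|j s IH].
  under eq_fun do rewrite big_nil; rewrite big_nil; exact: is_derive_cst.
under eq_fun do rewrite big_cons; rewrite big_cons.
have h := hF j.
exact: is_deriveD.
Qed.

Lemma is_derive_phase_mix (r z : nat) (F : nat -> R -> R) (dF : nat -> R) (v : R) :
  (forall j, (0 < j)%N -> is_derive v (1 : R) (F j) (dF j)) ->
  is_derive v (1 : R) (fun x => phase_mix K p r z (fun j => F j x)) (phase_mix K p r z dF).
Proof.
move=> hF; rewrite /phase_mix /binomial_mix.
by case: ifPn => _; apply: is_derive_sum_seq => m; apply: is_deriveZ; apply: hF; rewrite addn1.
Qed.

(** Finding [l] clients upon the next arrival, the new one included, means [k - l + 1]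
    departures. *)
Lemma q_phaseE (k l z : nat) (v t : R) : (l <= k)%N ->
  q_phase K mu p k l z v t = phase_mix K p (k - l + 1) z (psi_mix K mu p v t).
Proof.
move=> lk; rewrite /q_phase /phase_mix /binomial_mix addn1/=.
by case: (leqP z K) => _; apply: eq_bigr => m _; rewrite (addnAC _ m 1%N).
Qed.

End phase_mix_derivative.

(** * Survival function and transition densities *)

Section service_law.
Context d (T : measurableType d) (R : realType) (P : probability T R).
Notation leb := (@lebesgue_measure R).
Variables (K : nat) (mu p : R).
Hypotheses (K0 : (0 < K)%N) (mu0 : (0 < mu)%R) (p01 : (0 <= p <= 1)%R).
Variable B : {RV P >-> R}.
Hypothesis hB : erlang_mixture K mu p B.
Local Open Scope ereal_scope.

Let p0 : (0 <= p)%R. Proof. by case/andP: p01. Qed.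
Let p1 : (0 <= 1 - p)%R. Proof. by case/andP: p01 => _; rewrite subr_ge0. Qed.

Lemma ge0_integral_service (phi : R -> \bar R) : measurable_fun setT phi ->
  (forall x, 0 <= phi x) ->
  \int[P]_w phi (B w) = \int[leb]_x ((service_pdf K mu p x)%:E * phi x).
Proof.
move=> mphi phi0.
have merl j : measurable_fun [set: R] (fun x => (erlang_pdf j mu x)%:E : \bar R).
  by apply/measurable_EFinP; exact: measurable_erlang_pdf.
have mm j : measurable_fun [set: R] (fun x => (erlang_pdf j mu x)%:E * phi x).
  by apply: emeasurable_funM; [exact: merl|exact: mphi].
have m0 j x : 0 <= (erlang_pdf j mu x)%:E * phi x.
  by rewrite mule_ge0// lee_fin erlang_pdf_ge0.
transitivity (\int[distribution P B]_x phi x); first by rewrite ge0_integral_distribution.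
transitivity (\int[measure_add (mscale (NngNum p0) (erlang_prob K mu))
    (mscale (NngNum p1) (erlang_prob K.+1 mu))]_x phi x).
  apply: eq_measure_integral => A mA _; apply: etrans (hB mA) _.
  by apply/esym; exact: measure_addE.
rewrite ge0_integral_measure_add// ge0_integral_mscale// ge0_integral_mscale//=.
rewrite !ge0_integral_erlang_prob//.
rewrite -(ge0_integralZl lebesgue_measure (@measurableT _ _) (mm K) (fun x _ => m0 K x)) ?lee_fin//.
rewrite -(ge0_integralZl lebesgue_measure (@measurableT _ _) (mm K.+1) (fun x _ => m0 K.+1 x)) ?lee_fin//.
rewrite -ge0_integralD//.
- apply: eq_integral => x _; rewrite /service_pdf.
  by rewrite !muleA -!EFinM -ge0_muleDl ?lee_fin ?mulr_ge0 ?erlang_pdf_ge0// -EFinD.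
- by move=> x _; rewrite mule_ge0 ?lee_fin.
- by apply: measurable_funeM; exact: mm.
- by move=> x _; rewrite mule_ge0 ?lee_fin.
- by apply: measurable_funeM; exact: mm.
Qed.

Lemma service_nonpositive_null : P [set w | (B w <= 0)%R] = 0.
Proof.
have mb : measurable_fun [set: R] (fun x => ((x <= 0)%R%:R)%:E : \bar R).
  by apply: measurable_EFin_bool; exact: measurable_fun_ler.
have mS : measurable [set w | (B w <= 0)%R].
  by rewrite -[X in measurable X]setTI; apply: measurable_fun_ler.
rewrite -[LHS]mul1e -integral_cst// integral_boolE.
transitivity (\int[P]_w ((B w <= 0)%R%:R)%:E).
  by apply: eq_integral => w _; rewrite mule1.
rewrite (ge0_integral_service mb)//.
(* The density vanishes on the negative reals, so the integrand is supported at the null point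
   [0]. *)
rewrite -(integral_set1 (fun x => (service_pdf K mu p x)%:E * ((x <= 0)%R%:R)%:E) 0%R).
rewrite [RHS]integral_mkcond; apply: eq_integral => x _; rewrite patchE.
case: ifPn => // x0.
have [x0'|x0'|xE] := ltgtP x 0%R; last by rewrite xE mem_set in x0.
  by rewrite /service_pdf !lt0_erlang_pdf// !mulr0 addr0 mul0e.
by rewrite mule0.
Qed.

Lemma ge0_integral_service_pos (phi : R -> \bar R) : measurable_fun setT phi ->
  (forall x, 0 <= phi x) ->
  \int[P]_w phi (if (0 < B w)%R then B w else 1%R) =
  \int[leb]_x ((service_pdf K mu p x)%:E * phi x).
Proof.
move=> mphi phi0; rewrite -ge0_integral_service//.
have mg : measurable_fun setT (fun w => if (0 < B w)%R then B w else 1%R).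
  by apply: measurable_fun_ifT => //; exact: measurable_fun_ltr.
apply: ge0_ae_eq_integral => //; [exact: measurableT_comp|exact: measurableT_comp|].
exists [set w | (B w <= 0)%R]; split.
- by rewrite -[X in measurable X]setTI; apply: measurable_fun_ler.
- exact: service_nonpositive_null.
- by move=> w /=; rewrite leNgt; apply: contra_notN => Bw _; rewrite Bw.
Qed.

Lemma survivalE u : survival B u = (p * erlang_tail mu K u + (1 - p) * erlang_tail mu K.+1 u)%R.
Proof.
by rewrite /survival /ccdf hB// -[erlang_prob K mu _]fineK ?fin_num_measure//
  -[erlang_prob K.+1 mu _]fineK ?fin_num_measure.
Qed.

(** The total mass in the law of the first departure, for a single client: the constant sequence [B]
    with one index satisfies the independence hypothesis trivially. *)
Lemma survival_phase_weight u : (0 <= u)%R ->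
  survival B u = (\sum_(1 <= z < K.+2) phase_weight K mu p z u)%R.
Proof.
move=> u0; apply: EFin_inj; rewrite fineK ?fin_num_measure//.
have mB : forall j : nat, measurable_fun setT B by [].
have indep (A : nat -> set R) : (forall j, measurable (A j)) ->
    P (\bigcap_(j in [set j | (1 <= j <= 1)%N]) (B @^-1` A j)) =
    \prod_(1 <= j < 2) P (B @^-1` A j).
  move=> _; rewrite big_nat1; congr (P _); apply/seteqP; split => w /=; first exact.
  by move=> ? j /anti_leq <-.
have law (j : nat) : (1 <= j <= 1)%N -> forall phi : R -> \bar R,
    measurable_fun setT phi -> (forall x, 0 <= phi x) ->
    \int[P]_w phi (B w) = \int[leb]_x ((service_pdf K mu p x)%:E * phi x).
  by move=> _; exact: ge0_integral_service.
have one0 (x : R) : 0 <= cst 1 x :> \bar R by [].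
have := elapsed_work_law (X := fun=> B) K0 mu0 p01 mB indep law (a := 1%N) (r := 1%N) u0
  isT isT isT (phi := cst 1) (measurable_cst _) one0.
rewrite (ge0_integral_work_pdf K mu0 p01 1 u0 (measurable_cst _) one0 (c := fun=> 1%R)); last first.
  move=> j j0; apply: etrans (integral_erlang_pdf j0 mu0).
  by apply: eq_integral => x _; rewrite /= mule1.
rewrite integral_cst ?mul1e; last first.
  by rewrite -[X in measurable X]setTI; apply: measurable_fun_ltr.
rewrite (eq_bigr (phase_weight K mu p ^~ u)); last by move=> z _; rewrite phase_mix_cst mulr1.
move=> <-; rewrite /ccdf /distribution /pushforward; congr (P _).
by apply/seteqP; split => w /=; rewrite in_itv/= andbT.
Qed.

Lemma survival_gt0 u : (0 <= u)%R -> (0 < survival B u)%R.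
Proof.
move=> u0; rewrite survival_phase_weight// big_ltn// ltr_wpDr//.
  by apply: sumr_ge0 => z _; exact: phase_weight_ge0.
by rewrite /phase_weight K0 expr0 fact0 divr1 mulr1 expR_gt0.
Qed.

(** The two [psi] terms differentiate to the same density times the tails of shapes [K] and [K.+1].
    Weighted by [p] and [1 - p], these tails form [survival B v], whatever the shape [j]. *)
Lemma derive_q_phase k l z (v t : R) : (l <= k)%N -> (0 < v < t)%R ->
  ((fun v' => q_phase K mu p k l z v' t)^`()%classic v =
   erlang_mix K mu p (k - l + 1) z (t - v) * survival B v)%R.
Proof.
move=> lk vt; rewrite (funext (fun v' => q_phaseE K mu p z v' t lk)).
rewrite mulrC -phase_mixZ; under eq_fun do [].
rewrite derive1E; apply: derive_val; apply: is_derive_phase_mix => j j0.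
have h1 := @derive_psi R mu mu0 v t j (j + K) _ vt.
have h2 := @derive_psi R mu mu0 v t j (j + K + 1) _ vt.
have {}h1 := h1 ltac:(lia); have {}h2 := h2 ltac:(lia).
rewrite survivalE.
apply: is_derive_eq.
rewrite /GRing.scale/=.
have -> : (j + K - j)%N = K by lia.
have -> : (j + K + 1 - j)%N = K.+1 by lia.
by ring.
Qed.

Lemma p_densE k l (u v t : R) : (l <= k)%N -> (0 < v < t)%R ->
  p_dens K mu p B k l u v t =
  ((survival B u)^-1 * work_pdf K mu p (k - l + 1) u (t - v) * survival B v)%R.
Proof.
move=> lk vt; rewrite /p_dens work_pdfE -mulrA mulr_suml mulr_sumr.
by apply: eq_bigr => z _; rewrite derive_q_phase// /phase_prob; ring.
Qed.

End service_law.

Section scaled_infimum.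
Local Open Scope ereal_scope.

Lemma ereal_infZl (R : realType) (I : Type) (A : set I) (f : I -> \bar R) (c : R) : (0 < c)%R ->
  ereal_inf [set c%:E * f x | x in A] = c%:E * ereal_inf [set f x | x in A].
Proof.
move=> c0; apply/le_anti/andP; split.
  rewrite -lee_pdivrMl//; apply: le_ereal_inf_tmp => _ [x Ax <-].
  by rewrite lee_pdivrMl//; apply: ereal_inf_lbound; exists x.
apply: le_ereal_inf_tmp => _ [x Ax <-]; rewrite lee_wpmul2l ?lee_fin ?(ltW c0)//.
by apply: ereal_inf_lbound; exists x.
Qed.

End scaled_infimum.

(** * Normalization and the recursion for [min_cost] *)

Section minimal_cost.
Context d (T : measurableType d) (R : realType) (P : probability T R).
Notation leb := (@lebesgue_measure R).
Variables (n K : nat) (mu p omega : R) (B : {RV P >-> R}) (S : nat -> {RV P >-> R}).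
Hypotheses (K0 : (0 < K)%N) (mu0 : (0 < mu)%R) (p01 : (0 <= p <= 1)%R).
Hypothesis omega01 : (0 <= omega <= 1)%R.
Hypothesis hB : erlang_mixture K mu p B.
Hypothesis hcopies : forall j : nat, (1 <= j <= n)%N ->
  forall A : set R, measurable A -> distribution P (S j) A = distribution P B A.
Hypothesis hindep : mutually_independent n S.
Local Open Scope ereal_scope.

(* Redefined where they are not positive, which is a null event, so that the service
   times are positive everywhere. *)
Let X (j : nat) (w : T) : R := if (0 < S j w)%R then S j w else 1%R.

Let mX j : measurable_fun setT (X j).
Proof. by apply: measurable_fun_ifT => //; exact: measurable_fun_ltr. Qed.

Let X0 j w : (0 < X j w)%R.
Proof. by rewrite /X; case: ifPn. Qed.

Let indepX (A : nat -> set R) : (forall j, measurable (A j)) ->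
  P (\bigcap_(j in [set j | (1 <= j <= n)%N]) (X j @^-1` A j)) =
  \prod_(1 <= j < n.+1) P (X j @^-1` A j).
Proof.
move=> mA.
have mg : measurable_fun [set: R] (fun x : R => if (0 < x)%R then x else 1%R).
  by apply: measurable_fun_ifT => //; exact: measurable_fun_ltr.
pose A' j : set R := (fun x : R => if (0 < x)%R then x else 1%R) @^-1` A j.
have mA' j : measurable (A' j) by rewrite /A' -[X in measurable X]setTI; exact: mg.
exact: (hindep mA').
Qed.

Let mixture_S j : (1 <= j <= n)%N -> erlang_mixture K mu p (S j).
Proof. by move=> jn A mA; rewrite hcopies// hB. Qed.

Let lawX j : (1 <= j <= n)%N -> forall phi : R -> \bar R,
  measurable_fun setT phi -> (forall x, 0 <= phi x) ->
  \int[P]_w phi (X j w) = \int[leb]_x ((service_pdf K mu p x)%:E * phi x).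
Proof.
by move=> jn phi mphi phi0; exact: (ge0_integral_service_pos K0 mu0 p01 (mixture_S jn) mphi phi0).
Qed.

Let S_positive : \forall w \ae P, forall j, (1 <= j <= n)%N -> (0 < S j w)%R.
Proof.
apply: ae_foralln => j; have [jn|jn] := boolP (1 <= j <= n)%N; last first.
  exact: aeW.
exists [set w | (S j w <= 0)%R]; split.
- by rewrite -[X in measurable X]setTI; apply: measurable_fun_ler.
- exact: (service_nonpositive_null K0 mu0 p01 (mixture_S jn)).
- by move=> w /= h; rewrite leNgt; apply/negP => Sw; apply: h.
Qed.

Let J := expected_cost P n omega X.

(** Almost surely [S] and its positive version [X] agree on clients [1] to [n], and by [eq_cost] the
    cost sees no others. *)
Let cond_expectationE tau i k (u : R) : is_policy tau -> (i <= n)%N -> (0 < k <= i)%N ->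
  (0 <= u)%R ->
  cond_expectation P (fun w => cost omega n tau (fun j => S j w) i (k, u))
    [set w | (u < S (i - k).+1 w)%R] = (survival B u)^-1%:E * J tau i k u.
Proof.
move=> ptau ni ki u0; have /andP[k0 kile] := ki; set a := (i - k).+1.
have an : (1 <= a <= n)%N by rewrite /a; move: k0 kile ni; clear; lia.
rewrite /cond_expectation; congr (_%:E * _).
  rewrite /survival /ccdf -(hcopies an)//; congr ((fine (P _))^-1)%R.
  by apply/seteqP; split => w /=; rewrite in_itv/= andbT.
have mpair : measurable_fun [set: T] (fun=> (k, u)).
  by apply/measurable_fun_pairP; split; exact: measurable_cst.
rewrite /J /expected_cost -/a !integral_boolE; apply: ae_eq_integral => //.
- apply: emeasurable_funM; last first.
    apply/measurable_EFinP.
    exact: (measurable_cost (s := fun w j => S j w) _ ptau omega n i mpair).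
  by apply: measurable_EFin_bool; exact: measurable_fun_ltr.
- apply: emeasurable_funM; last first.
    by apply/measurable_EFinP; exact: (measurable_cost mX ptau omega n i mpair).
  by apply: measurable_EFin_bool; exact: measurable_fun_ltr.
apply: filterS S_positive => w Sw _.
have SX j : (1 <= j <= n)%N -> S j w = X j w by move=> jn; rewrite /X Sw.
rewrite SX//; congr (_ * _%:E); apply: eq_cost => //= m /andP[im mn].
by rewrite SX// mn (leq_ltn_trans _ im).
Qed.

Let min_costE i k (u : R) : (i <= n)%N -> (0 < k <= i)%N -> (0 <= u)%R ->
  min_cost S omega n i k u = (survival B u)^-1%:E * value J i k u.
Proof.
move=> ni ki u0; rewrite /value -ereal_infZl; last first.
  by rewrite invr_gt0 (survival_gt0 K0 mu0 p01 hB).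
by congr ereal_inf; apply: eq_imagel => tau /= ptau; exact: cond_expectationE.
Qed.

Let J_bellman tau i k u : is_policy tau -> (0 < i < n)%N -> (0 < k <= i)%N ->
  (0 <= u)%R -> J tau i k u = bellman K mu p omega (J tau i.+1) k u (tau i k u).
Proof.
by move=> *; exact: (expected_cost_bellman K0 mu0 p01 omega01 mX X0 indepX lawX).
Qed.

Let J_last tau k u : is_policy tau -> (0 < k <= n)%N -> (0 <= u)%R ->
  J tau n k u = (\sum_(1 <= z < K.+2) phase_weight K mu p z u *
    ((1 - omega) * hbar_phase K mu p k z))%R%:E.
Proof.
move=> ptau kn u0; have /andP[om0 om1] := omega01.
transitivity (\int[P]_(w in [set w | (u < X (n - k).+1 w)%R])
    ((1 - omega)%:E * (waiting_time (X ^~ w) n (k, u))%:E)).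
  by apply: eq_integral => w _; rewrite cost_last EFinM.
rewrite ge0_integralZl//.
- rewrite (expected_waiting_time K0 mu0 p01 mX X0 indepX lawX)// -EFinM mulr_sumr.
  by congr EFin; apply: eq_bigr => z _; rewrite mulrCA.
- by rewrite -[X in measurable X]setTI; apply: measurable_fun_ltr.
- apply: measurable_funTS; apply/measurable_EFinP.
  apply: (measurable_waiting_time mX).
  by apply/measurable_fun_pairP; split; exact: measurable_cst.
- move=> w uX; rewrite lee_fin waiting_time_ge0//; last exact: ltW.
  by move=> m; exact: ltW.
- by rewrite lee_fin subr_ge0.
Qed.

Let J_local tau tau' i : (i <= n)%N -> (forall j, (i <= j < n)%N -> tau j = tau' j) ->
  J tau i = J tau' i.
Proof.
move=> ni tt; apply/funext => k; apply/funext => u.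
by apply: eq_integral => w _; rewrite (eq_cost_policy _ _ _ ni tt).
Qed.

Let J_nonneg_measurable tau i : is_policy tau -> (i <= n)%N -> nonneg_measurable i (J tau i).
Proof.
move=> ptau ni l li; split => [|v _].
  by apply: measurable_funTS; exact: measurable_expected_cost.
exact: expected_cost_ge0.
Qed.

Let survival0 : survival B 0 = 1%R.
Proof.
rewrite (survival_phase_weight K0 mu0 p01 hB)// big_ltn// big1_seq ?addr0.
  by rewrite /phase_weight K0 mulr0 oppr0 expR0 fact0 divr1 mulr1.
move=> z; rewrite mem_index_iota => /andP[_ /andP[z1 _]]; rewrite /phase_weight mulr0.
case: ifPn => _; last by rewrite expr0n gtn_eqF// mulr0 mul0r.
by rewrite expr0n; case: z z1 => [|[|z]]//= _; rewrite mulr0 mul0r.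
Qed.

Lemma min_cost_last k (u : R) : (0 < n)%N -> (1 <= k <= n)%N -> (0 <= u)%R ->
  min_cost S omega n n k u = ((1 - omega) * hbar K mu p B k u)%:E.
Proof.
move=> n0 kn u0; rewrite min_costE// (value_last J_last)// -EFinM; congr EFin.
rewrite /hbar !mulr_sumr; apply: eq_bigr => z _; rewrite /phase_prob; ring.
Qed.

Let V i := value J i.

Let V_nonneg_measurable i : (0 < i <= n)%N -> nonneg_measurable i (V i).
Proof.
exact: (nonneg_measurable_value mu0 p01 omega01 J_bellman J_last J_local J_nonneg_measurable).
Qed.

(** Dividing by [survival B u] turns phase weights into [phase_prob]. Rewriting each next value
    through [min_costE] supplies the missing survival factors: [survival B v] in [p_dens],
    [survival B (u + t)] in [P_up], and [survival B 0 = 1] for the emptied system. *)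
Let normalized_bellman i k (u t : R) : (0 < i < n)%N -> (0 < k <= i)%N ->
  (0 <= u)%R -> (0 <= t)%R ->
  (survival B u)^-1%:E * bellman K mu p omega (V i.+1) k u t =
  (omega * fbar K mu p B k u t + (1 - omega) * hbar K mu p B k u)%:E
  + \sum_(2 <= l < k.+1)
      \int[leb]_(v in `]0%R, t[)
        ((p_dens K mu p B k l u v t)%:E * min_cost S omega n i.+1 l v)
  + (P_down K mu p B k u t)%:E * min_cost S omega n i.+1 1 0
  + (P_up B u t)%:E * min_cost S omega n i.+1 k.+1 (u + t).
Proof.
move=> i1n ki u0 t0; have /andP[i0 ilt] := i1n; have /andP[k0 kile] := ki.
have /andP[om0 om1] := omega01.
have su x : (0 <= x)%R -> (0 < survival B x)%R by exact: (survival_gt0 K0 mu0 p01 hB).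
have sne x : (0 <= x)%R -> survival B x != 0%R by move=> /su; exact: lt0r_neq0.
have hV : nonneg_measurable k.+1 (V i.+1).
  by move=> l /andP[l0 lk]; apply: V_nonneg_measurable => //; rewrite l0 (leq_trans lk).
have Vpos l v : (0 < l <= k.+1)%N -> (0 <= v)%R -> 0 <= V i.+1 l v.
  by move=> lk; have [_] := hV l lk; apply.
have pw0 z : (0 <= phase_weight K mu p z u)%R by exact: phase_weight_ge0.
have c0 : 0 <= (survival B u)^-1%:E by rewrite lee_fin invr_ge0 ltW// su.
have posv v : `]0%R, t[%classic v -> (0 <= v)%R by rewrite /= in_itv/= => /andP[/ltW].
have lk r : (0 < r < k)%N -> (0 < (k - r).+1 <= k.+1)%N by rewrite /= ltnS leq_subr.
have I0 r : (0 < r < k)%N -> 0 <= \int[leb]_(v in `]0%R, t[)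
    ((work_pdf K mu p r u (t - v))%:E * V i.+1 (k - r).+1 v).
  move=> /lk rk; apply: integral_ge0 => v /posv v0.
  by rewrite mule_ge0 ?Vpos// lee_fin work_pdf_ge0.
have d0 : (0 <= \sum_(1 <= z < K.+2) phase_weight K mu p z u * down_phase K mu p k z t)%R.
  by apply: sumr_ge0 => z _; rewrite mulr_ge0 ?down_phase_ge0.
rewrite bellmanE// ge0_muleDr ?Vpos ?leqnn ?addr_ge0//; last first.
  rewrite !adde_ge0 ?mule_ge0 ?Vpos ?lee_fin//.
    rewrite addr_ge0// mulr_ge0 ?subr_ge0// big_nat sumr_ge0// => z zK.
      by rewrite mulr_ge0 ?fbar_phase_ge0.
    by rewrite mulr_ge0 ?hbar_phase_ge0.
  by rewrite big_nat; apply: sume_ge0 => r; exact: I0.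
congr (_ + _); last first.
  rewrite min_costE ?addr_ge0// muleA -EFinM /P_up; congr (_%:E * _).
  by rewrite mulrAC divff ?mul1r// sne// addr_ge0.
rewrite ge0_muleDr ?mule_ge0 ?Vpos ?lee_fin//; last first.
  rewrite adde_ge0 ?lee_fin//.
    rewrite addr_ge0// mulr_ge0 ?subr_ge0// big_nat sumr_ge0// => z zK.
      by rewrite mulr_ge0 ?fbar_phase_ge0.
    by rewrite mulr_ge0 ?hbar_phase_ge0.
  by rewrite big_nat; apply: sume_ge0 => r; exact: I0.
congr (_ + _); last first.
  rewrite min_costE// survival0 invr1 mul1e muleA -EFinM mulr_sumr.
  congr (_%:E * _); apply: eq_bigr => z _; rewrite /phase_prob; ring.
rewrite ge0_muleDr; last 2 first.
- rewrite lee_fin addr_ge0// mulr_ge0 ?subr_ge0// big_nat sumr_ge0// => z zK.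
    by rewrite mulr_ge0 ?fbar_phase_ge0.
  by rewrite mulr_ge0 ?hbar_phase_ge0.
- by rewrite big_nat; apply: sume_ge0 => r; exact: I0.
congr (_ + _).
  rewrite -EFinM; congr EFin; rewrite /fbar /hbar mulrDr; congr (_ + _)%R;
    rewrite mulrCA; congr (_ * _)%R; rewrite mulr_sumr; apply: eq_bigr => z _;
    rewrite /phase_prob; ring.
(* The sums run in opposite directions: [r] departures correspond to [l = (k - r).+1] clients. *)
rewrite [RHS]big_nat_rev/= [RHS]big_add1/= [X in _ * X = _]big_nat [RHS]big_nat ge0_sume_distrr//.
apply: eq_bigr => r rk; have /andP[r0 rltk] := rk.
have -> : (2 + k.+1 - r.+2)%N = (k - r).+1 by move: rltk; clear; lia.
have [mV V0] := hV _ (lk _ rk).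
have mw : measurable_fun (`]0%R, t[ : set R) (fun v => (work_pdf K mu p r u (t - v))%:E *
    V i.+1 (k - r).+1 v).
  apply: emeasurable_funM.
    apply: measurable_funTS; apply/measurable_EFinP.
    by apply: (measurableT_comp (measurable_work_pdf K mu p r u)); exact: measurable_reflection.
  by apply: measurable_funS mV => // v /posv /=; rewrite in_itv/= andbT.
rewrite -(ge0_integralZl lebesgue_measure (measurable_itv _) mw _ c0); last first.
  by move=> v /posv v0; rewrite mule_ge0 ?V0// lee_fin work_pdf_ge0.
apply: eq_integral => v; rewrite inE => vt; have v0 := posv v vt.
rewrite min_costE//; last by move: r0 kile; clear; lia.
rewrite (p_densE K0 mu0 p01 hB); last 2 first.
- by move: r0 rltk; clear; lia.
- by move: vt; rewrite /= in_itv.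
have -> : (k - (k - r).+1 + 1)%N = r by move: r0 rltk; clear; lia.
rewrite !muleA -!EFinM; congr (_%:E * _).
by rewrite mulfK// sne.
Qed.

Lemma min_cost_recursion i k (u : R) : (0 < i < n)%N -> (0 < k <= i)%N -> (0 <= u)%R ->
  min_cost S omega n i k u =
  ereal_inf
    [set (omega * fbar K mu p B k u t + (1 - omega) * hbar K mu p B k u)%:E
      + \sum_(2 <= l < k.+1)
          \int[leb]_(v in `]0%R, t[)
            ((p_dens K mu p B k l u v t)%:E * min_cost S omega n i.+1 l v)
      + (P_down K mu p B k u t)%:E * min_cost S omega n i.+1 1 0
      + (P_up B u t)%:E * min_cost S omega n i.+1 k.+1 (u + t)
    | t in `[0%R, +oo[].
Proof.
move=> i1n ki u0; have /andP[i0 ilt] := i1n.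
rewrite min_costE//; last exact: ltnW.
rewrite (bellman_equation mu0 p01 omega01 J_bellman J_last J_local J_nonneg_measurable)//.
rewrite -ereal_infZl; last by rewrite invr_gt0 (survival_gt0 K0 mu0 p01 hB).
congr ereal_inf; apply: eq_imagel => t /=; rewrite in_itv/= andbT => t0.
exact: normalized_bellman.
Qed.

End minimal_cost.
Theorem theorem3 (R : realType) (d : measure_display) (T : measurableType d)
    (P : probability T R) (n K : nat) (mu p omega : R)
    (B : {RV P >-> R}) (S : nat -> {RV P >-> R})
    (hn : (0 < n)%N) (hK : (0 < K)%N) (hmu : 0 < mu)
    (hp : 0 <= p <= 1) (homega : 0 <= omega <= 1)
    (hB : erlang_mixture K mu p B)
    (hcopies : forall j : nat, (1 <= j <= n)%N ->
       forall A : set R, measurable A ->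
         distribution P (S j) A = distribution P B A)
    (hindep : mutually_independent n S) :
  (forall (i k : nat) (u : R), (1 <= i <= n.-1)%N -> (1 <= k <= i)%N -> 0 <= u ->
     min_cost S omega n i k u =
     ereal_inf
       [set ((omega * fbar K mu p B k u t + (1 - omega) * hbar K mu p B k u)%:E
             + \sum_(2 <= l < k.+1)
                 \int[lebesgue_measure]_(v in `]0%R, t[)
                   ((p_dens K mu p B k l u v t)%:E * min_cost S omega n i.+1 l v)
             + (P_down K mu p B k u t)%:E * min_cost S omega n i.+1 1 0
             + (P_up B u t)%:E * min_cost S omega n i.+1 k.+1 (u + t))%E
       | t in `[0, +oo[])
  /\
  (forall (k : nat) (u : R), (1 <= k <= n)%N -> 0 <= u ->
     min_cost S omega n n k u = ((1 - omega) * hbar K mu p B k u)%:E).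
Proof.
split => [i k u i1 ki u0|k u kn u0].
  apply: min_cost_recursion => //.
  by move: i1; case: n hn {hcopies hindep} => // m _ /=; rewrite ltnS.
exact: min_cost_last.
Qed.
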